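(* Let $X$ be a computable Polish space, $\nu$ a computable Borel probability measure on $X$, and $(\mathscr F_n)$ an almost-full effective filtration equipped uniformly with Kurtz disintegrations. Let $p>1$ be a computable real. Then for $x\in X$ the following are equivalent: (1) $x\in\mathsf{MDR}^{\nu,p}$; (2) $x\in\mathsf{KR}^\nu$ and $f(x)=\lim_n\mathbb E_\nu[f\mid\mathscr F_n](x)$ for all $L_p(\nu)$ maximal Doob tests $f$; (3) $x\in\mathsf{KR}^\nu$ and $\lim_n\mathbb E_\nu[f\mid\mathscr F_n](x)$ exists for all $L_p(\nu)$ maximal Doob tests $f$. Here limits are required to exist and be finite.
   Context: A computable Polish space is a Polish space $X$ with a distinguished dense sequence $x_0,x_1,\dots$ and a compatible complete metric $d$ with $d(x_i,x_j)$ uniformly computable. An open set is c.e. open if it equals $\bigcup_i B(x_{n(i)},r_i)$ for computable $n(\cdot)$ and a computable sequence of positive rationals $r_i$. A function $f:X\to(-\infty,\infty]$ is lower semi-computable (lsc) if the sets $f^{-1}(q,\infty]$, $q\in\mathbb Q$, are uniformly c.e. open. A Borel probability measure $\nu$ is computable if $\nu(U)$ is left-c.e. uniformly in the c.e. open $U$. For computable $p\ge1$, an $L_p(\nu)$ Schnorr test is an lsc $f:X\to[0,\infty]$ with $\|f\|_p$ a computable real. $\mathsf{KR}^\nu$ is the set of points in every c.e. open set of $\nu$-measure 1. An $L_p(\nu)$ maximal Doob test is an lsc $f:X\to[0,\infty]$ with $\|f\|_p<\infty$ for which there is a uniformly computable sequence $(f_s)$ of $L_p(\nu)$ Schnorr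 tests such that: (i) $0\le f_s\le f_{s+1}$ on $\mathsf{KR}^\nu$ and $f=\sup_sf_s$ on $\mathsf{KR}^\nu$; (ii) $f-f_s$ is equal on $\mathsf{KR}^\nu$ to a nonnegative lsc function; (iii) for $t>s$, $f_t-f_s$ is equal on $\mathsf{KR}^\nu$ to an $L_p(\nu)$ Schnorr test, uniformly in $t>s$; (iv) for every $k\ge0$, $\sum_s\|f-f_s\|_p(s+1)^k<\infty$. $\mathsf{MDR}^{\nu,p}$ is the set of $x$ with $f(x)<\infty$ for all $L_p(\nu)$ maximal Doob tests $f$. A $\nu$-computable basis is a computable sequence of c.e. open sets such that every c.e. open set is effectively a union of its members, finite unions of members have uniformly computable $\nu$-measure, and each member is uniformly paired with an effectively closed superset of equal $\nu$-measure. An almost-full effective filtration is an increasing sequence $(\mathscr F_n)$ of $\sigma$-algebras, $\mathscr F_n$ generated by a sequence $\{A_{n,m}\}_m$, uniformly computable in $n,m$, of members of the algebra generated by a $\nu$-computable basis, with a uniform procedure computing from a c.e. open $U$ a sequence $A_{n_i,m_i}$ with $U\cap\mathsf{KR}^\nu=\bigcup_iA_{n_i,m_i}\cap\mathsf{KR}^\nu$. For countably generated $\mathscr F$, $[x]_{\mathscr F}$ is the set of points in exactly the same members of $\mathscr F$ as $x$. A Borel measurable $\rho:X\to\mathcal M^+(X)$ (finite nonnegative Borel measures) is a Kurtz disintegration of $\mathscr F$ with respect to $\nu$ if: (a) for every Borel $f$ with $\int|f|d\nu<\infty$, $x\mapsto\int f\,d\rho_x$ is a version of the conditional expectation of $f$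 given $\mathscr F$; (b) for $x\in\mathsf{KR}^\nu$, $\rho_x(X)=1$ and $\rho_x([x]_{\mathscr F}\cap\mathsf{KR}^\nu)=1$; (c) $x\mapsto\rho_x(U)$ is lsc uniformly in c.e. open $U$. Equipped uniformly: each $\rho^{(n)}$ is such for $\mathscr F_n$, uniformly in $n$; $\mathbb E_\nu[f\mid\mathscr F_n](x)=\int f\,d\rho^{(n)}_x$. *)

(* Defs.v *)
From Stdlib Require Cantor.
From HB Require Import structures.
From mathcomp Require Import all_boot all_order all_algebra.
From mathcomp Require Import all_classical all_reals all_analysis.
From mathcomp Require Import measurable_realfun.

Set Implicit Arguments.
Unset Strict Implicit.
Unset Printing Implicit Defensive.

Import Order.TTheory GRing.Theory Num.Theory numFieldNormedType.Exports.

Local Open Scope classical_set_scope.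
Local Open Scope ring_scope.

(** * Partial recursive functions on [nat] *)

(* Cantor's pairing bijection *)
Definition npair (i j : nat) : nat := Cantor.to_nat (i, j).
Definition nfst (n : nat) : nat := (Cantor.of_nat n).1.
Definition nsnd (n : nat) : nat := (Cantor.of_nat n).2.

(* Programs for unary partial recursive functions; functions of several
   arguments take them paired. *)
Inductive program : Type :=
| Zero | Succ | Fst | Snd
| Pair of program & program
| Comp of program & program
| Prec of program & program
| Mini of program.

(* [evaluates c n m]: the program c halts on the input n with output m.
   - [Prec f g] on (x, k): h(0) = f(x), h(i+1) = g(x, (i, h(i))), output h(k);
   - [Mini f] on x: the least m with f(x, m) = 0, all the f(x, i) with i < m
     being defined. *)
Fixpoint evaluates (c : program) (n m : nat) : Prop :=
  match c with
  | Zero => m = 0%N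
  | Succ => m = n.+1
  | Fst => m = nfst n
  | Snd => m = nsnd n
  | Pair f g =>
      exists u v, [/\ evaluates f n u, evaluates g n v & m = npair u v]
  | Comp f g => exists2 u, evaluates g n u & evaluates f u m
  | Prec f g =>
      exists h : nat -> nat,
        [/\ evaluates f (nfst n) (h 0%N),
            forall i, (i < nsnd n)%N ->
              evaluates g (npair (nfst n) (npair i (h i))) (h i.+1)
          & m = h (nsnd n)]
  | Mini f =>
      evaluates f (npair n m) 0 /\
      forall i, (i < m)%N -> exists v, evaluates f (npair n i) v.+1
  end.

Definition computes (c : program) (e : nat -> nat) : Prop :=
  forall n, evaluates c n (e n).

Definition computable (e : nat -> nat) : Prop := exists c, computes c e.

(* Gödel numbers *)
Fixpoint program_index (c : program) : nat :=
  match c with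
  | Zero => npair 0 0
  | Succ => npair 1 0
  | Fst => npair 2 0
  | Snd => npair 3 0
  | Pair f g => npair 4 (npair (program_index f) (program_index g))
  | Comp f g => npair 5 (npair (program_index f) (program_index g))
  | Prec f g => npair 6 (npair (program_index f) (program_index g))
  | Mini f => npair 7 (program_index f)
  end.

(* A single algorithm produces, from the parameter i and from any index of a
   computable function e, a function g related to i and e by P. *)
Definition effectively (P : nat -> (nat -> nat) -> (nat -> nat) -> Prop) : Prop :=
  exists F : program, forall (i : nat) (c : program) (e : nat -> nat),
    computes c e ->
    exists2 g : nat -> nat,
      forall k, evaluates F (npair i (npair (program_index c) k)) (g k)
      & P i e g.

(* The set enumerated by e.  The value 0 enumerates nothing, so that a total
   enumeration may list the empty set. *)
Definition enumerated (e : nat -> nat) : set nat := [set j | exists k, e k = j.+1].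

Fixpoint seq_index (s : seq nat) : nat :=
  if s is j :: s' then (npair j (seq_index s')).+1 else 0%N.

(** * Rationals and computable reals *)

Section Reals.
Variable R : realType.

Definition qval (n : nat) : R :=
  ((nfst (nfst n))%:R - (nsnd (nfst n))%:R) / (nsnd n).+1%:R.

Definition posqval (n : nat) : R := (nfst n).+1%:R / (nsnd n).+1%:R.

Definition cauchy_name (g : nat -> nat) (x : R) : Prop :=
  forall k, `|x - qval (g k)| <= 2^-1 ^+ k.

Definition computable_real (x : R) : Prop :=
  exists2 g, computable g & cauchy_name g x.

Definition uniformly_computable_reals (x : nat -> R) : Prop :=
  exists2 g, computable g & forall i, cauchy_name (fun k => g (npair i k)) (x i).

Definition left_name (g : nat -> nat) (x : \bar R) : Prop :=
  nondecreasing_seq (fun k => qval (g k)) /\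
  (qval (g k))%:E @[k --> \oo] --> x.

End Reals.

(** * Computable Polish spaces *)

#[short(type="completeMetricType")]
HB.structure Definition CompleteMetric (R : numDomainType) :=
  {T of Complete T & Metric R T}.

Definition borel (R : realType) (X : completeMetricType R) :=
  g_sigma_algebraType (@open X).

Section Randomness.
Variables (R : realType) (X : completeMetricType R).
(* the distinguished dense sequence *)
Variable a : nat -> X.

Definition computable_polish : Prop :=
  dense (range a) /\
  uniformly_computable_reals (fun n => mdist (a (nfst n)) (a (nsnd n))).

Definition basic_ball (j : nat) : set X := ball (a (nfst j)) (posqval R (nsnd j)).

Definition open_of (e : nat -> nat) : set X :=
  \bigcup_(j in enumerated e) basic_ball j.

Definition ce_open (U : set X) : Prop :=
  exists2 e, computable e & U = open_of e.

Definition uniformly_ce_open (U : nat -> set X) : Prop :=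
  exists2 e, computable e & forall i, U i = open_of (fun k => e (npair i k)).

Definition lsc_name (g : nat -> nat) (f : X -> \bar R) : Prop :=
  forall q, [set x | ((qval R q)%:E < f x)%E] = open_of (fun k => g (npair q k)).

Definition lsc (f : X -> \bar R) : Prop :=
  exists2 g, computable g & lsc_name g f.

Definition uniformly_lsc (f : nat -> X -> \bar R) : Prop :=
  exists2 g, computable g & forall i, lsc_name (fun k => g (npair i k)) (f i).

Variable nu : probability (borel X) R.

Definition computable_measure : Prop :=
  effectively (fun _ e g => left_name g (nu (open_of e))).

(* Kurtz random points *)
Definition KR : set X :=
  [set x | forall U, ce_open U -> nu U = 1%E -> U x].

(** * Schnorr tests and maximal Doob tests *)

Definition uniform_schnorr_tests (p : R) (f : nat -> X -> \bar R) : Prop :=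
  [/\ uniformly_lsc f,
      forall s x, (0 <= f s x)%E
    & exists2 r : nat -> R, uniformly_computable_reals r &
        forall s, ('N[nu]_(p%:E)[f s] = (r s)%:E)%E].

(* The difference of two [0, +oo]-valued functions f >= g is undefined where
   both are infinite; everywhere else on KR it is h. *)
Definition difference_is (f g h : X -> \bar R) : Prop :=
  forall x, KR x -> (g x < +oo)%E -> (f x - g x = h x)%E.

(* In the last clause f and fs s are infinite only on a nu-null set, so the
   value given there to f \- fs s does not affect its norm. *)
Definition doob_approximation (p : R) (f : X -> \bar R)
    (fs : nat -> X -> \bar R) : Prop :=
  [/\ uniform_schnorr_tests p fs,
      forall x, KR x ->
        (forall s, 0 <= fs s x <= fs s.+1 x)%E /\
        f x = ereal_sup (range (fun s => fs s x)),
      forall s, exists h : X -> \bar R,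
        [/\ lsc h, forall x, (0 <= h x)%E & difference_is f (fs s) h],
      exists2 h : nat -> nat -> X -> \bar R,
        uniform_schnorr_tests p (fun n => h (nfst n) (nsnd n)) &
        forall s t, (s < t)%N -> difference_is (fs t) (fs s) (h s t)
    & forall k : nat,
        (\sum_(0 <= s <oo) 'N[nu]_(p%:E)[f \- fs s] * ((s.+1 ^ k)%N%:R)%:E < +oo)%E].

Definition maximal_doob_test (p : R) (f : X -> \bar R) : Prop :=
  [/\ lsc f, forall x, (0 <= f x)%E, ('N[nu]_(p%:E)[f] < +oo)%E
    & exists fs, doob_approximation p f fs].

Definition MDR (p : R) : set X :=
  [set x | forall f, maximal_doob_test p f -> (f x < +oo)%E].

(** * Bases and filtrations *)

Definition computable_basis (B : nat -> set X) : Prop :=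
  [/\ uniformly_ce_open B,
      effectively (fun _ e g => open_of e = \bigcup_(j in enumerated g) B j),
      exists2 g, computable g &
        forall s : seq nat,
          cauchy_name (fun k => g (npair (seq_index s) k))
            (fine (nu (\bigcup_(j in [set` s]) B j)))
    & exists2 C : nat -> set X, uniformly_ce_open (fun j => ~` C j) &
        forall j, B j `<=` C j /\ nu (C j) = nu (B j)].

(* The algebra of sets generated by a sequence consists of the values of these
   terms. *)
Inductive set_term : Type :=
| TAtom of nat
| TEmpty
| TCompl of set_term
| TUnion of set_term & set_term.

Fixpoint set_term_val (B : nat -> set X) (t : set_term) : set X :=
  match t with
  | TAtom j => B j
  | TEmpty => set0
  | TCompl u => ~` set_term_val B u
  | TUnion u v => set_term_val B u `|` set_term_val B v
  end.

Fixpoint set_term_index (t : set_term) : nat :=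
  match t with
  | TAtom j => npair 0 j
  | TEmpty => npair 1 0
  | TCompl u => npair 2 (set_term_index u)
  | TUnion u v => npair 3 (npair (set_term_index u) (set_term_index v))
  end.

Definition uniformly_in_algebra (B : nat -> set X) (A : nat -> nat -> set X) : Prop :=
  exists2 t : nat -> nat -> set_term,
    computable (fun n => set_term_index (t (nfst n) (nsnd n))) &
    forall n m, A n m = set_term_val B (t n m).

Definition almost_full_effective_filtration (F : nat -> set (set X)) : Prop :=
  (forall m n, (m <= n)%N -> F m `<=` F n) /\
  exists A : nat -> nat -> set X,
    [/\ forall n, F n = <<s range (A n) >>,
        exists2 B, computable_basis B & uniformly_in_algebra B A
      & effectively (fun _ e g =>
          open_of e `&` KR =
          (\bigcup_(j in enumerated g) A (nfst j) (nsnd j)) `&` KR)].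

(** * Kurtz disintegrations *)

(* the atom [x]_F *)
Definition atom (F : set (set X)) (x : X) : set X :=
  [set y | forall A, F A -> (A x <-> A y)].

(* g is a version of the conditional expectation of f given F *)
Definition cond_expectation (F : set (set X)) (f g : X -> \bar R) : Prop :=
  [/\ forall B : set (\bar R), measurable B -> F (g @^-1` B),
      nu.-integrable setT (g : borel X -> \bar R)
    & forall A, F A ->
        (\int[nu]_(x in (A : set (borel X))) g x =
         \int[nu]_(x in (A : set (borel X))) f x)%E].

(* Borel measurability into the space of finite measures, whose Borel sigma-
   algebra is generated by the evaluations, is that of the kernel rho. *)
Definition kurtz_disintegration (F : set (set X))
    (rho : R.-ker (borel X) ~> (borel X)) : Prop :=
  [/\ forall x, (rho x setT < +oo)%E,
      forall f : borel X -> \bar R, nu.-integrable setT f ->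
        cond_expectation F f (fun x => \int[rho x]_y f y)%E
    & forall x, KR x -> rho x setT = 1%E /\ rho x (atom F x `&` KR) = 1%E].

(* Clause (c) of Kurtz disintegrations is asked uniformly in n, which contains
   it for each n. *)
Definition uniform_kurtz_disintegrations (F : nat -> set (set X))
    (rho : nat -> R.-ker (borel X) ~> (borel X)) : Prop :=
  (forall n, kurtz_disintegration (F n) (rho n)) /\
  effectively (fun n e g => lsc_name g (fun x => rho n x (open_of e))).

End Randomness.

(* Main.v *)
(* The three conditions are linked by two bounds on the conditional expectations
   f_n = E[f | F_n] of a maximal Doob test f.

   On the Kurtz random points an open set where f exceeds a rational is a union
   of sets of the filtration, and rho^n_x lives on the atom of x. Hence
   liminf f_n(x) >= f(x) for Kurtz random x, which gives (3) => (1).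

   For (1) => (2), replace the approximations fs_s of f by simple functions
   Phi_s <= fs_s, increasing in s, that are measurable with respect to some F_n
   with n = L s computable and satisfy ||(fs_s - Phi_s)^+||_p <= 4^-s. Put
   D_s = Phi_(s+1) - Phi_s. Since D_s is its own conditional expectation from a
   computable n on, its maximal function M_s = max_n E[D_s | F_n] is a finite
   maximum, hence computable on KR, and Doob's inequality gives
   ||M_s||_p <= 2 p/(p-1) ||D_s||_p. The norms decrease fast enough for
   sum_s M_s to be a maximal Doob test again, so this sum is finite at x. As
   f_n(x) <= f(x) + sum_(s >= S) M_s(x) as soon as n >= L S, the limsup of
   f_n(x) is at most f(x).

   A point of MDR is Kurtz random because the complement of a c.e. open set of
   measure 1 is covered by a sequence of open sets, shrinking to a null set,
   from which a maximal Doob test infinite on the complement is built.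

   Effectiveness is expressed by predicates [eff_open O D P]: inside D the sets
   [P n] are unions of members of the base O, enumerated uniformly in n. Values
   in [-oo, +oo] are effective from below or above when their strict rational
   cuts are. *)

Require Import Defs.
From mathcomp Require Import all_boot all_order all_algebra.
From mathcomp Require Import all_classical all_reals all_analysis.
From mathcomp Require Import measurable_realfun.
From mathcomp Require Import zify ring lra.

Set Implicit Arguments.
Unset Strict Implicit.
Unset Printing Implicit Defensive.

Import Order.TTheory GRing.Theory Num.Theory numFieldNormedType.Exports.

Local Open Scope classical_set_scope.

(** * Computable functions *)

(** The obstacle is to bound norms effectively from above. The supremum over all [n] of the
    conditional expectations of [fs t - fs s] is effective from below, but nothing computes its norm
    from above, so it need not be a Schnorr test. Passing to [Phi s], constant on the atoms of a
    computable level, leaves a finite maximum of bounded functions. For a function [D] with a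
    computable bound [c], upper cuts come from lower cuts of [c - D], because [nu] and, at Kurtz
    random points, the disintegrations have mass 1. The price is that members of the filtration and
    their complements are open effectively only inside [KR]; [lsc_extension] returns to functions
    that are lower semi-computable everywhere and unchanged on [KR].

    The residual [fs s - Phi s] is controlled through u^p + v^p <= (u + v)^p: a small gap between
    the integrals of the p-th powers bounds the p-th power of the norm of the difference. Such a gap
    is found by search, since both integrals are computable. With a residual norm of at most 4^-s,
    the increments of [Phi] inherit from [f - fs s] summability against all polynomial weights. *)

Lemma nfst_npair i j : nfst (npair i j) = i.
Proof. by rewrite /nfst /npair Cantor.cancel_of_to. Qed.

Lemma nsnd_npair i j : nsnd (npair i j) = j.
Proof. by rewrite /nsnd /npair Cantor.cancel_of_to. Qed.

Lemma npairK n : npair (nfst n) (nsnd n) = n.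
Proof.
by rewrite /npair /nfst /nsnd -surjective_pairing Cantor.cancel_to_of.
Qed.

Lemma npair_inj i j i' j' : npair i j = npair i' j' -> i = i' /\ j = j'.
Proof.
move=> e; split; first by rewrite -(nfst_npair i j) e nfst_npair.
by rewrite -(nsnd_npair i j) e nsnd_npair.
Qed.

Lemma leq_npair i j : (i + j <= npair i j)%N.
Proof.
rewrite /npair; have := Cantor.to_nat_non_decreasing i j.
by move/ssrnat.leP; rewrite addnC.
Qed.

Lemma ltn_npairr i j : (0 < i)%N -> (j < npair i j)%N.
Proof.
by move=> i0; apply: leq_trans (leq_npair i j); rewrite -addn1 addnC leq_add2r.
Qed.

Definition npairE := (nfst_npair, nsnd_npair, npairK).

Opaque npair nfst nsnd.

Lemma eq_computable f g : f =1 g -> computable f -> computable g.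
Proof. by move=> /funext ->. Qed.

Lemma computable_fst f : computable f -> computable (fun n => nfst (f n)).
Proof. by move=> [c h]; exists (Comp Fst c) => n; exists (f n) => //=. Qed.

Lemma computable_snd f : computable f -> computable (fun n => nsnd (f n)).
Proof. by move=> [c h]; exists (Comp Snd c) => n; exists (f n) => //=. Qed.

Lemma computable_succ f : computable f -> computable (fun n => (f n).+1).
Proof. by move=> [c h]; exists (Comp Succ c) => n; exists (f n) => //=. Qed.

Lemma computable_pair f g : computable f -> computable g ->
  computable (fun n => npair (f n) (g n)).
Proof.
by move=> [c h] [d k]; exists (Pair c d) => n; exists (f n), (g n).
Qed.

Lemma computable_comp f g : computable f -> computable g ->
  computable (fun n => f (g n)).
Proof. by move=> [c h] [d k]; exists (Comp c d) => n; exists (g n). Qed.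

Lemma computable_id : computable (fun n => n).
Proof.
by exists (Pair Fst Snd) => n; exists (nfst n), (nsnd n); rewrite npairK.
Qed.

Fixpoint const_program (m : nat) : program :=
  if m is m'.+1 then Comp Succ (const_program m') else Zero.

Lemma const_programP m n : evaluates (const_program m) n m.
Proof. by elim: m => //= m IH; exists m. Qed.

Lemma computable_const m : computable (fun _ => m).
Proof. by exists (const_program m) => n; exact: const_programP. Qed.

Lemma computable_rec f g b : computable f ->
  computable (fun n => g (nfst n) (nfst (nsnd n)) (nsnd (nsnd n))) ->
  computable b ->
  computable (fun x => nat_rect (fun=> nat) (f x) (g x) (b x)).
Proof.
move=> [c hc] [d hd] [e he].
exists (Comp (Prec c d) (Pair (Pair Fst Snd) e)) => x.
exists (npair x (b x)).
  by exists x, (b x); split => //=; exists (nfst x), (nsnd x); rewrite npairK.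
exists (nat_rect (fun=> nat) (f x) (g x)); split; rewrite ?npairE //= => i _.
by have := hd (npair x (npair i (nat_rect (fun=> nat) (f x) (g x) i)));
  rewrite !npairE.
Qed.

Lemma computable_mini f : computable (fun n => f (nfst n) (nsnd n)) ->
  (forall n, exists m, f n m = 0%N) ->
  exists2 h, computable h & forall n, f n (h n) = 0%N.
Proof.
move=> [c hc] hex.
have hex' n : exists m, f n m == 0%N by have [m /eqP] := hex n; exists m.
exists (fun n => ex_minn (hex' n)); last by move=> n; case: ex_minnP => m /eqP.
exists (Mini c) => n; case: ex_minnP => m /eqP fm mmin; split.
  by have := hc (npair n m); rewrite !npairE fm.
move=> i im; exists (f n i).-1.
have fi0 : f n i != 0%N by apply/negP => /mmin; rewrite leqNgt im.
by rewrite prednK ?lt0n//; have := hc (npair n i); rewrite !npairE.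
Qed.

Create HintDb comp discriminated.
#[global] Hint Resolve computable_id computable_const computable_fst
  computable_snd computable_succ computable_pair : comp.
#[global] Hint Constants Opaque : comp.

Ltac comp := auto 100 with comp nocore.

Lemma computable_pred f : computable f -> computable (fun n => (f n).-1).
Proof.
move=> hf.
have := @computable_rec (fun=> 0%N) (fun _ i _ => i) f.
move=> /(_ _ _ hf) H.
by apply: eq_computable (H _ _) => [n /=||]; [case: (f n)|comp|comp].
Qed.

Lemma computable_add f g : computable f -> computable g ->
  computable (fun n => f n + g n)%N.
Proof.
move=> hf hg.
apply: eq_computable (computable_rec (f := f) (g := fun _ _ r => r.+1) hf _ hg).
  by move=> x /=; elim: (g x) => [|m IH] /=; rewrite ?addn0 // IH addnS.
by comp.
Qed.
#[global] Hint Resolve computable_pred computable_add : comp.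

Lemma computable_mul f g : computable f -> computable g ->
  computable (fun n => f n * g n)%N.
Proof.
move=> hf hg.
apply: eq_computable (computable_rec (f := fun=> 0%N)
  (g := fun x _ r => (f x + r)%N) _ _ hg); first last.
- by apply: computable_add; [apply: computable_comp => //|]; comp.
- by comp.
- by move=> x /=; elim: (g x) => [|m IH] /=; rewrite ?muln0 // IH mulnS.
Qed.

Lemma computable_sub f g : computable f -> computable g ->
  computable (fun n => f n - g n)%N.
Proof.
move=> hf hg.
apply: eq_computable (computable_rec (f := f)
  (g := fun x _ r => r.-1) _ _ hg) => //; last by comp.
by move=> x /=; elim: (g x) => [|m IH] /=; rewrite ?subn0 // IH subnS.
Qed.
#[global] Hint Resolve computable_mul computable_sub : comp.

Lemma computable_if (b : nat -> bool) f g :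
  computable (fun n => b n : nat) -> computable f -> computable g ->
  computable (fun n => if b n then f n else g n).
Proof.
move=> hb hf hg.
apply: eq_computable (_ : computable (fun n => b n * f n + (1 - b n) * g n)%N).
  by move=> n; case: (b n); rewrite /= ?mul1n ?subnn ?addn0// subn0 mul1n.
by comp.
Qed.

Lemma computable_leq f g : computable f -> computable g ->
  computable (fun n => (f n <= g n)%N : nat).
Proof.
move=> hf hg.
apply: eq_computable (_ : computable (fun n => 1 - (f n - g n))%N); last by comp.
by move=> n; rewrite /leq; case: (f n - g n)%N.
Qed.

Lemma computable_negb (b : nat -> bool) : computable (fun n => b n : nat) ->
  computable (fun n => ~~ b n : nat).
Proof.
move=> hb; apply: eq_computable (_ : computable (fun n => 1 - b n)%N); last by comp.
by move=> n; case: (b n).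
Qed.

Lemma computable_andb (b c : nat -> bool) : computable (fun n => b n : nat) ->
  computable (fun n => c n : nat) -> computable (fun n => b n && c n : nat).
Proof.
move=> hb hc; apply: eq_computable (_ : computable (fun n => b n * c n)%N); last by comp.
by move=> n; case: (b n); case: (c n).
Qed.
#[global] Hint Resolve computable_if computable_leq computable_negb computable_andb : comp.

Lemma computable_orb (b c : nat -> bool) : computable (fun n => b n : nat) ->
  computable (fun n => c n : nat) -> computable (fun n => b n || c n : nat).
Proof.
move=> hb hc.
apply: eq_computable (_ : computable (fun n => ~~ (~~ b n && ~~ c n) : nat)); last by comp.
by move=> n; rewrite negb_and !negbK.
Qed.

Lemma computable_eqn f g : computable f -> computable g ->
  computable (fun n => f n == g n : nat).
Proof.
move=> hf hg.
apply: eq_computable (_ : computable (fun n => (f n <= g n) && (g n <= f n) : nat)%N);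
  last by comp.
by move=> n; rewrite eqn_leq.
Qed.
#[global] Hint Resolve computable_orb computable_eqn : comp.

Lemma computable_exp f g : computable f -> computable g ->
  computable (fun n => f n ^ g n)%N.
Proof.
move=> hf hg.
apply: eq_computable (computable_rec (f := fun=> 1%N)
  (g := fun x _ r => (f x * r)%N) _ _ hg) => //.
- by move=> x /=; elim: (g x) => [|m IH] /=; rewrite ?expn0 // IH expnS.
- by comp.
- by apply: computable_mul; [apply: (computable_comp (f := f)) => //|]; comp.
Qed.

(* The sequence coded by [s] lists the left components met along the right
   spine of [s], so that every finite sequence has a code. *)
Definition nnth (s i : nat) : nat := nfst (iter i nsnd s).

Lemma computable_nnth f g : computable f -> computable g ->
  computable (fun n => nnth (f n) (g n)).
Proof.
move=> hf hg; apply: computable_fst.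
apply: eq_computable (computable_rec (f := f)
  (g := fun _ _ r => nsnd r) hf _ hg) => //; comp.
Qed.
#[global] Hint Resolve computable_exp computable_nnth : comp.

Lemma nnth_code (h : nat -> nat) n :
  exists s, forall i, (i < n)%N -> nnth s i = h i.
Proof.
elim: n h => [|n IH] h; first by exists 0%N.
have [s hs] := IH (fun i => h i.+1); exists (npair (h 0%N) s) => -[|i] i_n.
  by rewrite /nnth /= npairE.
by rewrite /nnth iterSr npairE; exact: hs.
Qed.

Lemma computable_all (b : nat -> nat -> bool) f :
  computable (fun n => b (nfst n) (nsnd n) : nat) -> computable f ->
  computable (fun n => all (b n) (iota 0 (f n)) : nat).
Proof.
move=> hb hf.
apply: eq_computable (computable_rec (f := fun=> 1%N)
  (g := fun x i r => (b x i * r)%N) _ _ hf).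
- move=> x /=; elim: (f x) => [//|m IH].
  rewrite -[in RHS]addn1 iotaD all_cat /= IH add0n andbT andbC.
  by case: (b x m) => //=; rewrite ?mul1n.
- by comp.
- have h1 : computable (fun n => b (nfst n) (nfst (nsnd n)) : nat).
    apply: eq_computable (computable_comp (g := fun n => npair (nfst n) (nfst (nsnd n))) hb _) => [n|].
      by rewrite !npairE.
    by comp.
  by comp.
Qed.

Lemma allP_iota (b : nat -> bool) n :
  reflect (forall i, (i < n)%N -> b i) (all b (iota 0 n)).
Proof.
apply: (iffP allP) => h i; first by move=> i_n; apply: h; rewrite mem_iota.
by rewrite mem_iota; exact: h.
Qed.

Lemma computable_sum (g : nat -> nat -> nat) f :
  computable (fun n => g (nfst n) (nsnd n)) -> computable f ->
  computable (fun n => \sum_(i < f n) g n i)%N.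
Proof.
move=> hg hf.
apply: eq_computable (computable_rec (f := fun=> 0%N)
  (g := fun x i r => (r + g x i)%N) _ _ hf).
- move=> x /=; elim: (f x) => [|m IH] /=; first by rewrite big_ord0.
  by rewrite big_ord_recr /= IH.
- by comp.
- have h1 : computable (fun n => g (nfst n) (nfst (nsnd n))).
    apply: eq_computable (computable_comp (g := fun n => npair (nfst n) (nfst (nsnd n))) hg _) => [n|].
      by rewrite !npairE.
    by comp.
  by comp.
Qed.

(** * Gödel numbers and parametrization *)

Lemma program_index_inj : injective program_index.
Proof.
elim=> [||||f IHf g IHg|f IHf g IHg|f IHf g IHg|f IHf];
  case=> [||||f' g'|f' g'|f' g'|f'] /= /npair_inj [] // _;
  by [move=> /npair_inj [/IHf -> /IHg ->]|move=> /IHf ->].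
Qed.

Lemma evaluates_functional c n m m' :
  evaluates c n m -> evaluates c n m' -> m = m'.
Proof.
elim: c n m m' => [||||f IHf g IHg|f IHf g IHg|f IHf g IHg|f IHf] n m m' /=;
  do ?by move=> -> ->.
- move=> [u [v [hu hv ->]]] [u' [v' [hu' hv' ->]]].
  by rewrite (IHf _ _ _ hu hu') (IHg _ _ _ hv hv').
- move=> [u hu hm] [u' hu' hm']; rewrite (IHg _ _ _ hu' hu) in hm'.
  exact: IHf hm hm'.
- move=> [h [h0 hS ->]] [h' [h0' hS' ->]].
  elim: (nsnd n) hS hS' => [|k IH] hS hS'; first exact: IHf h0 h0'.
  have e : h k = h' k by apply: IH => i ik; [apply: hS|apply: hS']; exact: ltnW.
  by have := hS' k (ltnSn k); rewrite -e; apply: IHg; exact: hS.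
- move=> [hm hi] [hm' hi']; case: (ltngtP m m') => // [/hi'|/hi].
    by move=> [v /IHf /(_ hm)].
  by move=> [v /IHf /(_ hm')].
Qed.

Lemma computes_functional c e e' : computes c e -> computes c e' -> e = e'.
Proof.
by move=> h h'; apply/funext => n; exact: evaluates_functional (h n) (h' n).
Qed.

(* The s-m-n theorem in the form needed here: sections of a computable binary
   function have computable indices. *)
Lemma effectively_uniform P e h : effectively P -> computable e -> computable h ->
  exists2 g, computable g &
    forall i, P (h i) (fun k => e (npair i k)) (fun k => g (npair i k)).
Proof.
move=> [F hF] [c hc] hh.
pose id_program := Pair Fst Snd.
pose sect i := Comp c (Pair (const_program i) id_program).
have hsect i : computes (sect i) (fun k => e (npair i k)).
  move=> k; exists (npair i k) => //; exists i, k; split => //.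
    exact: const_programP.
  by exists (nfst k), (nsnd k); rewrite npairK.
have /choice [g hg] : forall i, exists g : nat -> nat,
    (forall k, evaluates F (npair (h i) (npair (program_index (sect i)) k)) (g k)) /\
    P (h i) (fun k => e (npair i k)) g.
  by move=> i; have [g g1 g2] := hF (h i) _ _ (hsect i); exists g.
(* The index of [sect i] consists of fixed parts and the index of the [i]-fold successor of zero,
   which a recursion on [i] produces. *)
have hidx : computable (fun i => program_index (sect i)).
  have hK : computable (fun i => program_index (const_program i)).
    apply: eq_computable (computable_rec (f := fun=> program_index Zero)
      (g := fun _ _ r => npair 5 (npair (program_index Succ) r)) _ _ computable_id);
      [by elim=> //= i ->|by comp|by comp].
  by rewrite /=; comp.
have [d hd] : computable (fun n => npair (h (nfst n))
    (npair (program_index (sect (nfst n))) (nsnd n))).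
  have h1 := computable_comp hidx (computable_fst computable_id).
  have h2 := computable_comp hh (computable_fst computable_id).
  by apply: computable_pair => //; apply: computable_pair => //; comp.
exists (fun n => g (nfst n) (nsnd n)).
  exists (Comp F d) => n; eexists; first exact: hd.
  by case: (hg (nfst n)).
move=> i; have [_] := hg i.
rewrite (_ : (fun k => _ (nfst (npair i k)) _) = g i) //.
by apply/funext => k; rewrite !npairE.
Qed.

Local Open Scope ring_scope.

(** * Rational numbers *)

Section Rationals.
Variable R : realType.

Definition qcode (a b c : nat) : nat := npair (npair a b) c.

Lemma qval_qcode a b c : qval R (qcode a b c) = (a%:R - b%:R) / c.+1%:R.
Proof. by rewrite /qval /qcode !npairE. Qed.

Definition rational_seq (x : nat -> R) : Prop :=
  exists2 f, computable f & forall n, x n = qval R (f n).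

Lemma rational_seq_qval f : computable f -> rational_seq (fun n => qval R (f n)).
Proof. by exists f. Qed.

Lemma rational_seq_nat f : computable f -> rational_seq (fun n => (f n)%:R).
Proof.
move=> hf; exists (fun n => qcode (f n) 0 0); first by rewrite /qcode; comp.
by move=> n; rewrite qval_qcode subr0 divr1.
Qed.

Lemma rational_seq_invnat f : computable f -> rational_seq (fun n => (f n).+1%:R^-1).
Proof.
move=> hf; exists (fun n => qcode 1 0 (f n)); first by rewrite /qcode; comp.
by move=> n; rewrite qval_qcode subr0 div1r.
Qed.

Lemma rational_seq_opp x : rational_seq x -> rational_seq (fun n => - x n).
Proof.
move=> [f hf xf].
exists (fun n => qcode (nsnd (nfst (f n))) (nfst (nfst (f n))) (nsnd (f n))).
  by rewrite /qcode; comp.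
by move=> n; rewrite qval_qcode xf /qval -mulNr opprB.
Qed.

Lemma rational_seq_add x y : rational_seq x -> rational_seq y ->
  rational_seq (fun n => x n + y n).
Proof.
move=> [f hf xf] [g hg yg].
exists (fun n => qcode
  (nfst (nfst (f n)) * (nsnd (g n)).+1 + nfst (nfst (g n)) * (nsnd (f n)).+1)
  (nsnd (nfst (f n)) * (nsnd (g n)).+1 + nsnd (nfst (g n)) * (nsnd (f n)).+1)
  ((nsnd (f n)).+1 * (nsnd (g n)).+1).-1).
  by rewrite /qcode; comp.
move=> n; rewrite qval_qcode xf yg /qval prednK// !natrD !natrM.
by field; rewrite !nat1r !pnatr_eq0.
Qed.

Lemma rational_seq_mul x y : rational_seq x -> rational_seq y ->
  rational_seq (fun n => x n * y n).
Proof.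
move=> [f hf xf] [g hg yg].
exists (fun n => qcode
  (nfst (nfst (f n)) * nfst (nfst (g n)) + nsnd (nfst (f n)) * nsnd (nfst (g n)))
  (nfst (nfst (f n)) * nsnd (nfst (g n)) + nsnd (nfst (f n)) * nfst (nfst (g n)))
  ((nsnd (f n)).+1 * (nsnd (g n)).+1).-1).
  by rewrite /qcode; comp.
move=> n; rewrite qval_qcode xf yg /qval prednK// !natrD !natrM.
by field; rewrite !nat1r !pnatr_eq0.
Qed.

Lemma rational_seq_half f : computable f -> rational_seq (fun n => 2^-1 ^+ f n).
Proof.
move=> hf; exists (fun n => qcode 1 0 (2 ^ f n).-1); first by rewrite /qcode; comp.
by move=> n; rewrite qval_qcode subr0 div1r prednK ?expn_gt0// natrX exprVn.
Qed.

Lemma rational_seq_posqval f : computable f -> rational_seq (fun n => posqval R (f n)).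
Proof.
move=> hf; exists (fun n => qcode (nfst (f n)).+1 0 (nsnd (f n))).
  by rewrite /qcode; comp.
by move=> n; rewrite qval_qcode subr0.
Qed.

Lemma eq_rational_seq x y : x =1 y -> rational_seq x -> rational_seq y.
Proof. by move=> /funext ->. Qed.

Lemma rational_seq_comp x f : rational_seq x -> computable f ->
  rational_seq (fun n => x (f n)).
Proof.
move=> [g hg xg] hf; exists (fun n => g (f n)); first exact: computable_comp.
by move=> n; rewrite xg.
Qed.

Lemma computable_ltr x y : rational_seq x -> rational_seq y ->
  computable (fun n => nat_of_bool (x n < y n)%R).
Proof.
move=> [f hf xf] [g hg yg].
(* The fractions are cross-multiplied and negative parts moved to the other side, so that only
   natural numbers are compared. *)
apply: eq_computable (_ : computable (fun n =>
  nfst (nfst (f n)) * (nsnd (g n)).+1 + nsnd (nfst (g n)) * (nsnd (f n)).+1 <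
  nfst (nfst (g n)) * (nsnd (f n)).+1 + nsnd (nfst (f n)) * (nsnd (g n)).+1 : nat)%N);
  last by comp.
move=> n; rewrite xf yg /qval ltr_pdivrMr ?ltr0Sn// mulrAC ltr_pdivlMr ?ltr0Sn//.
rewrite -(ltr_nat R) !natrD !natrM; congr nat_of_bool.
by apply/idP/idP => h; rewrite !mulrBl in h *; lra.
Qed.

Lemma computable_ler x y : rational_seq x -> rational_seq y ->
  computable (fun n => nat_of_bool (x n <= y n)%R).
Proof.
move=> hx hy; apply: eq_computable (computable_negb (computable_ltr hy hx)) => n.
by rewrite leNgt.
Qed.

Lemma rational_seq_exp x f : rational_seq x -> computable f ->
  rational_seq (fun n => x n ^+ f n).
Proof.
move=> hx hf.
have [m hm mE] : rational_seq (fun n => x (nfst n) * qval R (nsnd (nsnd n))).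
  apply: rational_seq_mul; last by apply: rational_seq_qval; comp.
  by apply: rational_seq_comp => //; comp.
exists (fun n => nat_rect (fun=> nat) (qcode 1 0 0)
  (fun i r => m (npair n (npair i r))) (f n)).
  apply: (computable_rec (f := fun=> qcode 1 0 0)
    (g := fun n i r => m (npair n (npair i r)))) hf; first by comp.
  by apply: eq_computable hm => n; rewrite !npairE.
move=> n; elim: (f n) => [|k IH] /=; first by rewrite qval_qcode subr0 divr1.
by rewrite -mE !npairE exprS IH.
Qed.

Lemma rational_seq_sum (x : nat -> nat -> R) f :
  rational_seq (fun n => x (nfst n) (nsnd n)) -> computable f ->
  rational_seq (fun n => \sum_(i < f n) x n i).
Proof.
move=> hx hf.
have [m hm mE] : rational_seq (fun n => qval R (nsnd (nsnd n)) + x (nfst n) (nfst (nsnd n))).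
  apply: rational_seq_add; first by apply: rational_seq_qval; comp.
  apply: eq_rational_seq (rational_seq_comp (f := fun n => npair (nfst n) (nfst (nsnd n))) hx _).
    by move=> n; rewrite !npairE.
  by comp.
exists (fun n => nat_rect (fun=> nat) (qcode 0 0 0)
  (fun i r => m (npair n (npair i r))) (f n)).
  apply: (computable_rec (f := fun=> qcode 0 0 0)
    (g := fun n i r => m (npair n (npair i r)))) hf; first by comp.
  by apply: eq_computable hm => n; rewrite !npairE.
move=> n; elim: (f n) => [|k IH] /=.
  by rewrite big_ord0 qval_qcode subr0 mul0r.
by rewrite big_ord_recr /= -mE !npairE IH.
Qed.

Lemma qval_dense (x y : R) : x < y -> exists n, x < qval R n < y.
Proof.
move=> xy; have [q] := rat_in_itvoo xy; rewrite in_itv /= => hq.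
suff [n nE] : exists n, qval R n = ratr q by exists n; rewrite nE.
have : (0 < denq q)%R by exact: denq_gt0.
case E : (denq q) => [d|//] d0; have {d0} : (0 < d)%N by [].
case: d E => // d E _.
rewrite /ratr E; case: (numq q) => m.
  by exists (qcode m 0 d); rewrite qval_qcode subr0 !pmulrn.
exists (qcode 0 m.+1 d); rewrite qval_qcode sub0r NegzE.
by rewrite mulrNz !pmulrn.
Qed.

Lemma posqval_gt0 n : 0 < posqval R n.
Proof. by rewrite /posqval divr_gt0. Qed.

Lemma posqval_lt (x : R) : 0 < x -> exists n, posqval R n < x.
Proof.
move=> x0; have /qval_dense [n /andP[n0 nx]] := x0.
exists (npair 0 (nsnd n)); rewrite /posqval !npairE.
apply: le_lt_trans nx.
rewrite /qval ler_pM2r ?invr_gt0 ?ltr0Sn//.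
have : 0 < (nfst (nfst n))%:R - (nsnd (nfst n))%:R :> R.
  by move: n0; rewrite /qval pmulr_lgt0 // invr_gt0.
rewrite subr_gt0 ltr_nat => h; rewrite lerBrDr -natrD ler_nat add1n.
exact: h.
Qed.

End Rationals.
#[global] Hint Resolve rational_seq_qval rational_seq_nat rational_seq_invnat rational_seq_opp
  rational_seq_add rational_seq_mul rational_seq_half rational_seq_posqval
 : comp.
#[global] Hint Extern 3 (computable (fun _ => nat_of_bool _)) =>
  first [simple apply computable_ltr|simple apply computable_ler
        |apply: computable_ltr|apply: computable_ler] : comp.
#[global] Hint Extern 3 (rational_seq (fun _ => _ ^+ _)%R) =>
  first [apply: rational_seq_half|apply: rational_seq_exp] : comp.

(** * Effectively open predicates *)

(* [O] plays the role of a base of open sets of [Y]; [sub l j w] says that [w]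
   witnesses a formal inclusion of [O l] in [O j]. *)
Definition effective_base (Y : Type) (O : nat -> set Y) : Prop :=
  exists2 sub : nat -> nat -> nat -> bool,
    computable (fun n => sub (nfst n) (nfst (nsnd n)) (nsnd (nsnd n)) : nat) &
    (forall l j w, sub l j w -> O l `<=` O j) /\
    forall y n (J : nat -> nat), (forall m, (m < n)%N -> O (J m) y) ->
      exists2 l, O l y & forall m, (m < n)%N -> exists w, sub l (J m) w.

Definition eff_open (Y : Type) (O : nat -> set Y) (D : set Y)
    (P : nat -> Y -> Prop) : Prop :=
  exists2 e, computable e &
    forall n y, D y -> (P n y <-> exists k j, e (npair n k) = j.+1 /\ O j y).

Definition trivial_base (_ : nat) : set unit := setT.

Lemma trivial_base_effective : effective_base trivial_base.
Proof.
exists (fun _ _ _ => true); first by comp.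
by split => // y n J _; exists 0%N => // m _; exists 0%N.
Qed.

(* Recursively enumerable predicates are the effectively open predicates on
   the one-point space. *)
Definition re (P : nat -> Prop) : Prop :=
  eff_open trivial_base setT (fun n _ => P n).

Section EffOpen.
Variables (Y : Type) (O : nat -> set Y) (D : set Y).
Hypothesis O_base : effective_base O.
Implicit Types P Q : nat -> Y -> Prop.

Lemma eff_open_ext P Q : (forall n y, D y -> (P n y <-> Q n y)) ->
  eff_open O D P -> eff_open O D Q.
Proof.
move=> h [e he H]; exists e => // n y Dy.
by rewrite -(h n y Dy); exact: H.
Qed.

Lemma eff_open_subst P h : eff_open O D P -> computable h ->
  eff_open O D (fun n y => P (h n) y).
Proof.
move=> [e he H] hh; exists (fun n => e (npair (h (nfst n)) (nsnd n))).
  apply: (computable_comp he); apply: computable_pair; last by comp.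
  by apply: (computable_comp hh); comp.
move=> n y Dy; rewrite H//; split => -[k [j]]; rewrite ?npairE => ejk;
  by exists k, j; rewrite ?npairE.
Qed.

Lemma eff_open_false : eff_open O D (fun _ _ => False).
Proof. by exists (fun=> 0%N) => [|n y _]; [comp|split => // -[? [? []]]]. Qed.

Lemma eff_open_base h : computable h -> eff_open O D (fun n y => O (h n) y).
Proof.
move=> hh; exists (fun n => (h (nfst n)).+1).
  by apply: computable_succ; apply: (computable_comp hh); comp.
move=> n y _; split => [Oy|]; first by exists 0%N, (h n); rewrite npairE.
by move=> [k [j [+ Oj]]]; rewrite npairE => -[->].
Qed.

(** This is the empty intersection, [n = 0], in the refinement clause of the base. *)
Lemma base_cover y : exists l, O l y.
Proof.
have [sub _ [_ /(_ y 0%N id)]] := O_base.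
by case=> // l Oly _; exists l.
Qed.

Lemma eff_open_re (P : nat -> Prop) : re P -> eff_open O D (fun n _ => P n).
Proof.
move=> [e he H].
(* Once a stage confirms [P n], every base set gets listed, and these cover the space. *)
exists (fun n => if 0 < e (npair (nfst n) (nfst (nsnd n))) then (nsnd (nsnd n)).+1 else 0)%N.
  have : computable (fun n => e (npair (nfst n) (nfst (nsnd n)))).
    by apply: (computable_comp he); comp.
  by comp.
move=> n y Dy; rewrite (H n tt I); split.
  move=> [k [j [ek _]]]; have [l Ol] := base_cover y.
  by exists (npair k l), l; rewrite !npairE ek.
by move=> [k [j []]]; rewrite !npairE; case E : (e _) => [//|i] _ _; exists (nfst k), i.
Qed.

Lemma re_dec (b : nat -> bool) : computable (fun n => b n : nat) -> re (fun n => b n).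
Proof.
move=> hb; exists (fun n => b (nfst n) : nat).
  by apply: (computable_comp hb); comp.
move=> n y _; split => [bn|]; first by exists 0%N, 0%N; rewrite npairE bn.
by move=> [k [j []]]; rewrite npairE; case: (b n).
Qed.

Lemma eff_open_dec (b : nat -> bool) : computable (fun n => b n : nat) ->
  eff_open O D (fun n _ => b n).
Proof. by move=> hb; apply: eff_open_re; exact: re_dec. Qed.

Lemma eff_open_if (b : nat -> bool) P Q : computable (fun n => b n : nat) ->
  eff_open O D P -> eff_open O D Q ->
  eff_open O D (fun n y => if b n then P n y else Q n y).
Proof.
move=> hb [e he H] [e' he' H'].
exists (fun n => if b (nfst n) then e n else e' n).
  by apply: computable_if => //; apply: (computable_comp hb); comp.
by move=> n y Dy; case E : (b n); [rewrite H//|rewrite H'//];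
  split => -[k [j]]; rewrite ?npairE ?E => ejk; exists k, j; rewrite ?npairE ?E.
Qed.

Lemma eff_open_ex (P : nat -> nat -> Y -> Prop) :
  eff_open O D (fun n y => P (nfst n) (nsnd n) y) ->
  eff_open O D (fun n y => exists m, P n m y).
Proof.
move=> [e he H].
exists (fun n => e (npair (npair (nfst n) (nfst (nsnd n))) (nsnd (nsnd n)))).
  by apply: (computable_comp he); comp.
move=> n y Dy; split => [[m Pm]|].
  have := H (npair n m) y Dy; rewrite !npairE => -[/(_ Pm) [k [j ejk]] _].
  by exists (npair m k), j; rewrite !npairE.
move=> [k [j]]; rewrite !npairE => ejk; exists (nfst k).
have := H (npair n (nfst k)) y Dy; rewrite !npairE => -[_ ]; apply.
by exists (nsnd k), j.
Qed.

(** A finite intersection of open sets: a base set is listed once witnesses show it formally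
    included in a listed set of each [P n m]. The refinement clause of the base ensures that no
    point of the intersection is missed. *)
Lemma eff_open_all (P : nat -> nat -> Y -> Prop) f :
  eff_open O D (fun n y => P (nfst n) (nsnd n) y) -> computable f ->
  eff_open O D (fun n y => forall m, (m < f n)%N -> P n m y).
Proof.
move=> [e he H] hf; have [sub hsub [sub_incl sub_ex]] := O_base.
(* the code [k] lists the radius index [l] and, for each [m], a stage of the
   enumeration of [P n m] and a witness of inclusion *)
pose v n k m := e (npair (npair n m) (nfst (nnth (nsnd k) m))).
pose b z m := (0 < v (nfst z) (nsnd z) m)%N &&
  sub (nfst (nsnd z)) (v (nfst z) (nsnd z) m).-1 (nsnd (nnth (nsnd (nsnd z)) m)).
have hb : computable (fun z => b (nfst z) (nsnd z) : nat).
  have hv : computable (fun z => v (nfst (nfst z)) (nsnd (nfst z)) (nsnd z)).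
    by apply: (computable_comp he); comp.
  apply: computable_andb; first by comp.
  apply: eq_computable (computable_comp (g := fun z => npair (nfst (nsnd (nfst z)))
    (npair (v (nfst (nfst z)) (nsnd (nfst z)) (nsnd z)).-1
      (nsnd (nnth (nsnd (nsnd (nfst z))) (nsnd z))))) hsub _); last by comp.
  by move=> z; rewrite !npairE.
exists (fun z => if all (b z) (iota 0 (f (nfst z))) then (nfst (nsnd z)).+1 else 0%N).
  apply: computable_if; [|by comp|by comp].
  by apply: computable_all => //; apply: (computable_comp hf); comp.
move=> n y Dy; split => [Pn|].
  have /choice [J HJ] : forall m, exists kj : nat * nat, (m < f n)%N ->
      e (npair (npair n m) kj.1) = kj.2.+1 /\ O kj.2 y.
    move=> m; case: (ltnP m (f n)) => [mf|_]; last by exists (0, 0)%N.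
    have := H (npair n m) y Dy; rewrite !npairE => -[/(_ (Pn _ mf)) [k [j kj]] _].
    by exists (k, j).
  have [l Ol wl] := sub_ex y (f n) (fun m => (J m).2) (fun m mf => (HJ m mf).2).
  have /choice [w Hw] : forall m, exists w, (m < f n)%N -> sub l (J m).2 w.
    move=> m; case: (ltnP m (f n)) => [mf|_]; last by exists 0%N.
    by have [w] := wl _ mf; exists w.
  have [s hs] := nnth_code (fun m => npair (J m).1 (w m)) (f n).
  exists (npair l s), l; split => //; rewrite !npairE.
  case: allP_iota => // -[] m mf.
  rewrite /b /v !npairE hs// !npairE; have [-> _] := HJ m mf.
  by rewrite /= Hw.
move=> [k [j []]]; rewrite !npairE; case: allP_iota => // hall [<-] Ol m mf.
have := hall m mf; rewrite /b !npairE => /andP[v0 /sub_incl/(_ _ Ol) Ov].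
have := H (npair n m) y Dy; rewrite !npairE => -[_]; apply.
by exists (nfst (nnth (nsnd k) m)), (v n k m).-1; split => //; rewrite prednK.
Qed.

Lemma eff_open_and P Q : eff_open O D P -> eff_open O D Q ->
  eff_open O D (fun n y => P n y /\ Q n y).
Proof.
move=> hP hQ.
have := @eff_open_all (fun n m y => if m == 0%N then P n y else Q n y) (fun=> 2%N).
move=> /(_ _ _)/eff_open_ext; apply.
- move=> n y _; split => [h|[Pn Qn] [|[|]]//].
  by split; [exact: (h 0%N)|exact: (h 1%N)].
- apply: eff_open_if; [by comp| |].
    by apply: (eff_open_subst hP); comp.
  by apply: (eff_open_subst hQ); comp.
- by comp.
Qed.

Lemma eff_open_or P Q : eff_open O D P -> eff_open O D Q ->
  eff_open O D (fun n y => P n y \/ Q n y).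
Proof.
move=> hP hQ.
have := @eff_open_ex (fun n m y => if m == 0%N then P n y else Q n y).
move=> /(_ _)/eff_open_ext; apply.
- move=> n y _; split => [[m]|[Pn|Qn]]; [case: eqP; tauto|by exists 0%N|by exists 1%N].
- apply: eff_open_if; [by comp| |].
    by apply: (eff_open_subst hP); comp.
  by apply: (eff_open_subst hQ); comp.
Qed.

End EffOpen.
#[global] Hint Resolve eff_open_false eff_open_base eff_open_re eff_open_dec eff_open_ex
  eff_open_all eff_open_and eff_open_or trivial_base_effective : comp.

Lemma eff_open_sub Y (O : nat -> set Y) (D D' : set Y) P : D' `<=` D ->
  eff_open O D P -> eff_open O D' P.
Proof. by move=> DD' [e he H]; exists e => // n y /DD'; exact: H. Qed.

(** The relation is only enumerable, so the unbounded search runs over pairs of a value and a stage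
    that confirms it. *)
Lemma re_choice (P : nat -> nat -> Prop) : re (fun n => P (nfst n) (nsnd n)) ->
  (forall n, exists m, P n m) ->
  exists2 h, computable h & forall n, P n (h n).
Proof.
move=> [e he H] hex.
have [||h hh Ph] := @computable_mini
    (fun n k => e (npair (npair n (nfst k)) (nsnd k)) == 0%N : nat).
- suff : computable (fun n => e (npair (npair (nfst n) (nfst (nsnd n))) (nsnd (nsnd n)))).
    by comp.
  by apply: (computable_comp he); comp.
- move=> n; have [m] := hex n; have := H (npair n m) tt I.
  rewrite !npairE => -[+ _] => /[apply] -[k [j [ek _]]].
  by exists (npair m k); rewrite !npairE ek.
exists (fun n => nfst (h n)); first by comp.
move=> n; have := H (npair n (nfst (h n))) tt I; rewrite !npairE => -[_]; apply.
have := Ph n; case E : (e _) => [//|j] _.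
by exists (nsnd (h n)), j.
Qed.

(** * Real powers *)

Section RealPowers.
Variable R : realType.
Implicit Types x y r p : R.

Lemma ltr_powR p x y : 0 < p -> 0 <= x -> 0 <= y -> (x `^ p < y `^ p) = (x < y).
Proof.
move=> p0 x0 y0; apply/idP/idP; last by apply: gt0_ltr_powR.
by apply: contraTT; rewrite -!leNgt => yx; apply: ge0_ler_powR => //; exact: ltW.
Qed.

Lemma powRK p x : p != 0 -> 0 <= x -> (x `^ p) `^ p^-1 = x.
Proof. by move=> p0 x0; rewrite -powRrM divff// powRr1. Qed.

Lemma powRVK p x : p != 0 -> 0 <= x -> (x `^ p^-1) `^ p = x.
Proof. by move=> p0 x0; rewrite -powRrM mulVf// powRr1. Qed.

Lemma exprn_powR x m n : 0 <= x -> x ^+ m = (x `^ (m%:R / n.+1%:R)) ^+ n.+1.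
Proof.
move=> x0; rewrite -[in RHS](@powR_mulrn _ _ n.+1) ?powR_ge0// -powRrM.
by rewrite divfK ?pnatr_eq0// powR_mulrn.
Qed.

(** The power x^r increases in r for [1 <= x] and decreases for [x <= 1]. The side of [p] on which
    the fraction lies therefore makes the power with this fraction a lower estimate of x^p when [lo]
    holds, and an upper estimate otherwise. *)
Definition frac_near (lo : bool) x p m n : bool :=
  if lo then (1 <= x) && (m%:R / n.+1%:R < p) || (x <= 1) && (p < m%:R / n.+1%:R)
  else (1 <= x) && (p < m%:R / n.+1%:R) || (x <= 1) && (m%:R / n.+1%:R < p).

Lemma nnegrat_between (s t : R) : s < t -> 0 < t ->
  exists m n : nat, (s < m%:R / n.+1%:R < t)%R.
Proof.
move=> st t0; have [|k /andP[sk kt]] := @qval_dense R (Num.max s 0) t.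
  by rewrite gt_max st.
move: sk; rewrite gt_max => /andP[sk k0].
exists (nfst (nfst k) - nsnd (nfst k))%N, (nsnd k).
suff -> : (nfst (nfst k) - nsnd (nfst k))%:R / (nsnd k).+1%:R = qval R k by rewrite sk.
rewrite /qval natrB// -(ler_nat R) -subr_ge0; apply: ltW.
by move: k0; rewrite /qval pmulr_lgt0 // invr_gt0.
Qed.

(** Clearing the denominator of the fraction leaves integer powers, whose comparison is decidable
    for rational [x] and [r]. Only the position of fractions relative to [p] remains to be
    enumerated. *)
Lemma ltr_powR_frac p x r : 0 < p -> 0 < x -> 0 <= r ->
  r < x `^ p <-> exists m n, frac_near true x p m n /\ r ^+ n.+1 < x ^+ m.
Proof.
move=> p0 x0 r0; split; last first.
  move=> [m [n [near rx]]]; have : r < x `^ (m%:R / n.+1%:R).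
    by rewrite -(@ltr_pXn2r _ n.+1) ?nnegrE ?powR_ge0// -exprn_powR// ltW.
  move=> /lt_le_trans; apply; case/orP: near => /andP[x1 mp].
    by apply: ler_powR => //; exact: ltW.
  by apply: ger_powR; rewrite ?x0//; exact: ltW.
move=> rx.
suff [m [n [near rx']]] : exists m n, frac_near true x p m n /\ r < x `^ (m%:R / n.+1%:R).
  exists m, n; split => //.
  by rewrite (exprn_powR m n (ltW x0)) ltr_pXn2r ?nnegrE ?powR_ge0.
(* The case [r = 0] is separate, since the fraction is otherwise found by comparing [p] with
   [ln r / ln x]. *)
move: r0; rewrite le_eqVlt => /orP[/eqP <-|r0].
  have [x1|x1] := leP 1 x.
    by exists 0%N, 0%N; rewrite /frac_near x1 mul0r p0 powRr0.
  have [||m [n /andP[pm _]]] := @nnegrat_between p (p + 1); [lra|lra|].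
  by exists m, n; rewrite /frac_near (ltW x1) pm orbT powR_gt0.
have lnE u : r < x `^ u <-> ln r < u * ln x.
  by rewrite -{1}(lnK (x := r))// /powR gt_eqF// ltr_expR.
move/lnE: rx => rx; case: (ltrgt0P (ln x)) => lnx.
- have x1 : 1 <= x.
    rewrite leNgt; apply/negP => x1.
    by have := @ln_lt0 _ x; rewrite x0 x1 ltNge (ltW lnx) => /(_ isT).
  have [|//|m [n /andP[m1 m2]]] := @nnegrat_between (ln r / ln x) p; first by rewrite ltr_pdivrMr.
  exists m, n; rewrite /frac_near x1 m2; split => //; apply/lnE.
  by rewrite -ltr_pdivrMr.
- have x1 : x <= 1 by rewrite leNgt; apply/negP => /ln_gt0; rewrite ltNge (ltW lnx).
  have pr : p < ln r / ln x by rewrite ltr_ndivlMr.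
  have [//||m [n /andP[m1 m2]]] := @nnegrat_between p (ln r / ln x); first lra.
  exists m, n; rewrite /frac_near x1 m1 orbT; split => //; apply/lnE.
  by rewrite -ltr_ndivlMr.
- have x1 : x = 1.
    by apply/eqP; rewrite -ln_eq0// lnx.
  exists 0%N, 0%N; rewrite /frac_near x1 lexx mul0r p0 powRr0; split => //.
  by move: rx; rewrite lnx mulr0 -[X in _ < X]ln1 ltr_ln ?posrE.
Qed.

Lemma gtr_powR_frac p x r : 0 < p -> 0 < x -> 0 < r ->
  x `^ p < r <-> exists m n, frac_near false x p m n /\ x ^+ m < r ^+ n.+1.
Proof.
move=> p0 x0 r0.
have -> : (x `^ p < r) = (r^-1 < x^-1 `^ p).
  rewrite -(powR_inv1 (ltW x0)) -powRrM mulN1r powRN ltf_pV2 ?posrE// powR_gt0//.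
rewrite ltr_powR_frac ?invr_gt0 ?(ltW r0)// ?invr_ge0 ?(ltW r0)//.
have E m n : (r^-1 ^+ n.+1 < x^-1 ^+ m) = (x ^+ m < r ^+ n.+1).
  by rewrite !exprVn ltf_pV2 ?posrE ?exprn_gt0.
have F m n : frac_near true x^-1 p m n = frac_near false x p m n.
  by rewrite /frac_near invf_ge1// invf_le1// orbC.
by split => -[m [n]]; rewrite ?E ?F => h; exists m, n; rewrite ?E ?F.
Qed.

End RealPowers.

(** * Pointwise inequalities behind Doob's inequality *)

Section YoungInequalities.
Variables (R : realType) (p : R).
Hypothesis p_gt1 : 1 < p.
Let q : R := p / (p - 1).

Let p1_gt0 : 0 < p - 1. Proof. by rewrite subr_gt0. Qed.
Let p_gt0 : 0 < p. Proof. exact: lt_trans p_gt1. Qed.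

Lemma conj_exponent_ge1 : 1 <= q.
Proof. by rewrite /q ler_pdivlMr// mul1r gerBl. Qed.

Let q_gt0 : 0 < q. Proof. exact: lt_le_trans conj_exponent_ge1. Qed.

(** One step of a telescoping argument, with [x] the running maximum and [y] the next value of the
    martingale. For [x < y] it is Young's inequality for [y] and x^(p-1), multiplied by [q], since q
    / p = q - 1. *)
Lemma powR_max_increment (x y : R) : 0 <= x -> 0 <= y ->
  Num.max x y `^ p + q * (y * x `^ (p - 1)) <=
  x `^ p + q * (y * Num.max x y `^ (p - 1)).
Proof.
move=> x0 y0; have [yx|xy] := leP y x; first by rewrite lexx.
have := @conjugate_powR R y (x `^ (p - 1)) p q y0 (powR_ge0 _ _) p_gt0 q_gt0.
have -> : p^-1 + q^-1 = 1.
  by rewrite /q invf_div; field; rewrite gt_eqF.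
move=> /(_ erefl).
have -> : (x `^ (p - 1)) `^ q = x `^ p.
  by rewrite -powRrM /q mulrC divfK// gt_eqF.
rewrite mulr_powRB1// => h.
have e : q^-1 = (p - 1) / p by rewrite /q invf_div.
have eq1 : q * (y `^ p / p + x `^ p / q) = (q - 1) * y `^ p + x `^ p.
  rewrite /q; field; rewrite ?gt_eqF//=.
have : q * (y * x `^ (p - 1)) <= q * (y `^ p / p + x `^ p / q) by rewrite ler_pM2l.
by rewrite eq1; lra.
Qed.

(** Lets half of the integral of x^p be absorbed into the left side of the maximal inequality.
    Beyond the threshold [2 * q * y] one has q y <= x / 2; below it, [x] is replaced by the
    threshold. *)
Lemma young_split (x y : R) : 0 <= x -> 0 <= y ->
  q * (y * x `^ (p - 1)) <= x `^ p / 2 + q * (2 * q) `^ (p - 1) * y `^ p.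
Proof.
move=> x0 y0; have q2 : 0 <= 2 * q by rewrite mulr_ge0// ltW.
have [h|h] := leP x (2 * q * y).
  rewrite -[leLHS]add0r; apply: lerD; first by rewrite divr_ge0// powR_ge0.
  rewrite -mulrA ler_pM2l//; apply: (@le_trans _ _ (y * (2 * q * y) `^ (p - 1))).
    apply: ler_wpM2l => //; apply: ge0_ler_powR; rewrite ?nnegrE ?(ltW p1_gt0)//.
    exact: mulr_ge0.
  by rewrite powRM// mulrCA mulr_powRB1.
rewrite -[leLHS]addr0; apply: lerD; last first.
  by apply: mulr_ge0; [apply: mulr_ge0; [exact: ltW|]|]; exact: powR_ge0.
rewrite mulrA ler_pdivlMr// -(mulr_powRB1 x0 p_gt0) mulrAC.
by apply: ler_wpM2r; rewrite ?powR_ge0//; lra.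
Qed.

End YoungInequalities.

Fixpoint running_max (R : realType) (T : Type) (s : nat -> T -> R) (i : nat) (x : T) : R :=
  if i is j.+1 then Num.max (running_max s j x) (s i x) else s 0%N x.

Lemma le_running_max (R : realType) (T : Type) (s : nat -> T -> R) i j x :
  (i <= j)%N -> s i x <= running_max s j x.
Proof.
elim: j => [|j IH]; first by rewrite leqn0 => /eqP ->.
rewrite leq_eqVlt => /orP[/eqP ->|]; first by rewrite /= le_max lexx orbT.
by rewrite ltnS => /IH h; rewrite /= le_max h.
Qed.

Local Open Scope ereal_scope.

(** * Effective cuts *)

Section Cuts.
Variable R : realType.
Variables (Y : Type) (O : nat -> set Y) (D : set Y).
Hypothesis O_base : effective_base O.
Implicit Types x y : nat -> Y -> \bar R.

Definition eff_lower x : Prop :=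
  eff_open O D (fun n z => (qval R (nfst n))%:E < x (nsnd n) z).

Definition eff_upper x : Prop :=
  eff_open O D (fun n z => x (nsnd n) z < (qval R (nfst n))%:E).

Lemma eff_lowerP x r h : eff_lower x -> rational_seq r -> computable h ->
  eff_open O D (fun n z => (r n)%:E < x (h n) z).
Proof.
move=> hx [f hf rf] hh.
apply: eff_open_ext (eff_open_subst (h := fun n => npair (f n) (h n)) hx _).
  by move=> n z _; rewrite !npairE rf.
by comp.
Qed.

Lemma eff_upperP x r h : eff_upper x -> rational_seq r -> computable h ->
  eff_open O D (fun n z => x (h n) z < (r n)%:E).
Proof.
move=> hx [f hf rf] hh.
apply: eff_open_ext (eff_open_subst (h := fun n => npair (f n) (h n)) hx _).
  by move=> n z _; rewrite !npairE rf.
by comp.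
Qed.

Lemma eff_lower_ext x y : (forall i z, D z -> x i z = y i z) ->
  eff_lower x -> eff_lower y.
Proof. by move=> h; apply: eff_open_ext => n z Dz; rewrite h. Qed.

Lemma eff_upper_ext x y : (forall i z, D z -> x i z = y i z) ->
  eff_upper x -> eff_upper y.
Proof. by move=> h; apply: eff_open_ext => n z Dz; rewrite h. Qed.

Lemma eff_lower_opp x : eff_upper x -> eff_lower (fun i z => - x i z).
Proof.
move=> hx; have h := eff_upperP hx.
apply: eff_open_ext (_ : eff_open O D
  (fun n z => x (nsnd n) z < (- qval R (nfst n))%:E)); last by comp.
by move=> n z _; rewrite lteNr.
Qed.

Lemma eff_upper_opp x : eff_lower x -> eff_upper (fun i z => - x i z).
Proof.
move=> hx; have h := eff_lowerP hx.
apply: eff_open_ext (_ : eff_open O D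
  (fun n z => (- qval R (nfst n))%:E < x (nsnd n) z)); last by comp.
by move=> n z _; rewrite lteNl.
Qed.

Lemma eff_lower_subst x h : eff_lower x -> computable h ->
  eff_lower (fun i z => x (h i) z).
Proof.
move=> hx hh; apply: (eff_lowerP hx); first by comp.
by apply: (computable_comp hh); comp.
Qed.

Lemma eff_upper_subst x h : eff_upper x -> computable h ->
  eff_upper (fun i z => x (h i) z).
Proof.
move=> hx hh; apply: (eff_upperP hx); first by comp.
by apply: (computable_comp hh); comp.
Qed.

Lemma eff_lower_rational r : rational_seq r -> eff_lower (fun i _ => (r i)%:E).
Proof.
move=> hr.
apply: eff_open_ext (_ : eff_open O D (fun n _ => (qval R (nfst n) < r (nsnd n))%R)).
  by move=> n z _; rewrite lte_fin.
apply: eff_open_dec => //; apply: computable_ltr; first by comp.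
by apply: rational_seq_comp => //; comp.
Qed.

Lemma eff_upper_rational r : rational_seq r -> eff_upper (fun i _ => (r i)%:E).
Proof.
move=> hr.
apply: eff_open_ext (_ : eff_open O D (fun n _ => (r (nsnd n) < qval R (nfst n))%R)).
  by move=> n z _; rewrite lte_fin.
apply: eff_open_dec => //; apply: computable_ltr; last by comp.
by apply: rational_seq_comp => //; comp.
Qed.

Lemma qval_between (a b : \bar R) : a < b -> exists n, a < (qval R n)%:E < b.
Proof.
have dense (s t : R) : (s < t)%R -> exists n, (s%:E < (qval R n)%:E < t%:E).
  by move=> /qval_dense [n]; exists n; rewrite !lte_fin.
case: a b => [a| |] [b| |] //; first by rewrite lte_fin => /dense.
- move=> _; have [|n /andP[an _]] := @dense a (a + 1)%R; first by rewrite ltrDl.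
  by exists n; rewrite an ltry.
- move=> _; have [|n /andP[_ bn]] := @dense (b - 1)%R b; first by rewrite ltrBlDr ltrDl.
  by exists n; rewrite bn ltNyr.
- by move=> _; exists 0%N; rewrite ltNyr ltry.
Qed.

Lemma lt_add_split (q : R) (a b : \bar R) : a != -oo -> b != -oo ->
  q%:E < a + b ->
  exists r s, [/\ (qval R r)%:E < a, (qval R s)%:E < b &
    (q < qval R r + qval R s)%R].
Proof.
move=> a0 b0 qab.
have [t /andP[qt tb]] : exists t, (q%:E - a) < (qval R t)%:E < b.
  apply: qval_between.
  move: a b a0 b0 qab => [a| |] [b| |]//= _ _; rewrite ?ltry ?ltNyr//.
  by rewrite -EFinD !lte_fin => h; rewrite ltrBlDl.
have [r /andP[qr ra]] : exists r, (q%:E - (qval R t)%:E) < (qval R r)%:E < a.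
  apply: qval_between.
  move: a a0 qt {qab} => [a| |]//= _; last by rewrite ltry.
  by rewrite -!EFinB !lte_fin => h; lra.
exists r, t; split => //.
by rewrite -EFinB lte_fin ltrBlDr in qr.
Qed.

Lemma lt_sum_split (q : R) (v : nat -> \bar R) n : (forall m, v m != -oo) ->
  q%:E < \sum_(m < n) v m ->
  exists s, (forall m, (m < n)%N -> (qval R (nnth s m))%:E < v m) /\
    (q < \sum_(m < n) qval R (nnth s m))%R.
Proof.
move=> v0; suff : q%:E < \sum_(m < n) v m -> exists s : nat -> nat,
    (forall m, (m < n)%N -> (qval R (s m))%:E < v m) /\
    (q < \sum_(m < n) qval R (s m))%R.
  move=> + qv => /(_ qv) [s [s1 s2]]; have [c cs] := nnth_code s n.
  exists c; split => [m mn|]; first by rewrite cs// s1.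
  by under eq_bigr => i _ do rewrite cs//.
elim: n q => [|n IH] q; first by rewrite !big_ord0 lte_fin; exists (fun=> 0%N); rewrite big_ord0.
rewrite big_ord_recr /= => /lt_add_split[||r [t [rv tv qrt]]] //.
  elim: (n) => [|k]; first by rewrite big_ord0.
  by rewrite big_ord_recr /= => IHk; move: (v k) (v0 k) IHk => [a| |]//= _; case: (\sum_(_ < _) _).
have [s [s1 s2]] := IH _ rv.
exists (fun m => if (m < n)%N then s m else t); split.
  move=> m; rewrite ltnS leq_eqVlt; case: ltnP => [mn _|mn]; first exact: s1.
  by rewrite orbF => /eqP ->.
rewrite big_ord_recr /= ltnn; under eq_bigr => i _ do rewrite ltn_ord.
by apply: lt_trans qrt _; rewrite ltrD2r.
Qed.

Lemma eff_lower_sum (x : nat -> nat -> Y -> \bar R) f :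
  (forall i m z, D z -> x i m z != -oo) ->
  eff_lower (fun n => x (nfst n) (nsnd n)) -> computable f ->
  eff_lower (fun i z => \sum_(m < f i) x i m z).
Proof.
move=> x0 hx hf.
apply: eff_open_ext (_ : eff_open O D (fun n z => exists s,
  (forall m, (m < f (nsnd n))%N -> (qval R (nnth s m))%:E < x (nsnd n) m z) /\
  (qval R (nfst n) < \sum_(m < f (nsnd n)) qval R (nnth s m))%R)).
  move=> n z Dz; split => [[s [s1 s2]]|]; last first.
    by apply: (lt_sum_split (v := fun m => x (nsnd n) m z)) => m; exact: x0.
  apply: (@lt_le_trans _ _ (\sum_(m < f (nsnd n)) (qval R (nnth s m))%:E)).
    by rewrite sumEFin lte_fin.
  by apply: lee_sum => i _; apply/ltW/s1.
apply: eff_open_ex => //; apply: eff_open_and => //.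
  apply: eff_open_all => //.
  - apply: eff_open_ext (eff_lowerP hx (r := fun n => qval R (nnth (nsnd (nfst n)) (nsnd n)))
     (h := fun n => npair (nsnd (nfst (nfst n))) (nsnd n)) _ _); try by comp.
    by move=> n z _; rewrite !npairE.
  - by apply: (computable_comp hf); comp.
apply: eff_open_dec => //; apply: computable_ltr; first by comp.
apply: (rational_seq_sum (x := fun n m => qval R (nnth (nsnd n) m))); first by comp.
by apply: (computable_comp hf); comp.
Qed.

Lemma eff_lower_add x y : (forall i z, D z -> x i z != -oo) ->
  (forall i z, D z -> y i z != -oo) ->
  eff_lower x -> eff_lower y -> eff_lower (fun i z => x i z + y i z).
Proof.
move=> x0 y0 hx hy; have h := eff_lowerP hx; have h' := eff_lowerP hy.
apply: eff_open_ext (_ : eff_open O D (fun n z => exists r s,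
  (qval R r)%:E < x (nsnd n) z /\ (qval R s)%:E < y (nsnd n) z /\
  (qval R (nfst n) < qval R r + qval R s)%R)); last by comp.
move=> n z Dz; split => [[r [s [rx [sy qrs]]]]|]; last first.
  by move=> /lt_add_split [||r [s [? ? ?]]]; [exact: x0|exact: y0|exists r, s].
by apply: lt_trans (lteD rx sy); rewrite -EFinD lte_fin.
Qed.

Lemma eff_upper_add x y : (forall i z, D z -> x i z != +oo) ->
  (forall i z, D z -> y i z != +oo) ->
  eff_upper x -> eff_upper y -> eff_upper (fun i z => x i z + y i z).
Proof.
move=> x0 y0 hx hy.
apply: eff_upper_ext (eff_upper_opp (eff_lower_add _ _ (eff_lower_opp hx) (eff_lower_opp hy))).
- by move=> i z Dz; move: (x i z) (y i z) (x0 i z Dz) (y0 i z Dz) => [a| |] [b| |]//= _ _;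
    rewrite /= opprD !opprK.
- by move=> i z Dz; rewrite eqe_oppLR x0.
- by move=> i z Dz; rewrite eqe_oppLR y0.
Qed.

End Cuts.

Lemma lt_bigmaxe (R : realType) n (x : nat -> \bar R) (q : \bar R) :
  q < \big[Order.max/0]_(m < n) x m <-> q < 0 \/ exists2 m, (m < n)%N & q < x m.
Proof.
split=> [|[q0|[m mn qx]]]; last 2 first.
- by apply: lt_le_trans q0 _; exact: bigmax_ge_id.
- by apply: lt_le_trans qx _; exact: (le_bigmax _ _ (Ordinal mn)).
rewrite ltNge => /negP qmax; apply: contrapT => /not_orP[/negP q0 qx]; apply: qmax.
apply/bigmax_leP; split=> [|m _]; first by rewrite leNgt.
by rewrite leNgt; apply/negP => qxm; apply: qx; exists m.
Qed.

Lemma bigmaxe_lt (R : realType) n (x : nat -> \bar R) (q : \bar R) :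
  \big[Order.max/0]_(m < n) x m < q <-> 0 < q /\ forall m, (m < n)%N -> x m < q.
Proof.
split=> [/bigmax_ltP[q0 h]|[q0 h]]; last by apply/bigmax_ltP; split => // i _; exact: h.
by split => // m mn; exact: (h (Ordinal mn)).
Qed.

Section Cuts2.
Variable R : realType.
Variables (Y : Type) (O : nat -> set Y) (D : set Y).
Hypothesis O_base : effective_base O.
Implicit Types x y : nat -> Y -> \bar R.

Lemma eff_lower_sup (x : nat -> nat -> Y -> \bar R) :
  eff_lower O D (fun n => x (nfst n) (nsnd n)) ->
  eff_lower O D (fun i z => ereal_sup (range (fun m => x i m z))).
Proof.
move=> hx.
apply: eff_open_ext (_ : eff_open O D (fun n z => exists m,
  (qval R (nfst n))%:E < x (nsnd n) m z)).
  move=> n z _; split => [[m qx]|/ereal_sup_gt [_ [m _ <-] qx]]; last by exists m.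
  by apply: lt_le_trans qx _; apply: ereal_sup_ubound; exists m.
apply: eff_open_ex.
apply: eff_open_ext (eff_lowerP hx (r := fun n => qval R (nfst (nfst n)))
  (h := fun n => npair (nsnd (nfst n)) (nsnd n)) _ _); [|by comp..].
by move=> n z _; rewrite !npairE.
Qed.

Lemma eff_lower_max (x : nat -> nat -> Y -> \bar R) f :
  eff_lower O D (fun n => x (nfst n) (nsnd n)) -> computable f ->
  eff_lower O D (fun i z => \big[Order.max/0]_(m < f i) x i m z).
Proof.
move=> hx hf.
apply: eff_open_ext (_ : eff_open O D (fun n z => (qval R (nfst n) < 0)%R \/
  exists m, (m < f (nsnd n))%N /\ (qval R (nfst n))%:E < x (nsnd n) m z)).
  move=> n z _; rewrite (lt_bigmaxe _ (fun m => x _ m z)) lte_fin.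
  by split => [[?|[m [? ?]]]|[?|[m ? ?]]];
    [left|right; exists m|left|right; exists m].
have h0 : rational_seq (fun _ : nat => 0%R : R).
  by apply: eq_rational_seq (rational_seq_nat R (computable_const 0)).
apply: eff_open_or => //.
  by apply: eff_open_dec => //; apply: computable_ltr => //; comp.
apply: eff_open_ex; apply: eff_open_and => //.
  apply: eff_open_dec => //; apply: computable_leq; first by comp.
  by apply: (computable_comp hf); comp.
apply: eff_open_ext (eff_lowerP hx (r := fun n => qval R (nfst (nfst n)))
  (h := fun n => npair (nsnd (nfst n)) (nsnd n)) _ _); [|by comp..].
by move=> n z _; rewrite !npairE.
Qed.

Lemma eff_upper_max (x : nat -> nat -> Y -> \bar R) f :
  eff_upper O D (fun n => x (nfst n) (nsnd n)) -> computable f ->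
  eff_upper O D (fun i z => \big[Order.max/0]_(m < f i) x i m z).
Proof.
move=> hx hf.
apply: eff_open_ext (_ : eff_open O D (fun n z => (0 < qval R (nfst n))%R /\
  forall m, (m < f (nsnd n))%N -> x (nsnd n) m z < (qval R (nfst n))%:E)).
  by move=> n z _; rewrite (bigmaxe_lt _ (fun m => x _ m z)) lte_fin.
have h0 : rational_seq (fun _ : nat => 0%R : R).
  by apply: eq_rational_seq (rational_seq_nat R (computable_const 0)).
apply: eff_open_and => //.
  by apply: eff_open_dec => //; apply: computable_ltr => //; comp.
apply: eff_open_all => //; last by apply: (computable_comp hf); comp.
apply: eff_open_ext (eff_upperP hx (r := fun n => qval R (nfst (nfst n)))
  (h := fun n => npair (nsnd (nfst n)) (nsnd n)) _ _); [|by comp..].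
by move=> n z _; rewrite !npairE.
Qed.

Lemma eff_upper_sum (x : nat -> nat -> Y -> \bar R) f :
  (forall i m z, D z -> x i m z \is a fin_num) ->
  eff_upper O D (fun n => x (nfst n) (nsnd n)) -> computable f ->
  eff_upper O D (fun i z => \sum_(m < f i) x i m z).
Proof.
move=> x0 hx hf.
have := eff_lower_sum (D := D) O_base (x := fun i m z => - x i m z) _ (eff_lower_opp hx) hf.
move=> /(_ _)/eff_upper_opp/eff_upper_ext; apply => i; first 1 last.
  by move=> m z Dz; rewrite eqe_oppLR /=; have := x0 i m z Dz; rewrite fin_numE => /andP[].
move=> z Dz; rewrite fin_num_sumeN ?oppeK// => m _; exact: x0.
Qed.

Lemma eff_lower_opp_add (c : nat -> R) x : rational_seq c ->
  (forall i z, D z -> x i z != +oo) -> eff_upper O D x ->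
  eff_lower O D (fun i z => (c i)%:E - x i z).
Proof.
move=> hc x0 hx; apply: eff_lower_add => //.
- by move=> i z Dz; rewrite eqe_oppLR x0.
- exact: eff_lower_rational.
- exact: eff_lower_opp.
Qed.

Lemma eff_upper_opp_add (c : nat -> R) x : rational_seq c ->
  (forall i z, D z -> x i z != -oo) -> eff_lower O D x ->
  eff_upper O D (fun i z => (c i)%:E - x i z).
Proof.
move=> hc x0 hx; apply: eff_upper_add => //.
- by move=> i z Dz; rewrite eqe_oppLR x0.
- exact: eff_upper_rational.
- exact: eff_upper_opp.
Qed.

End Cuts2.

(** * Names of reals and their cuts *)

Section Names.
Variable R : realType.

Definition computable_seq (x : nat -> \bar R) : Prop :=
  eff_lower trivial_base setT (fun i _ => x i) /\
  eff_upper trivial_base setT (fun i _ => x i).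

Lemma half_small (e : R) : (0 < e)%R -> exists k, (2^-1 ^+ k < e)%R.
Proof.
move=> e0; have : (2^-1 ^+ k : R)%R @[k --> \oo] --> 0%R.
  by apply: cvg_expr; rewrite ger0_norm// invf_lt1// ltr1n.
move/cvgrPdist_lt => /(_ e e0)[k _ /(_ k (leqnn _))] /=.
by rewrite sub0r normrN ger0_norm ?exprn_ge0// => h; exists k.
Qed.

Lemma computable_seqP (x : nat -> R) :
  uniformly_computable_reals x <-> computable_seq (fun i => (x i)%:E).
Proof.
split=> [[g hg gx]|[hl hu]].
  have hg' : computable (fun n => g (npair (nsnd (nfst n)) (nsnd n))).
    by apply: (computable_comp hg); comp.
  split.
    apply: eff_open_ext (_ : eff_open trivial_base setT (fun n _ => exists k,
      (qval R (nfst n) + 2^-1 ^+ k < qval R (g (npair (nsnd n) k)))%R)); last by comp.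
    move=> n _ _; rewrite lte_fin; have gxn := gx (nsnd n).
    split=> [[k hk]|nx]; first by have := gxn k; rewrite ler_distl => /andP[]; lra.
    have [|k hk] := half_small (e := ((x (nsnd n) - qval R (nfst n)) / 2)%R); first by lra.
    by exists k; have := gxn k; rewrite ler_distl => /andP[]; lra.
  apply: eff_open_ext (_ : eff_open trivial_base setT (fun n _ => exists k,
      (qval R (g (npair (nsnd n) k)) + 2^-1 ^+ k < qval R (nfst n))%R)); last by comp.
  move=> n _ _; rewrite lte_fin; have gxn := gx (nsnd n).
  split=> [[k hk]|nx]; first by have := gxn k; rewrite ler_distl => /andP[]; lra.
  have [|k hk] := half_small (e := ((qval R (nfst n) - x (nsnd n)) / 2)%R); first by lra.
  by exists k; have := gxn k; rewrite ler_distl => /andP[]; lra.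
(* At precision [nsnd n], search for a pair [m] of rational bounds enclosing the real in an interval
   shorter than the required error; the lower bound is the approximation. *)
have [||h hh hP] := @re_choice (fun n m =>
   ((qval R (nfst m))%:E < (x (nfst n))%:E /\ (x (nfst n))%:E < (qval R (nsnd m))%:E) /\
   (qval R (nsnd m) - qval R (nfst m) < 2^-1 ^+ nsnd n)%R).
- have h1 := eff_lowerP hl; have h2 := eff_upperP hu.
  apply: (eff_open_and trivial_base_effective); last by comp.
  by apply: (eff_open_and trivial_base_effective); [apply: (h1 _ (fun n => nfst (nfst n)))|apply: (h2 _ (fun n => nfst (nfst n)))]; comp.
- move=> n; set e : R := (2^-1 ^+ nsnd n)%R; have e0 : (0 < e)%R by rewrite exprn_gt0.
  have [|a /andP[a1 a2]] := @qval_dense R (x (nfst n) - e / 2) (x (nfst n)); first by lra.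
  have [|b /andP[b1 b2]] := @qval_dense R (x (nfst n)) (x (nfst n) + e / 2); first by lra.
  by exists (npair a b); rewrite !npairE !lte_fin; split; [split|lra].
exists (fun n => nfst (h n)); first by comp.
move=> i k; have := hP (npair i k); rewrite !npairE !lte_fin => -[[]]; rewrite ler_distl; lra.
Qed.

Lemma computable_real_seq (x : R) : computable_real x ->
  computable_seq (fun _ => x%:E).
Proof.
move=> [g hg gx]; apply/computable_seqP; exists (fun n => g (nsnd n)).
  by apply: (computable_comp hg); comp.
by move=> i k; rewrite npairE; exact: gx.
Qed.

Lemma left_nameP (g : nat -> nat) (x : \bar R) (q : R) : left_name g x ->
  q%:E < x <-> exists k, (q < qval R (g k))%R.
Proof.
move=> [ndg gx].
have xE : x = ereal_sup (range (fun k => (qval R (g k))%:E)).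
  have ndE : nondecreasing_seq (fun k => (qval R (g k))%:E).
    by move=> m n mn; rewrite lee_fin; exact: ndg.
  by rewrite -(cvg_lim _ gx)// (cvg_lim _ (ereal_nondecreasing_cvgn ndE)).
split => [|[k qk]].
  by rewrite xE => /ereal_sup_gt[_ [k _ <-]]; rewrite lte_fin; exists k.
by rewrite xE; apply: (@lt_le_trans _ _ (qval R (g k))%:E); rewrite ?lte_fin//;
  apply: ereal_sup_ubound; exists k.
Qed.

End Names.

Lemma EFin_lt_poweR (R : realType) (p q : R) (x : \bar R) : (0 < p)%R -> (0 <= q)%R -> 0 <= x ->
  (q%:E < x `^ p) = ((q `^ p^-1)%R%:E < x).
Proof.
move=> p0 q0; have pn0 : p != 0%R by rewrite gt_eqF.
move: x => [x| |]//= x0; last by rewrite (negbTE pn0) !ltry.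
rewrite !lte_fin -[in LHS](powRVK (p := p) pn0 q0) ltr_powR// powR_ge0//.
Qed.

Lemma poweR_lt_EFin (R : realType) (p q : R) (x : \bar R) : (0 < p)%R -> (0 <= q)%R -> 0 <= x ->
  (x `^ p < q%:E) = (x < (q `^ p^-1)%R%:E).
Proof.
move=> p0 q0; have pn0 : p != 0%R by rewrite gt_eqF.
move: x => [x| |]//= x0; last by rewrite (negbTE pn0) !ltNge !leey.
rewrite !lte_fin -[in LHS](powRVK (p := p) pn0 q0) ltr_powR// powR_ge0//.
Qed.

Lemma lee_poweR (R : realType) (p : R) (x y : \bar R) : (0 <= p)%R ->
  0 <= x -> x <= y -> x `^ p <= y `^ p.
Proof.
move=> p0 x0 xy; apply: gt0_ler_poweR; rewrite ?in_itv /= ?leey ?andbT//.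
exact: le_trans xy.
Qed.

(** * Cuts of p-th powers and p-th roots *)

Section EffectivePowers.
Variables (R : realType) (p : R).
Hypothesis p_computable : computable_real p.
Hypothesis p_gt0 : (0 < p)%R.
Variables (Y : Type) (O : nat -> set Y) (D : set Y).
Hypothesis O_base : effective_base O.

Let rational0 : rational_seq (fun _ : nat => 0%R : R).
Proof. by apply: eq_rational_seq (rational_seq_nat R (computable_const 0)). Qed.

Let rational1 : rational_seq (fun _ : nat => 1%R : R).
Proof. by apply: eq_rational_seq (rational_seq_nat R (computable_const 1)). Qed.

Lemma eff_open_frac_near (b : bool) (x : nat -> R) m n :
  rational_seq x -> computable m -> computable n ->
  eff_open O D (fun k _ => frac_near b (x k) p (m k) (n k)).
Proof.
move=> hx hm hn; have [hl hu] := computable_real_seq p_computable.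
have hf : rational_seq (fun k => (m k)%:R / (n k).+1%:R : R)%R by comp.
have hl' := eff_lowerP hl hf (computable_const 0).
have hu' := eff_upperP hu hf (computable_const 0).
apply: eff_open_ext (_ : eff_open O D (fun k _ => if b
  then (1 <= x k)%R /\ ((m k)%:R / (n k).+1%:R)%R%:E < p%:E \/
       (x k <= 1)%R /\ p%:E < ((m k)%:R / (n k).+1%:R)%R%:E
  else (1 <= x k)%R /\ p%:E < ((m k)%:R / (n k).+1%:R)%R%:E \/
       (x k <= 1)%R /\ ((m k)%:R / (n k).+1%:R)%R%:E < p%:E)).
  move=> k _ _; rewrite !lte_fin /frac_near; case: b;
    by split=> [[[-> ->]|[-> ->]]|/orP[]/andP[-> ->]]; rewrite ?orbT//; auto.
by case: b; apply: eff_open_or => //; apply: eff_open_and => //;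
  by [apply: eff_open_dec => //; comp|apply: eff_open_re].
Qed.

Lemma eff_open_lt_powR (x r : nat -> R) : rational_seq x -> rational_seq r ->
  eff_open O D (fun n _ => (0 <= x n)%R /\ (r n < x n `^ p)%R).
Proof.
move=> hx hr.
apply: eff_open_ext (_ : eff_open O D (fun n _ => (0 <= x n)%R /\ ((r n < 0)%R \/
  (0 < x n)%R /\ (0 <= r n)%R /\ exists m k, frac_near true (x n) p m k /\
   (r n ^+ k.+1 < x n ^+ m)%R))).
  move=> n _ _; split => -[x0 h]; split => //.
    case: h => [|[x0' [r0]]]; first by move/lt_le_trans; apply; exact: powR_ge0.
    by move/ltr_powR_frac; apply.
  have [|r0] := ltP (r n) 0%R; [by left|right].
  have x0' : (0 < x n)%R.
    rewrite lt_neqAle x0 andbT; apply/eqP => xn0.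
    by move: h; rewrite -xn0 powR0 ?gt_eqF// ltNge r0.
  by split => //; split => //; apply/ltr_powR_frac.
apply: eff_open_and => //; first by apply: eff_open_dec => //; comp.
apply: eff_open_or => //; first by apply: eff_open_dec => //; comp.
apply: eff_open_and => //; first by apply: eff_open_dec => //; comp.
apply: eff_open_and => //; first by apply: eff_open_dec => //; comp.
apply: eff_open_ex; apply: eff_open_ex; apply: eff_open_and => //.
  by apply: eff_open_frac_near; [apply: (rational_seq_comp hx)| |]; comp.
have hx' := rational_seq_comp hx; have hr' := rational_seq_comp hr.
by apply: eff_open_dec => //; comp.
Qed.

Lemma eff_open_powR_lt (x r : nat -> R) : rational_seq x -> rational_seq r ->
  eff_open O D (fun n _ => (0 <= x n)%R /\ (x n `^ p < r n)%R).
Proof.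
move=> hx hr.
apply: eff_open_ext (_ : eff_open O D (fun n _ => (0 < r n)%R /\ ((0 <= x n)%R && (x n <= 0)%R \/
  (0 < x n)%R /\ exists m k, frac_near false (x n) p m k /\
   (x n ^+ m < r n ^+ k.+1)%R))).
  move=> n _ _; split => -[r0 h].
    case: h => [|[x0 h]].
      by rewrite -eq_le => /eqP <-; rewrite lexx powR0 ?gt_eqF.
    by rewrite (ltW x0); split => //; apply/gtr_powR_frac.
  have {}h' : (0 < r n)%R by apply: le_lt_trans h; exact: powR_ge0.
  split => //.
  have /orP[/eqP <-|x0] : (0 == x n)%R || (0 < x n)%R by rewrite -le_eqVlt.
    by left; rewrite lexx.
  by right; split => //; apply/gtr_powR_frac.
apply: eff_open_and => //; first by apply: eff_open_dec => //; comp.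
apply: eff_open_or => //; first by apply: eff_open_dec => //; comp.
apply: eff_open_and => //; first by apply: eff_open_dec => //; comp.
apply: eff_open_ex; apply: eff_open_ex; apply: eff_open_and => //.
  by apply: eff_open_frac_near; [apply: (rational_seq_comp hx)| |]; comp.
have hx' := rational_seq_comp hx; have hr' := rational_seq_comp hr.
by apply: eff_open_dec => //; comp.
Qed.

Variable x : nat -> Y -> \bar R.
Hypothesis x_ge0 : forall i z, D z -> 0 <= x i z.

Lemma eff_lower_powR : eff_lower O D x -> eff_lower O D (fun i z => x i z `^ p).
Proof.
move=> hx.
apply: eff_open_ext (_ : eff_open O D (fun n z => (qval R (nfst n) < 0)%R \/
  exists r, ((0 <= qval R r)%R /\ (qval R (nfst n) < qval R r `^ p)%R) /\
    (qval R r)%:E < x (nsnd n) z)).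
  move=> n z Dz; have xn0 := x_ge0 (nsnd n) Dz; split.
    move=> [q0|[r [[r0 qr] rx]]].
      by apply: (@lt_le_trans _ _ 0); [rewrite lte_fin|exact: poweR_ge0].
    apply: (@lt_le_trans _ _ ((qval R r)%:E `^ p)); first by rewrite lte_fin.
    by apply: lee_poweR; rewrite ?lee_fin// ltW.
  have [|q0] := ltP (qval R (nfst n)) 0%R; first by left.
  rewrite EFin_lt_poweR// => /qval_between[r /andP[qr rx]].
  right; exists r; split => //; rewrite lte_fin in qr.
  have r0 : (0 <= qval R r)%R by apply/ltW/(le_lt_trans _ qr); exact: powR_ge0.
  by rewrite r0 -(powRVK (p := p) _ q0) ?gt_eqF// ltr_powR// powR_ge0.
apply: eff_open_or => //; first by apply: eff_open_dec => //; comp.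
apply: eff_open_ex; apply: eff_open_and => //.
  by apply: eff_open_lt_powR; comp.
by apply: (eff_lowerP hx); comp.
Qed.

Lemma eff_upper_powR : eff_upper O D x -> eff_upper O D (fun i z => x i z `^ p).
Proof.
move=> hx.
apply: eff_open_ext (_ : eff_open O D (fun n z =>
  exists r, ((0 <= qval R r)%R /\ (qval R r `^ p < qval R (nfst n))%R) /\
    x (nsnd n) z < (qval R r)%:E)).
  move=> n z Dz; have xn0 := x_ge0 (nsnd n) Dz; split.
    move=> [r [[r0 qr] rx]].
    apply: (@le_lt_trans _ _ ((qval R r)%:E `^ p)); last by rewrite lte_fin.
    by apply: lee_poweR; rewrite ?lee_fin// ltW.
  move=> h; have q0 : (0 <= qval R (nfst n))%R.
    by rewrite -lee_fin; apply/ltW/(le_lt_trans _ h); exact: poweR_ge0.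
  move: h; rewrite poweR_lt_EFin// => /qval_between[r /andP[xr rq]].
  exists r; split => //; rewrite lte_fin in rq.
  have r0 : (0 <= qval R r)%R by rewrite -lee_fin; apply/ltW/(le_lt_trans _ xr).
  by rewrite r0 -[ltRHS](powRVK (p := p) _ q0) ?gt_eqF// ltr_powR// powR_ge0.
apply: eff_open_ex; apply: eff_open_and => //.
  by apply: eff_open_powR_lt; comp.
by apply: (eff_upperP hx); comp.
Qed.

(** For rational q >= 0, q is below the p-th root of x exactly when q^p < x, so roots reduce to
    powers of rationals with the exponent [p] itself. *)
Lemma eff_lower_root : eff_lower O D x -> eff_lower O D (fun i z => x i z `^ p^-1).
Proof.
move=> hx.
apply: eff_open_ext (_ : eff_open O D (fun n z => (qval R (nfst n) < 0)%R \/
  exists r, ((0 <= qval R (nfst n))%R /\ (qval R (nfst n) `^ p < qval R r)%R) /\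
    (qval R r)%:E < x (nsnd n) z)).
  move=> n z Dz; have xn0 := x_ge0 (nsnd n) Dz; split.
    move=> [q0|[r [[q0 qr] rx]]].
      by apply: (@lt_le_trans _ _ 0); [rewrite lte_fin|exact: poweR_ge0].
    by rewrite EFin_lt_poweR ?invr_gt0// invrK; apply: lt_trans rx; rewrite lte_fin.
  have [|q0] := ltP (qval R (nfst n)) 0%R; first by left.
  rewrite EFin_lt_poweR ?invr_gt0// invrK => /qval_between[r /andP[qr rx]].
  by right; exists r; rewrite lte_fin in qr.
apply: eff_open_or => //; first by apply: eff_open_dec => //; comp.
apply: eff_open_ex; apply: eff_open_and => //.
  by apply: eff_open_powR_lt; comp.
by apply: (eff_lowerP hx); comp.
Qed.

Lemma eff_upper_root : eff_upper O D x -> eff_upper O D (fun i z => x i z `^ p^-1).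
Proof.
move=> hx.
apply: eff_open_ext (_ : eff_open O D (fun n z =>
  exists r, ((0 <= qval R (nfst n))%R /\ (qval R r < qval R (nfst n) `^ p)%R) /\
    x (nsnd n) z < (qval R r)%:E)).
  move=> n z Dz; have xn0 := x_ge0 (nsnd n) Dz; split.
    move=> [r [[q0 qr] rx]].
    by rewrite poweR_lt_EFin ?invr_gt0// invrK; apply: lt_trans rx _; rewrite lte_fin.
  move=> h; have q0 : (0 <= qval R (nfst n))%R.
    by rewrite -lee_fin; apply/ltW/(le_lt_trans _ h); exact: poweR_ge0.
  move: h; rewrite poweR_lt_EFin ?invr_gt0// invrK => /qval_between[r /andP[xr rq]].
  by exists r; rewrite lte_fin in rq.
apply: eff_open_ex; apply: eff_open_and => //.
  by apply: eff_open_lt_powR; comp.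
by apply: (eff_upperP hx); comp.
Qed.

End EffectivePowers.

(** * Computable Polish spaces *)

Section Space.
Variables (R : realType) (X : completeMetricType R) (a : nat -> X).

Notation ballX := (basic_ball a).

Lemma basic_ballE j y : ballX j y = (mdist (a (nfst j)) y < posqval R (nsnd j))%R :> Prop.
Proof. by rewrite /basic_ball ballEmdist. Qed.

Lemma open_metric_ball (x : X) (r : R) : open (ball x r).
Proof.
rewrite openE => y; rewrite ballEmdist /= => xy; apply/nbhs_ballP.
exists (r - mdist x y)%R; first by rewrite /= subr_gt0.
move=> z; rewrite !ballEmdist /= => yz.
by apply: le_lt_trans (metric_triangle x y z) _; rewrite -ltrBrDl.
Qed.

Lemma dense_near (x : X) (e : R) : dense (range a) -> (0 < e)%R ->
  exists i, (mdist x (a i) < e)%R.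
Proof.
move=> da e0; have [||z [xz [i _ iz]]] := da (ball x e).
- by exists x; rewrite ballEmdist /= mdistxx.
- exact: open_metric_ball.
- by exists i; rewrite iz; rewrite ballEmdist in xz.
Qed.

Lemma finite_gap (d r : nat -> R) n : (forall m, (m < n)%N -> (d m < r m)%R) ->
  exists2 e : R, (0 < e)%R & forall m, (m < n)%N -> (d m + e < r m)%R.
Proof.
elim: n => [|n IH] h; first by exists 1%R.
have [m mn|e e0 he] := IH; first by apply: h; exact: ltnW.
have hn := h n (ltnSn n).
exists (Num.min e ((r n - d n) / 2))%R; first by rewrite lt_min e0 divr_gt0// subr_gt0.
move=> m; rewrite ltnS leq_eqVlt => /orP[/eqP ->|mn].
  have : (Num.min e ((r n - d n) / 2) <= (r n - d n) / 2)%R by rewrite ge_min lexx orbT.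
  by move=> h'; lra.
apply: le_lt_trans (he m mn); rewrite lerD2l ge_min lexx //.
Qed.

(** Formal inclusion asks that the distance of the centres plus the inner radius be smaller than the
    outer radius. The witness [w] is a precision at which the approximated distance, with its error
    added, proves this. *)
Lemma basic_ball_effective : computable_polish a -> effective_base ballX.
Proof.
move=> [da [g hg gdist]].
exists (fun l j w => qval R (g (npair (npair (nfst l) (nfst j)) w)) + 2^-1 ^+ w
  + posqval R (nsnd l) < posqval R (nsnd j))%R.
  have h1 : computable (fun n => g (npair (npair (nfst (nfst n)) (nfst (nfst (nsnd n)))) (nsnd (nsnd n)))).
    by apply: (computable_comp hg); comp.
  by comp.
have dE i j w : (`|mdist (a i) (a j) - qval R (g (npair (npair i j) w))| <= 2^-1 ^+ w)%R.
  by have := gdist (npair i j) w; rewrite !npairE.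
split=> [l j w hlj y|y n J hJ].
  rewrite !basic_ballE => ly.
  have := dE (nfst l) (nfst j) w; rewrite ler_distl => /andP[_ h].
  have h3 := metric_triangle (a (nfst j)) (a (nfst l)) y.
  have h4 := metric_sym (a (nfst j)) (a (nfst l)).
  by lra.
have [m mn|e e0 he] := @finite_gap (fun m => mdist (a (nfst (J m))) y)
    (fun m => posqval R (nsnd (J m))) n.
  by have := hJ m mn; rewrite basic_ballE.
(* The gap [e] is spent in quarters: on the new radius, on the distance from its centre to [y], and
   twice on the error 2^-w. *)
have [|k hk] := @posqval_lt R (e / 4); first by rewrite divr_gt0.
have [i hi] := dense_near y da (posqval_gt0 R k).
exists (npair i k); first by rewrite basic_ballE !npairE metric_sym.
move=> m mn; have := he m mn => hm.
have [|w hw] := @half_small R (e / 4); first by rewrite divr_gt0.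
exists w; rewrite !npairE.
have := dE i (nfst (J m)) w; rewrite ler_distl => /andP[h _].
have h3 := metric_triangle (a i) y (a (nfst (J m))).
have h4 := metric_sym y (a (nfst (J m))); have h5 := metric_sym y (a i).
by lra.
Qed.

Lemma open_ofE e x : open_of a e x <-> exists k j, e k = j.+1 /\ ballX j x.
Proof.
split=> [[j [k ek] jx]|[k [j [ek jx]]]]; first by exists k, j.
by exists j => //; exists k.
Qed.

Lemma open_open_of e : open (open_of a e).
Proof. by apply: bigcup_open => j _; exact: open_metric_ball. Qed.

Lemma measurable_open (U : set X) : open U -> measurable (U : set (borel X)).
Proof. by move=> oU; exact: sub_sigma_algebra. Qed.

Lemma uniformly_ce_openP (U : nat -> set X) :
  uniformly_ce_open a U <-> eff_open ballX setT U.
Proof.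
split=> -[e he eU]; exists e => // n.
  by move=> x _; rewrite eU open_ofE.
by apply/funext => x; apply/propext; rewrite eU// open_ofE.
Qed.

Lemma ce_open_eff_open (P : nat -> X -> Prop) i :
  eff_open ballX setT P -> ce_open a (P i).
Proof.
move=> /uniformly_ce_openP[e he eP]; exists (fun k => e (npair i k)); last exact: eP.
by apply: (computable_comp he); comp.
Qed.

Lemma measurable_eff_open (P : nat -> X -> Prop) i :
  eff_open ballX setT P -> measurable (P i : set (borel X)).
Proof.
move=> /(ce_open_eff_open i)[e _ ->]; apply: measurable_open; exact: open_open_of.
Qed.

Lemma uniformly_lscP (f : nat -> X -> \bar R) :
  uniformly_lsc a f <-> eff_lower ballX setT f.
Proof.
split=> [[g hg gf]|[e he ef]].
  exists (fun n => g (npair (nsnd (nfst n)) (npair (nfst (nfst n)) (nsnd n)))).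
    by apply: (computable_comp hg); comp.
  move=> n y _; have := gf (nsnd n) (nfst n) => /(congr1 (fun S : set X => S y)) /= ->.
  by rewrite open_ofE; split=> -[k [j h]]; exists k, j; rewrite ?npairE in h *.
exists (fun n => e (npair (npair (nfst (nsnd n)) (nfst n)) (nsnd (nsnd n)))).
  by apply: (computable_comp he); comp.
move=> i q; apply/funext => x; apply/propext; rewrite open_ofE.
have := ef (npair q i) x I; rewrite !npairE => H; apply: (iff_trans H).
by split=> -[k [j]]; rewrite ?npairE => h; exists k, j; rewrite ?npairE.
Qed.

Lemma lscP (f : X -> \bar R) : lsc a f <-> eff_lower ballX setT (fun _ => f).
Proof.
rewrite -uniformly_lscP; split=> -[g hg gf].
  exists (fun n => g (nsnd n)); first by apply: (computable_comp hg); comp.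
  move=> i; rewrite (_ : (fun k => _) = g)//.
  by apply/funext => k; rewrite npairE.
exists (fun k => g (npair 0 k)); first by apply: (computable_comp hg); comp.
exact: gf.
Qed.

Lemma measurable_eff_lower (f : nat -> X -> \bar R) i :
  eff_lower ballX setT f -> measurable_fun setT (f i : borel X -> \bar R).
Proof.
move=> hf; apply: measurability (ErealGenOInfty.measurableE R) _.
move=> _ [_ [r ->] <-]; rewrite setTI.
rewrite [X in measurable X](_ : _ = \bigcup_q [set x | (r < qval R q)%R /\ (qval R q)%:E < f i x]).
  apply: bigcupT_measurable => q.
  have [rq|rq] := ltP r (qval R q); last first.
    by rewrite [X in measurable X](_ : _ = set0)// -subset0 => x [].
  rewrite [X in measurable X](_ : _ = [set x | (qval R q)%:E < f i x]); last first.
    by apply/seteqP; split => [x []|x qx].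
  have := measurable_eff_open (npair q i) hf.
  by rewrite [X in measurable X](_ : _ = [set x | (qval R q)%:E < f i x])//; apply/funext => x; rewrite !npairE.
apply/seteqP; split => x /=; rewrite in_itv /= andbT.
  by move=> /qval_between[q /andP[rq qf]]; exists q => //; rewrite lte_fin in rq.
by move=> [q _ [rq qf]]; apply: lt_trans qf; rewrite lte_fin.
Qed.

Variable nu : probability (borel X) R.

(** Indexing the open sets by Gödel numbers writes [KR] as a countable intersection, which yields
    its measurability and full measure. An index giving no total enumeration of a set of measure 1
    contributes the whole space; by injectivity of the numbering every other one contributes a
    single open set. *)
Definition KR_cover (n : nat) : set X := [set x | forall c e,
  program_index c = n -> computes c e -> nu (open_of a e) = 1 -> open_of a e x].

Lemma KR_bigcap : KR a nu = \bigcap_n KR_cover n.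
Proof.
apply/seteqP; split => [x Kx n _ c e _ ce e1|x Kx U [e [c ce] ->] e1].
  by apply: Kx => //; exists e => //; exists c.
exact: (Kx (program_index c)).
Qed.

Lemma KR_coverE n : KR_cover n = setT \/
  exists e, nu (open_of a e) = 1 /\ KR_cover n = open_of a e.
Proof.
have [[c [e [cn ce e1]]]|h] := pselect (exists c e, [/\ program_index c = n, computes c e &
  nu (open_of a e) = 1]); last first.
  left; apply/seteqP; split => // x _ c e cn ce e1.
  by exfalso; apply: h; exists c, e.
right; exists e; split => //; apply/seteqP; split => [x|x ex c' e' cn' ce' _].
  by move=> /(_ c e cn ce e1).
have cc' : c' = c by apply: program_index_inj; rewrite cn'.
by rewrite cc' in ce'; rewrite (computes_functional ce' ce).
Qed.

Lemma measurable_KR_cover n : measurable (KR_cover n : set (borel X)).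
Proof.
have [->|[e [_ ->]]] := KR_coverE n; first exact: measurableT.
by apply: measurable_open; exact: open_open_of.
Qed.

Lemma measurable_KR : measurable (KR a nu : set (borel X)).
Proof. by rewrite KR_bigcap; apply: bigcapT_measurable; exact: measurable_KR_cover. Qed.

Lemma KR_ae : {ae nu, forall x, KR a nu x}.
Proof.
have : nu.-negligible (\bigcup_n ~` KR_cover n : set (borel X)).
  apply: negligible_bigcup => n; apply/negligibleP.
    by apply: measurableC; exact: measurable_KR_cover.
  have [->|[e [e1 ->]]] := KR_coverE n; first by rewrite setCT measure0.
  have me : measurable (open_of a e : set (borel X)).
    by apply: measurable_open; exact: open_open_of.
  by have := probability_setC nu me; rewrite e1 subee.
apply: negligibleS => x /=; rewrite KR_bigcap => h.
by apply: contrapT => hx; apply: h => n _; apply: contrapT => hn; apply: hx; exists n.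
Qed.

Hypothesis nu_computable : computable_measure a nu.

Lemma eff_lower_nu P : eff_open ballX setT P ->
  eff_lower trivial_base setT (fun i _ => nu (P i)).
Proof.
move=> hP; have [e he eP] := (uniformly_ce_openP P).2 hP.
have [g hg gnu] := effectively_uniform nu_computable he computable_id.
apply: eff_open_ext (_ : eff_open trivial_base setT (fun n _ =>
  exists k, (qval R (nfst n) < qval R (g (npair (nsnd n) k)))%R)).
  by move=> n _ _; rewrite eP (left_nameP _ (gnu (nsnd n))).
have hg' : computable (fun n => g (npair (nsnd (nfst n)) (nsnd n))).
  by apply: (computable_comp hg); comp.
by comp.
Qed.

Variable rho : nat -> R.-ker (borel X) ~> (borel X).
Hypothesis rho_lsc : effectively (fun n e g => lsc_name a g (fun x => rho n x (open_of a e))).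

Lemma eff_lower_rho P : eff_open ballX setT P ->
  eff_lower ballX setT (fun i x => rho (nfst i) x (P (nsnd i))).
Proof.
move=> hP; have [e he eP] := (uniformly_ce_openP P).2 hP.
have he' : computable (fun n => e (npair (nsnd (nfst n)) (nsnd n))).
  by apply: (computable_comp he); comp.
have [g hg grho] := effectively_uniform rho_lsc he' (computable_fst computable_id).
apply/uniformly_lscP; exists g => // i; have := grho i.
rewrite (_ : (fun k => e _) = (fun k => e (npair (nsnd i) k))).
  by rewrite -eP.
by apply/funext => k; rewrite !npairE.
Qed.

End Space.

(** * Integrals of lower semi-computable functions *)

Section StepSums.
Variable R : realType.
Implicit Types (d : R) (y : \bar R).

(** The layer-cake form of rounding [y] down to the grid of mesh [d], cut off at [M * d]. Each level
    contributes the indicator of a strict superlevel set, so that for lower semi-computable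
    functions the integral is a finite combination of measures of c.e. open sets. *)
Definition step_sum d (M : nat) y : R :=
  (\sum_(m < M) (if ((m.+1%:R * d)%R%:E < y)%E then d else 0))%R.

Lemma step_sum_le d M y : (0 <= d)%R -> 0 <= y -> (step_sum d M y)%:E <= y.
Proof.
move=> d0 y0; suff : (step_sum d M y <= M%:R * d)%R /\ (step_sum d M y)%:E <= y by case.
elim: M => [|M [IH1 IH2]]; first by rewrite /step_sum big_ord0 mul0r.
rewrite /step_sum big_ord_recr /= -/(step_sum d M y); case: ifPn => h.
  have h1 : (step_sum d M y + d <= M.+1%:R * d)%R by rewrite -natr1 mulrDl mul1r lerD2r.
  by split => //; apply: le_trans (ltW h); rewrite lee_fin.
by rewrite addr0; split => //; rewrite -natr1 mulrDl mul1r -[leLHS]addr0 lerD.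
Qed.

Lemma step_sum_ge d M y : (0 <= d)%R ->
  step_sum d M y = (M%:R * d)%R \/ y <= (step_sum d M y + d)%:E.
Proof.
move=> d0; elim: M => [|M IH]; first by left; rewrite /step_sum big_ord0 mul0r.
rewrite /step_sum big_ord_recr /= -/(step_sum d M y); case: ifPn => h; last first.
  rewrite addr0 -leNgt in h *; case: IH => [->|]; last by right.
  by right; rewrite -natr1 mulrDl mul1r in h.
case: IH => [->|IH]; first by left; rewrite -natr1 mulrDl mul1r.
have := lt_le_trans h IH; rewrite lte_fin => h'.
have M0 : (step_sum d M y <= M%:R * d)%R.
  rewrite /step_sum; elim: M {h IH h'} => [|k IHk]; first by rewrite big_ord0 mul0r.
  rewrite big_ord_recr /= -natr1 mulrDl mul1r; apply: lerD => //.
  by case: ifP.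
by exfalso; move: h'; rewrite -natr1 mulrDl mul1r; lra.
Qed.

(** With [N * 2 ^ N] levels of height 2^-N the sum reaches up to [N], so that the mesh vanishes and
    the cutoff disappears together. *)
Definition dyadic_sum (N : nat) y : R := step_sum (2^-1 ^+ N) (N * 2 ^ N) y.

Lemma dyadic_sum_cvg y : 0 <= y -> (dyadic_sum N y)%:E @[N --> \oo] --> y.
Proof.
have E N : ((N * 2 ^ N)%:R * 2^-1 ^+ N = N%:R :> R)%R.
  by rewrite natrM natrX -mulrA -exprMn divff ?pnatr_eq0// expr1n mulr1.
have d0 N : (0 <= 2^-1 ^+ N :> R)%R by rewrite exprn_ge0.
move: y => [y| |]//; first last.
  move=> _; apply/cvgeryP; apply/cvgryPge => A.
  near=> N; have [h|] := step_sum_ge (N * 2 ^ N) +oo (d0 N); last by rewrite leye_eq.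
  by rewrite /dyadic_sum h E; near: N; exact: nbhs_infty_ger.
rewrite lee_fin => y0; apply: cvg_EFin; first by near=> N.
apply/cvgrPdist_le => e e0; near=> N.
have h1 := step_sum_le (N * 2 ^ N) (d0 N) (y0 : 0 <= y%:E); rewrite lee_fin in h1.
have yN : (y < N%:R)%R by near: N; exact: nbhs_infty_gtr.
have Ne : (2^-1 ^+ N <= e)%R.
  near: N; have : (2^-1 ^+ k : R)%R @[k --> \oo] --> 0%R.
    by apply: cvg_expr; rewrite ger0_norm// invf_lt1// ltr1n.
  move/cvgrPdist_le => /(_ e e0); apply: filterS => k.
  by rewrite sub0r normrN ger0_norm.
have [h|h] := step_sum_ge (N * 2 ^ N) y%:E (d0 N).
  by exfalso; move: h1 yN; rewrite h E => h1 /(le_lt_trans h1); rewrite ltxx.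
rewrite lee_fin in h; rewrite /= ger0_norm; last by rewrite subr_ge0.
by rewrite lerBlDl; apply: le_trans h _; rewrite lerD2l.
Unshelve. all: by end_near.
Qed.

End StepSums.

Section DyadicIntegral.
Variables (d : measure_display) (T : measurableType d) (R : realType).
Variables (mu : {measure set T -> \bar R}) (f : T -> \bar R).
Hypotheses (mf : measurable_fun setT f) (f0 : forall x, 0 <= f x).

Lemma measurable_dyadic_sum N : measurable_fun setT (fun x => (dyadic_sum N (f x))%:E).
Proof.
apply/measurable_EFinP; rewrite /dyadic_sum /step_sum.
apply: measurable_sum => m.
apply: measurable_fun_ifT => //; exact: measurable_fun_lte.
Qed.

Lemma integral_dyadic_sum N : \int[mu]_x (dyadic_sum N (f x))%:E =
  \sum_(m < N * 2 ^ N) (2^-1 ^+ N)%R%:E * mu [set x | (m.+1%:R * 2^-1 ^+ N)%R%:E < f x].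
Proof.
pose A m := [set x | (m.+1%:R * 2^-1 ^+ N)%R%:E < f x].
have mA m : measurable (A m).
  rewrite -[X in measurable X]setTI; apply: measurable_lte => //.
transitivity (\int[mu]_x \sum_(m < N * 2 ^ N) ((2^-1 ^+ N)%R * \1_(A m) x)%:E).
  apply: eq_integral => x _; rewrite /dyadic_sum /step_sum sumEFin; congr EFin.
  apply: eq_bigr => m _; rewrite indicE; case: ifPn => h.
    by rewrite mem_set// mulr1.
  by rewrite memNset ?mulr0//; exact/negP.
rewrite ge0_integral_sum//.
- apply: eq_bigr => m _.
  under eq_integral do rewrite EFinM.
  rewrite ge0_integralZl//; last by apply/measurable_EFinP; exact: measurable_indic.
  by rewrite integral_indic// setIT.
- by move=> m; apply/measurable_EFinP/measurable_funM => //; exact: measurable_indic.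
Qed.

Lemma lt_integral_dyadic q : q < \int[mu]_x f x <->
  exists N, q < \sum_(m < N * 2 ^ N)
    (2^-1 ^+ N)%R%:E * mu [set x | (m.+1%:R * 2^-1 ^+ N)%R%:E < f x].
Proof.
have S0 N x : 0 <= (dyadic_sum N (f x))%:E.
  by rewrite lee_fin sumr_ge0// => m _; case: ifP; rewrite ?exprn_ge0.
split=> [qf|[N]]; last first.
  rewrite -integral_dyadic_sum => /lt_le_trans; apply.
  apply: ge0_le_integral => //; first exact: measurable_dyadic_sum.
  by move=> x _; apply: step_sum_le => //; rewrite exprn_ge0.
(* The sums stay below [f] and converge to it pointwise. A lower bound on the limit inferior of
   their integrals is all that is asked for, and Fatou's lemma gives it. *)
have := fatou mu measurableT (fun N => measurable_dyadic_sum N) (fun N x _ => S0 N x).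
under [X in X <= _]eq_integral => x _ do
  rewrite (cvg_limn_einf_sup (dyadic_sum_cvg (f0 x))).1.
move=> /(lt_le_trans qf); rewrite limn_einf_lim.
rewrite (cvg_lim _ (ereal_nondecreasing_cvgn (nondecreasing_einfs _)))//.
move=> /ereal_sup_gt[_ [N _ <-] qN]; exists N; rewrite -integral_dyadic_sum.
by apply: lt_le_trans qN _; apply: ereal_inf_lbound; exists N => /=.
Qed.

End DyadicIntegral.

Section EffectiveIntegral.
Variables (R : realType) (X : completeMetricType R) (a : nat -> X).
Variables (Y : Type) (O : nat -> set Y) (D : set Y).
Hypothesis O_base : effective_base O.
Variable mu : nat -> Y -> {measure set (borel X) -> \bar R}.
Hypothesis mu_eff : forall P, eff_open (basic_ball a) setT P ->
  eff_lower O D (fun i y => mu (nfst i) y (P (nsnd i))).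

Lemma eff_lower_integral (f : nat -> X -> \bar R) : (forall i x, 0 <= f i x) ->
  eff_lower (basic_ball a) setT f ->
  eff_lower O D (fun i y => \int[mu (nfst i) y]_(x in (setT : set (borel X))) f (nsnd i) x).
Proof.
move=> f0 hf.
have mf i : measurable_fun setT (f i : borel X -> \bar R) by exact: measurable_eff_lower hf.
apply: eff_open_ext (_ : eff_open O D (fun n y => exists N, (qval R (nfst n))%:E <
  \sum_(m < N * 2 ^ N) (2^-1 ^+ N)%R%:E * mu (nfst (nsnd n)) y
    [set x | (m.+1%:R * 2^-1 ^+ N)%R%:E < f (nsnd (nsnd n)) x])).
  by move=> n y Dy; rewrite (lt_integral_dyadic _ (mf _) (f0 _)).
apply: eff_open_ex.
(* index of the summand: ((((q, (k, i)), N), m) *)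
pose v n y := (2^-1 ^+ nsnd (nfst n))%R%:E * mu (nfst (nsnd (nfst (nfst n)))) y
  [set x | ((nsnd n).+1%:R * 2^-1 ^+ nsnd (nfst n))%R%:E < f (nsnd (nsnd (nfst (nfst n)))) x].
have hv : eff_lower O D v.
  have hP : eff_open (basic_ball a) setT (fun n x =>
      ((nsnd n).+1%:R * 2^-1 ^+ nsnd (nfst n))%R%:E < f (nsnd (nsnd (nfst (nfst n)))) x).
    by apply: (eff_lowerP hf); comp.
  have h := eff_lowerP (mu_eff hP).
  apply: eff_open_ext (h (fun n => qval R (nfst n) * (2 ^ (nsnd (nfst (nsnd n))))%:R)%R
    (fun n => npair (nfst (nsnd (nfst (nfst (nsnd n))))) (nsnd n)) _ _); [|by comp..].
  move=> n y _; rewrite /v !npairE EFinM muleC.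
  by rewrite exprVn lte_pdivlMl ?exprn_gt0// natrX.
have v0 n y : D y -> v n y != -oo.
  by move=> _; rewrite -ltNye; apply: (@lt_le_trans _ _ 0) => //; apply: mule_ge0; rewrite ?lee_fin ?exprn_ge0.
have hS := @eff_lower_sum _ _ _ _ O_base (fun n m => v (npair n m))
  (fun n => nsnd n * 2 ^ nsnd n)%N (fun i m z Dz => v0 _ _ Dz) _ _.
apply: eff_open_ext (eff_lowerP (hS _ _) (r := fun n => qval R (nfst (nfst n)))
  (h := fun n => n) _ _); [|by apply: eff_open_ext hv => n y _; rewrite npairK|by comp..].
move=> n y _; under eq_bigr => m _ do rewrite /v !npairE.
by [].
Qed.

End EffectiveIntegral.

(** * Norms and Doob's inequality *)

Section LnormFacts.
Variables (d : measure_display) (T : measurableType d) (R : realType).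
Variables (mu : {measure set T -> \bar R}) (p : R).
Hypothesis p_ge1 : (1 <= p)%R.
Implicit Types f g : T -> \bar R.

Let p_gt0 : (0 < p)%R. Proof. exact: lt_le_trans p_ge1. Qed.
Let p_neq0 : p != 0%R. Proof. by rewrite gt_eqF. Qed.
Local Notation N f := ('N[mu]_(p%:E)[f]).

Lemma ge0_LnormE f : (forall x, 0 <= f x) -> N f = (\int[mu]_x f x `^ p) `^ p^-1.
Proof.
move=> f0; rewrite unlock; congr (_ `^ _).
by apply: eq_integral => x _; rewrite gee0_abs.
Qed.

Lemma measurable_poweR_comp f r : measurable_fun setT f ->
  measurable_fun setT (fun x => f x `^ r).
Proof. by move=> mf; exact: (measurableT_comp (measurable_poweR r) mf). Qed.

Lemma ae_le_Lnorm f g : measurable_fun setT f -> measurable_fun setT g ->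
  {ae mu, forall x, `|f x| <= `|g x|} -> N f <= N g.
Proof.
move=> mf mg fg; rewrite unlock; apply: lee_poweR.
- by rewrite invr_ge0 ltW.
- by apply: integral_ge0 => x _; exact: poweR_ge0.
apply: ae_ge0_le_integral => // [x _||x _||]; rewrite ?poweR_ge0//.
- by apply: (@measurable_poweR_comp (fun x => `|f x|)); exact: measurableT_comp.
- by apply: (@measurable_poweR_comp (fun x => `|g x|)); exact: measurableT_comp.
by apply: filterS fg => x fgx _; apply: lee_poweR => //; exact: ltW.
Qed.

Lemma ae_eq_Lnorm f g : measurable_fun setT f -> measurable_fun setT g ->
  {ae mu, forall x, f x = g x} -> N f = N g.
Proof.
move=> mf mg fg; apply/eqP; rewrite eq_le !ae_le_Lnorm//.
  by apply: filterS fg => x ->.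
by apply: filterS fg => x ->.
Qed.

Lemma Lnorm_lty_ae f : measurable_fun setT f -> (forall x, 0 <= f x) ->
  N f < +oo -> {ae mu, forall x, f x \is a fin_num}.
Proof.
move=> mf f0; rewrite ge0_LnormE// => /lty_poweRy; rewrite invr_eq0 => /(_ p_neq0) h.
have : mu.-integrable setT (fun x => f x `^ p).
  apply/integrableP; split; first exact: measurable_poweR_comp.
  by under eq_integral => x _ do rewrite gee0_abs ?poweR_ge0//.
move=> /(integrable_ae measurableT); apply: filterS => x /(_ I).
by rewrite !ge0_fin_numE ?poweR_ge0//; exact: lty_poweRy.
Qed.

Lemma Lnorm_le_of_integral f (c : R) : (forall x, 0 <= f x) -> (0 <= c)%R ->
  \int[mu]_x f x `^ p <= (c `^ p)%R%:E -> N f <= c%:E.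
Proof.
move=> f0 c0 h; rewrite ge0_LnormE//.
rewrite (_ : c%:E = (c `^ p)%R%:E `^ p^-1); last by rewrite /= powRK.
apply: lee_poweR => //; first by rewrite invr_ge0 ltW.
by apply: integral_ge0 => x _; exact: poweR_ge0.
Qed.

(** Reduces to Minkowski's inequality for real-valued functions: if both norms are finite, the
    functions are finite almost everywhere and agree there with their [fine] parts. *)
Lemma ge0_minkowski f g : measurable_fun setT f -> measurable_fun setT g ->
  (forall x, 0 <= f x) -> (forall x, 0 <= g x) -> N (f \+ g) <= N f + N g.
Proof.
move=> mf mg f0 g0.
have [fy|fy] := eqVneq (N f) +oo; first by rewrite fy addye ?leey// -ltNye (lt_le_trans _ (Lnorm_ge0 _ _ _)).
have [gy|gy] := eqVneq (N g) +oo; first by rewrite gy addey ?leey// -ltNye (lt_le_trans _ (Lnorm_ge0 _ _ _)).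
rewrite -ltey in fy; rewrite -ltey in gy.
have aef := Lnorm_lty_ae mf f0 fy; have aeg := Lnorm_lty_ae mg g0 gy.
have mff : measurable_fun setT (fine \o f) by exact: (measurableT_comp (fine_measurable measurableT) mf).
have mgg : measurable_fun setT (fine \o g) by exact: (measurableT_comp (fine_measurable measurableT) mg).
rewrite (@ae_eq_Lnorm f (EFin \o (fine \o f))) //; last 2 first.
- exact/measurable_EFinP.
- by apply: filterS aef => x fx; rewrite /= fineK.
rewrite (@ae_eq_Lnorm g (EFin \o (fine \o g))) //; last 2 first.
- exact/measurable_EFinP.
- by apply: filterS aeg => x fx; rewrite /= fineK.
rewrite (@ae_eq_Lnorm (f \+ g) (EFin \o ((fine \o f) \+ (fine \o g))%R)) //.
- exact: minkowski_EFin.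
- exact: emeasurable_funD.
- by apply/measurable_EFinP; exact: measurable_funD.
- by apply: filterS2 aef aeg => x fx gx; rewrite /= EFinD !fineK.
Qed.

Lemma ge0_Lnorm_sum (f : nat -> T -> \bar R) n : (forall i, measurable_fun setT (f i)) ->
  (forall i x, 0 <= f i x) ->
  N (fun x => \sum_(0 <= i < n) f i x) <= \sum_(0 <= i < n) N (f i).
Proof.
move=> mf f0; elim: n => [|n IH].
  by rewrite big_nil; under eq_Lnorm do rewrite big_nil; rewrite Lnorm0.
rewrite big_nat_recr //= (@eq_Lnorm _ _ _ _ _ _ ((fun x => \sum_(0 <= i < n) f i x) \+ f n)); last first.
  by move=> x; rewrite big_nat_recr.
apply: le_trans (ge0_minkowski _ _ _ _) _ => //.
- exact: emeasurable_sum.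
- by move=> x; exact: sume_ge0.
- by rewrite leeD2r.
Qed.

Lemma poweR_sup (u : nat -> \bar R) : (forall n, 0 <= u n) ->
  ereal_sup (range u) `^ p = ereal_sup (range (fun n => u n `^ p)).
Proof.
move=> u0; have s0 : 0 <= ereal_sup (range u).
  by apply: le_trans (u0 0%N) _; apply: ereal_sup_ubound; exists 0%N.
apply/eqP; rewrite eq_le; apply/andP; split; last first.
  apply: ge_ereal_sup => _ [n _ <-]; apply: lee_poweR => //; first exact: ltW.
  by apply: ereal_sup_ubound; exists n.
rewrite leNgt; apply/negP => /qval_between[q /andP[q1 q2]].
have q0 : (0 <= qval R q)%R.
  rewrite -lee_fin; apply/ltW/(le_lt_trans _ q1).
  by apply: le_trans (poweR_ge0 (u 0%N) p) _; apply: ereal_sup_ubound; exists 0%N.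
move: q2; rewrite EFin_lt_poweR// => /ereal_sup_gt[_ [n _ <-]].
rewrite -EFin_lt_poweR// ltNge => /negP; apply; apply/ltW/(le_lt_trans _ q1).
by apply: ereal_sup_ubound; exists n.
Qed.

Lemma nneseries_sup (u : nat -> \bar R) : (forall n, 0 <= u n) ->
  \sum_(0 <= i <oo) u i = ereal_sup (range (fun n => \sum_(0 <= i < n) u i)).
Proof.
move=> u0; apply/cvg_lim => //; apply: ereal_nondecreasing_cvgn.
by apply: ereal_nondecreasing_series.
Qed.

Lemma ge0_Lnorm_nneseries (f : nat -> T -> \bar R) :
  (forall i, measurable_fun setT (f i)) -> (forall i x, 0 <= f i x) ->
  N (fun x => \sum_(0 <= i <oo) f i x) <= \sum_(0 <= i <oo) N (f i).
Proof.
move=> mf f0; rewrite ge0_LnormE; last by move=> x; exact: nneseries_ge0.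
pose S n x := \sum_(0 <= i < n) f i x.
have S0 n x : 0 <= S n x by exact: sume_ge0.
have ndS x : {homo (fun n => S n x `^ p) : n m / (n <= m)%N >-> n <= m}.
  move=> n m nm; apply: lee_poweR => //; first exact: ltW.
  exact: ereal_nondecreasing_series.
have mS n : measurable_fun setT (fun x => S n x `^ p).
  by apply: measurable_poweR_comp; exact: emeasurable_sum.
have -> : \int[mu]_x (\sum_(0 <= i <oo) f i x) `^ p =
    ereal_sup (range (fun n => \int[mu]_x (S n x `^ p))).
  under eq_integral => x _.
    rewrite nneseries_sup// poweR_sup; last by move=> n; exact: S0.
    rewrite -(cvg_lim _ (ereal_nondecreasing_cvgn (ndS x)))//.
    over.
  rewrite monotone_convergence//; last by move=> n x _; exact: poweR_ge0.
  apply/cvg_lim => //; apply: ereal_nondecreasing_cvgn => n m nm.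
  apply: ge0_le_integral => // x _; try exact: poweR_ge0.
  exact: ndS.
set B := \sum_(0 <= i <oo) N (f i).
have B0 : 0 <= B by apply: nneseries_ge0 => n _ _; exact: Lnorm_ge0.
have -> : B = (B `^ p) `^ p^-1 by rewrite -poweRrM divff// poweRe1.
apply: lee_poweR; first by rewrite invr_ge0 ltW.
  apply: le_trans (ereal_sup_ubound _); last by exists 0%N.
  by apply: integral_ge0 => x _; exact: poweR_ge0.
apply: ge_ereal_sup => _ [n _ <-].
have -> : \int[mu]_x (S n x `^ p) = N (S n) `^ p.
  rewrite poweR_Lnorm//; apply: eq_integral => x _; rewrite gee0_abs//; exact: S0.
apply: lee_poweR; [exact: ltW|exact: Lnorm_ge0|].
apply: (le_trans (ge0_Lnorm_sum n mf f0)).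
by apply: nneseries_lim_ge => i _ _; exact: Lnorm_ge0.
Qed.

End LnormFacts.

Lemma integral_probability_cst (d : measure_display) (T : measurableType d) (R : realType)
    (P : probability T R) (r : R) : \int[P]_x r%:E = r%:E.
Proof. by rewrite integral_cst// -[RHS]mule1; congr (_ * _); exact: probability_setT. Qed.

Lemma polynomial_le_exp2 (R : realType) k : exists2 C : R, (0 <= C)%R &
  forall s : nat, (s.+1%:R ^+ k <= C * 2 ^+ s)%R.
Proof.
(* For this [l], (1 + s l)^k <= exp (k s l) <= 2^s. Dividing by [k.+1] rather than [k] covers
   [k = 0]. *)
pose l : R := (ln 2 / k.+1%:R)%R.
have l0 : (0 < l)%R by rewrite divr_gt0// ln_gt0// ltr1n.
exists ((1 + l^-1) ^+ k)%R.
  by rewrite exprn_ge0// addr_ge0// invr_ge0 ltW.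
move=> s.
have h : ((1 + s%:R * l) ^+ k <= 2 ^+ s :> R)%R.
  apply: (@le_trans _ _ (expR (s%:R * l) ^+ k)%R).
    apply: lerXn2r; last exact: expR_ge1Dx.
      by rewrite nnegrE addr_ge0// mulr_ge0// ltW.
    by rewrite nnegrE expR_ge0.
  rewrite -expRM_natr.
  apply: (@le_trans _ _ (expR (ln 2 * s%:R)))%R; last first.
    by rewrite expRM_natr lnK// posrE.
  rewrite ler_expR /l -!mulrA [leRHS]mulrC; apply: ler_wpM2l => //.
  rewrite -[leRHS]mulr1; apply: ler_wpM2l; first by rewrite ltW// ln_gt0// ltr1n.
  by rewrite mulrC ler_pdivrMr ?ltr0Sn// mul1r ler_nat.
apply: (@le_trans _ _ ((1 + l^-1) ^+ k * (1 + s%:R * l) ^+ k)%R); last first.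
  by apply: ler_wpM2l => //; rewrite exprn_ge0// addr_ge0// invr_ge0 ltW.
have l1 : (0 <= l^-1)%R by rewrite invr_ge0 ltW.
have sl : (0 <= s%:R * l)%R by rewrite mulr_ge0// ltW.
rewrite -exprMn; apply: lerXn2r; [by rewrite nnegrE|by rewrite nnegrE mulr_ge0// addr_ge0|].
have -> : ((1 + l^-1) * (1 + s%:R * l) = 1 + s%:R * l + l^-1 + s%:R)%R.
  by field; rewrite gt_eqF.
by rewrite -natr1; lra.
Qed.

(** The reason for the rate 4^-s: the polynomial weight consumes a factor 2^s and leaves a
    convergent geometric series. *)
Lemma quarter_polynomial_summable (R : realType) k :
  \sum_(0 <= s <oo) ((4^-1 : R) ^+ s)%R%:E * ((s.+1 ^ k)%N%:R)%:E < +oo.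
Proof.
have [C C0 hC] := polynomial_le_exp2 R k.
have half n : (\sum_(0 <= i < n) 2^-1 ^+ i <= 2 :> R)%R.
  suff -> : (\sum_(0 <= i < n) 2^-1 ^+ i = 2 - 2 * 2^-1 ^+ n :> R)%R.
    by rewrite gerBl mulr_ge0// exprn_ge0.
  elim: n => [|n IH]; first by rewrite big_nil expr0 mulr1 subrr.
  by rewrite big_nat_recr //= IH exprS; lra.
rewrite nneseries_sup; last by move=> s; rewrite -EFinM lee_fin mulr_ge0// exprn_ge0.
apply: (@le_lt_trans _ _ (C * 2)%R%:E); last by rewrite ltry.
apply: ge_ereal_sup => _ [n _ <-].
apply: (@le_trans _ _ (\sum_(0 <= s < n) (C * 2^-1 ^+ s)%R%:E)); last first.
  by rewrite sumEFin lee_fin -mulr_sumr ler_wpM2l.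
apply: lee_sum => s _; rewrite -EFinM lee_fin natrX.
have -> : (4^-1 = 2^-1 * 2^-1 :> R)%R by rewrite -invfM -natrM.
have -> : (C * 2^-1 ^+ s = (2^-1 * 2^-1) ^+ s * (C * 2 ^+ s) :> R)%R.
  by rewrite mulrCA -exprMn -mulrA mulVf// mulr1.
by apply: ler_wpM2l; rewrite ?exprn_ge0 ?mulr_ge0.
Qed.

Section DoobInequality.
Variables (d : measure_display) (T : measurableType d) (R : realType).
Variables (mu : probability T R) (p c : R) (D : T -> R) (s : nat -> T -> R).
Hypotheses (p_gt1 : (1 < p)%R) (mD : measurable_fun setT D)
  (ms : forall i, measurable_fun setT (s i))
  (D_bounds : forall x, (0 <= D x <= c)%R) (s_bounds : forall i x, (0 <= s i x <= c)%R).
Local Notation m := (running_max s).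
(* the martingale property, for the weights [m i `^ (p - 1)] only *)
Hypothesis martingale : forall i j, (i <= j)%N ->
  \int[mu]_x (s j x * m i x `^ (p - 1))%R%:E = \int[mu]_x (D x * m i x `^ (p - 1))%R%:E.
Let q : R := (p / (p - 1))%R.

Let p_gt0 : (0 < p)%R. Proof. exact: lt_trans p_gt1. Qed.
Let q_ge1 : (1 <= q)%R. Proof. exact: conj_exponent_ge1. Qed.

Let m_bounds i x : (0 <= m i x <= c)%R.
Proof.
elim: i => [|i /andP[IH1 IH2]] //=.
by have /andP[h1 h2] := s_bounds i.+1 x; rewrite le_max IH1 ge_max IH2.
Qed.

Let mm i : measurable_fun setT (m i).
Proof. by elim: i => [|i IH] //=; exact: measurable_maxr. Qed.

Let mpow (f : T -> R) r : measurable_fun setT f -> measurable_fun setT (fun x => f x `^ r)%R.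
Proof. by move=> mf; exact: (measurableT_comp (measurable_powR r) mf). Qed.

Let integral_fin (f : T -> R) : measurable_fun setT f ->
  (exists C : R, forall x, 0 <= f x <= C)%R -> \int[mu]_x (f x)%:E \is a fin_num.
Proof.
move=> mf [C fC]; rewrite ge0_fin_numE; last by apply: integral_ge0 => x _; rewrite lee_fin; case/andP: (fC x).
apply: (@le_lt_trans _ _ (\int[mu]_x C%:E)).
  apply: ge0_le_integral => //.
  - by move=> x _; rewrite lee_fin; case/andP: (fC x).
  - exact/measurable_EFinP.
  - by move=> x _; rewrite lee_fin; case/andP: (fC x).
by rewrite integral_probability_cst ltry.
Qed.

(** Integrating [powR_max_increment] shows that q times the integral of D m_i^(p-1), minus the
    integral of m_i^p, does not decrease with i. The martingale property enters with the weights of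
    [m i] and of [m i.+1], where it exchanges [s i.+1] for [D]. It remains to absorb half of the
    integral of m_N^p by [young_split], hence the constant 2 q. *)
Lemma doob_inequality N :
  \int[mu]_x (m N x `^ p)%R%:E <= ((2 * q) `^ p)%R%:E * \int[mu]_x (D x `^ p)%R%:E.
Proof.
have I_fin (f : T -> R) i r : (0 <= r)%R -> measurable_fun setT f -> (forall x, 0 <= f x <= c)%R ->
    \int[mu]_x (f x * m i x `^ r)%R%:E \is a fin_num.
  move=> r0 mf fc; apply: integral_fin; first by apply: measurable_funM => //; exact: mpow.
  exists (c * c `^ r)%R => x; have /andP[f1 f2] := fc x; have /andP[m1 m2] := m_bounds i x.
  rewrite mulr_ge0 ?powR_ge0//=; apply: ler_pM; rewrite ?powR_ge0//.
  by apply: ge0_ler_powR; rewrite ?nnegrE// (le_trans m1).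
have q_ge0 : (0 <= q)%R by apply: le_trans q_ge1.
have p1_ge0 : (0 <= p - 1)%R by rewrite subr_ge0 ltW.
have D0 x : (0 <= D x)%R by case/andP: (D_bounds x).
have s0 i x : (0 <= s i x)%R by case/andP: (s_bounds i x).
have m0 i x : (0 <= m i x)%R by case/andP: (m_bounds i x).
have mp1 (f : T -> R) i : measurable_fun setT f ->
    measurable_fun setT (fun x => (f x * m i x `^ (p - 1))%R%:E).
  by move=> mf; apply/measurable_EFinP/measurable_funM => //; exact: mpow.
have mpE (f : T -> R) : measurable_fun setT f -> measurable_fun setT (fun x => (f x `^ p)%R%:E).
  by move=> mf; exact/measurable_EFinP/mpow.
have key i : \int[mu]_x (m i x `^ p)%R%:E <= q%:E * \int[mu]_x (D x * m i x `^ (p - 1))%R%:E.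
  elim: i => [|i IH].
    under eq_integral => x _ do rewrite -(mulr_powRB1 (m0 0%N x) p_gt0).
    rewrite (martingale (leqnn 0)) -[leLHS]mul1e; apply: lee_wpmul2r; last by rewrite lee_fin.
    by apply: integral_ge0 => x _; rewrite lee_fin mulr_ge0 ?powR_ge0.
  have step : \int[mu]_x (m i.+1 x `^ p)%R%:E + q%:E * \int[mu]_x (D x * m i x `^ (p - 1))%R%:E <=
      \int[mu]_x (m i x `^ p)%R%:E + q%:E * \int[mu]_x (D x * m i.+1 x `^ (p - 1))%R%:E.
    rewrite -(martingale (leqnSn i)) -(martingale (leqnn i.+1)).
    have ge0 j x : (0 <= s i.+1 x * m j x `^ (p - 1))%R by rewrite mulr_ge0 ?powR_ge0.
    rewrite -!ge0_integralZl//; try (by move=> x _; rewrite lee_fin ge0);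
      try exact: mp1.
    have ge0' j x : setT x -> 0 <= q%:E * (s i.+1 x * m j x `^ (p - 1))%R%:E.
      by move=> _; rewrite -EFinM lee_fin mulr_ge0.
    have mq j : measurable_fun setT (fun x => q%:E * (s i.+1 x * m j x `^ (p - 1))%R%:E).
      by apply: emeasurable_funM => //; exact: mp1.
    have pge0 j x : setT x -> 0 <= (m j x `^ p)%R%:E by move=> _; rewrite lee_fin powR_ge0.
    rewrite -!ge0_integralD//; try exact: mpE; try exact: ge0'; try exact: pge0; try exact: mq.
    apply: ge0_le_integral => //; try (by apply: emeasurable_funD; [exact: mpE|exact: mq]);
      try (by move=> x _; apply: adde_ge0; [exact: pge0|exact: ge0']).
    move=> x _; rewrite -!EFinM -!EFinD lee_fin.
    exact: powR_max_increment.
  have fin : q%:E * \int[mu]_x (D x * m i x `^ (p - 1))%R%:E \is a fin_num.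
    by rewrite fin_numM// I_fin.
  rewrite -(leeD2rE _ _ fin); apply: le_trans step _.
  by rewrite [leRHS]addeC; apply: leeD2r.
have Dp_ge0 : 0 <= \int[mu]_x (D x `^ p)%R%:E.
  by apply: integral_ge0 => x _; rewrite lee_fin powR_ge0.
have {}key := key N.
have mN_fin : \int[mu]_x (m N x `^ p)%R%:E \is a fin_num.
  have := I_fin (m N) N (p - 1)%R p1_ge0 (mm N) (m_bounds N).
  by under eq_integral => x _ do rewrite (mulr_powRB1 (m0 N x) p_gt0).
have split : q%:E * \int[mu]_x (D x * m N x `^ (p - 1))%R%:E <=
    2^-1%:E * \int[mu]_x (m N x `^ p)%R%:E + (q * (2 * q) `^ (p - 1))%R%:E * \int[mu]_x (D x `^ p)%R%:E.
  have K0 : (0 <= q * (2 * q) `^ (p - 1))%R by rewrite mulr_ge0 ?powR_ge0.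
  rewrite -!ge0_integralZl//; try (by move=> x _; rewrite lee_fin ?mulr_ge0 ?powR_ge0);
    try exact: mp1; try exact: mpE.
  rewrite -ge0_integralD//; try (by move=> x _; rewrite -EFinM lee_fin mulr_ge0 ?powR_ge0);
    try (by apply: emeasurable_funM => //; exact: mpE).
  apply: ge0_le_integral => //.
  - move=> x _; rewrite -EFinM lee_fin; apply: mulr_ge0 => //; apply: mulr_ge0 => //.
    exact: powR_ge0.
  - by apply: emeasurable_funM => //; exact: mp1.
  - by apply: emeasurable_funD; apply: emeasurable_funM => //; exact: mpE.
  move=> x _; rewrite -!EFinM -EFinD lee_fin mulrC [(2^-1 * _)%R]mulrC mulrC.
  exact: young_split.
(* With [u] and [v] the integrals of m_N^p and D^p and [u] finite, u <= u / 2 + q (2 q)^(p-1) v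
   gives u <= (2 q)^p v. *)
have := le_trans key split.
move: mN_fin Dp_ge0; case: (\int[mu]_x (m N x `^ p)%R%:E) => // u _.
case: (\int[mu]_x (D x `^ p)%R%:E) => [v| |]//; last first.
  by move=> _ _; rewrite gt0_muley ?leey// lte_fin powR_gt0// mulr_gt0// (lt_le_trans _ q_ge1).
rewrite -!EFinM -EFinD !lee_fin => v0 h.
have q2 : (0 <= 2 * q)%R by rewrite mulr_ge0.
rewrite -(mulr_powRB1 q2 p_gt0) -mulrA.
by rewrite -mulrA in h; lra.
Qed.

End DoobInequality.

(** * Maximal Doob tests *)

(** Tests have to be lower semi-computable on the whole space, while the constructions are effective
    on [KR] only. Off [D] the enumerated sets need not be nested in the rational; taking the
    supremum of the rationals listed at a point still defines a function effective from below. The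
    value 0 in the supremum keeps it nonnegative. *)
Lemma lsc_extension (R : realType) (Y : Type) (O : nat -> set Y) (D : set Y)
    (f : nat -> Y -> \bar R) : effective_base O ->
  (forall i y, D y -> 0 <= f i y) -> eff_lower O D f ->
  exists g, [/\ eff_lower O setT g, forall i y, 0 <= g i y &
    forall i y, D y -> g i y = f i y].
Proof.
move=> O_base f0 [e he ef].
pose P n y := exists k j, e (npair n k) = j.+1 /\ O j y.
have hP : eff_open O setT P by exists e.
pose S i y := [set t | t = 0 \/ exists2 q, P (npair q i) y & t = (qval R q)%:E].
pose g i y := ereal_sup (S i y).
have gE i y (t : \bar R) : t < g i y <-> t < 0 \/ exists2 q, t < (qval R q)%:E & P (npair q i) y.
  split=> [/ereal_sup_gt[_ [->|[q Pq ->]] tq]|[t0|[q tq Pq]]]; [by left|by right; exists q| |].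
  - by apply: lt_le_trans t0 _; apply: ereal_sup_ubound; left.
  - by apply: lt_le_trans tq _; apply: ereal_sup_ubound; right; exists q.
have g0 i y : 0 <= g i y by apply: ereal_sup_ubound; left.
exists g; split => //.
  apply: eff_open_ext (_ : eff_open O setT (fun n y => (qval R (nfst n) < 0)%R \/
    exists q, (qval R (nfst n) < qval R q)%R /\ P (npair q (nsnd n)) y)).
    move=> n y _; rewrite gE lte_fin.
    by split=> -[?|[q]]; [left|move=> [? ?]; right; exists q|left|right; exists q].
  have h0 : rational_seq (fun _ : nat => 0%R : R).
    by apply: eq_rational_seq (rational_seq_nat R (computable_const 0)).
  apply: eff_open_or => //; first by apply: eff_open_dec => //; comp.
  apply: eff_open_ex; apply: eff_open_and => //; first by apply: eff_open_dec => //; comp.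
  by apply: (eff_open_subst hP); comp.
move=> i y Dy.
have PE q : P (npair q i) y <-> (qval R q)%:E < f i y.
  by have := ef (npair q i) y Dy; rewrite !npairE => ->.
apply/eqP; rewrite eq_le; apply/andP; split.
  apply: ge_ereal_sup => _ [->|[q /PE qf ->]]; [exact: f0|exact: ltW].
rewrite leNgt; apply/negP => /qval_between[q /andP[gq /PE Pq]].
have : (qval R q)%:E <= g i y by apply: ereal_sup_ubound; right; exists q.
by rewrite leNgt gq.
Qed.

Lemma nneseries_tail (R : realType) (u : nat -> \bar R) s :
  \sum_(s <= i <oo) u i = \sum_(0 <= i <oo) (if (s <= i)%N then u i else 0).
Proof. by rewrite eseries_cond eseries_mkcondr. Qed.

(** The term [b i] occurs in the tails starting at 0, ..., i. The resulting weight [i.+1] is what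
    raises the degree of the polynomial weights by one in [series_test]. *)
Lemma nneseries_nneseries_tail (R : realType) (b : nat -> \bar R) : (forall i, 0 <= b i) ->
  \sum_(0 <= s <oo) \sum_(s <= i <oo) b i = \sum_(0 <= i <oo) i.+1%:R%:E * b i.
Proof.
move=> b0.
under eq_eseriesr => s _ do rewrite nneseries_tail.
rewrite (nneseries_interchange xpredT xpredT) /=; last by move=> i j; case: ifP.
apply: eq_eseriesr => i _.
rewrite (nneseries_split 0 i.+1) ?add0n; last by move=> k _; case: ifP.
rewrite [X in _ + X]eseries0 ?adde0; last by move=> k ik _; rewrite leqNgt ik.
rewrite (eq_big_nat _ _ (F2 := fun=> b i)); last by move=> k /andP[_ ki]; rewrite -ltnS ki.
by rewrite sumr_const_nat subn0 mule_natl.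
Qed.

Lemma re_enumeration (P : nat -> Prop) : re P ->
  exists2 u, computable u & forall z, P z <-> exists n, u n = z.+1.
Proof.
move=> [e he eP]; exists (fun n => if (0 < e n)%N then (nfst n).+1 else 0%N); first by comp.
move=> z; rewrite (eP z tt I); split=> [[k [j [ekj _]]]|[n]].
  by exists (npair z k); rewrite ekj npairE.
by case E : (e n) => [//|j] /= [<-]; exists (nsnd n), j; rewrite npairK.
Qed.

Lemma uniformly_computable_mdist (R : realType) (X : completeMetricType R) (a : nat -> X) :
  computable_polish a -> computable_seq (fun n => (mdist (a (nfst n)) (a (nsnd n)))%:E).
Proof. by move=> [_ /computable_seqP]. Qed.

Lemma eff_open_extension (Y : Type) (O : nat -> set Y) (D : set Y) P :
  eff_open O D P -> exists2 P', eff_open O setT P' & forall n y, D y -> (P' n y <-> P n y).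
Proof.
move=> [e he eP]; exists (fun n y => exists k j, e (npair n k) = j.+1 /\ O j y).
  by exists e.
by move=> n y Dy; rewrite eP.
Qed.

Lemma rational_seq_natconst (R : realType) n : rational_seq (fun _ : nat => n%:R : R)%R.
Proof. exact: (rational_seq_nat R (computable_const n)). Qed.

Lemma computable_eqb (b c : nat -> bool) : computable (fun n => b n : nat) ->
  computable (fun n => c n : nat) -> computable (fun n => b n == c n : nat).
Proof.
move=> hb hc; apply: eq_computable (computable_eqn hb hc) => n.
by case: (b n); case: (c n).
Qed.

Lemma measurable_bigmaxe (d : measure_display) (T : measurableType d) (R : realType)
    (f : nat -> T -> \bar R) n : (forall i, measurable_fun setT (f i)) ->
  measurable_fun setT (fun x => \big[Order.max/0]_(i < n) f i x).
Proof.
move=> mf; under eq_fun => x do rewrite -(big_mkord xpredT (f^~ x)).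
rewrite /index_iota; elim: (iota _ _) => [|i s IH].
  by under eq_fun do rewrite big_nil; exact: measurable_cst.
by under eq_fun do rewrite big_cons; exact: measurable_maxe.
Qed.

Lemma powR_superadd (R : realType) (p u v : R) : (1 <= p)%R -> (0 <= u)%R -> (0 <= v)%R ->
  (u `^ p + v `^ p <= (u + v) `^ p)%R.
Proof.
move=> p1 u0 v0; have p0 : (0 < p)%R by exact: lt_le_trans p1.
rewrite -(mulr_powRB1 u0 p0) -(mulr_powRB1 v0 p0) -(mulr_powRB1 (addr_ge0 u0 v0) p0) mulrDl.
by apply: lerD; apply: ler_wpM2l => //; apply: ge0_ler_powR;
  rewrite ?subr_ge0 ?nnegrE ?addr_ge0// ?lerDl ?lerDr.
Qed.

(** Integrated, this turns a gap between the integrals of x^p and y^p into a bound on the p-th power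
    of the norm of x - y. *)
Lemma poweR_superadd (R : realType) (p : R) (x y : \bar R) : (1 <= p)%R ->
  0 <= y -> y <= x -> y \is a fin_num -> (x - y) `^ p + y `^ p <= x `^ p.
Proof.
move=> p1; case: y => [y| |]//; rewrite lee_fin => y0; case: x => [x| |]//.
  rewrite lee_fin => yx _; rewrite -EFinB !poweR_EFin -EFinD lee_fin.
  by have := @powR_superadd R p (x - y) y p1; rewrite subr_ge0 yx subrK; exact.
by move=> _ _; rewrite [leRHS]poweRyr ?leey// gt_eqF// (lt_le_trans _ p1).
Qed.

Section MaximalDoobTests.
Variables (R : realType) (X : completeMetricType R) (a : nat -> X).
Variables (nu : probability (borel X) R) (p : R).
Hypotheses (X_polish : computable_polish a) (nu_computable : computable_measure a nu)
  (p_computable : computable_real p) (p_gt1 : (1 < p)%R).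

Local Notation KR := (KR a nu).
Local Notation ballX := (basic_ball a).
Local Notation N f := ('N[nu]_(p%:E)[f]).

Let p_gt0 : (0 < p)%R. Proof. exact: lt_trans p_gt1. Qed.
Let p_ge1 : (1 <= p)%R. Proof. exact: ltW. Qed.
Let p_neq0 : p != 0%R. Proof. by rewrite gt_eqF. Qed.
Let O_base : effective_base ballX. Proof. exact: basic_ball_effective. Qed.

Lemma ae_KR (P : X -> Prop) : (forall x, KR x -> P x) -> {ae nu, forall x, P x}.
Proof. by move=> h; apply: negligibleS (KR_ae a nu) => x; apply: contra_not; exact: h. Qed.

Lemma eff_lower_integral_nu (f : nat -> X -> \bar R) : (forall i x, 0 <= f i x) ->
  eff_lower ballX setT f ->
  eff_lower trivial_base setT (fun i _ => \int[nu]_x f i x).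
Proof.
move=> f0 hf.
have h P : eff_open ballX setT P -> eff_lower trivial_base setT (fun i _ => nu (P (nsnd i))).
  move=> hP; apply: (eff_lower_subst (x := fun i _ => nu (P i))).
    exact: (eff_lower_nu nu_computable hP).
  by comp.
have := eff_lower_integral (mu := fun _ _ => nu) trivial_base_effective h f0 hf.
move=> /(eff_lower_subst (h := fun i => npair 0 i))/(_ _)/eff_lower_ext; apply; last by comp.
by move=> i z _; rewrite !npairE.
Qed.

Lemma eff_lower_integral_nu_KR (f : nat -> X -> \bar R) :
  (forall i, measurable_fun setT (f i : borel X -> \bar R)) -> (forall i x, 0 <= f i x) ->
  eff_lower ballX KR f ->
  eff_lower trivial_base setT (fun i _ => \int[nu]_x f i x).
Proof.
move=> mf f0 hf; have [g [hg g0 gE]] := lsc_extension O_base (fun i y _ => f0 i y) hf.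
apply: eff_lower_ext (eff_lower_integral_nu g0 hg) => i _ _.
apply: ge0_ae_eq_integral => //; first exact: measurable_eff_lower hg.
by apply: ae_KR => x Kx _; rewrite gE.
Qed.

(** * Computability of the norms of bounded functions *)

Section SchnorrTests.
Variable f : nat -> X -> \bar R.
Hypotheses (mf : forall i, measurable_fun setT (f i : borel X -> \bar R))
  (f_ge0 : forall i x, 0 <= f i x)
  (f_lower : eff_lower ballX KR f) (f_upper : eff_upper ballX KR f).
Variable c : nat -> nat.
Hypotheses (c_computable : computable c) (f_le : forall i x, KR x -> f i x <= (c i)%:R%:E).

Let mfp i : measurable_fun setT (fun x : borel X => f i x `^ p).
Proof. exact: (measurable_poweR_comp p (mf i)). Qed.

Lemma integral_powR_fin i : \int[nu]_x f i x `^ p \is a fin_num.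
Proof.
rewrite ge0_fin_numE; last by apply: integral_ge0 => x _; exact: poweR_ge0.
apply: (@le_lt_trans _ _ (\int[nu]_x ((c i)%:R `^ p)%R%:E)); last by rewrite integral_probability_cst ltry.
apply: ae_ge0_le_integral => //; first by move=> x _; exact: poweR_ge0.
apply: ae_KR => x Kx _; rewrite -poweR_EFin; apply: lee_poweR => //; [exact: ltW|exact: f_le].
Qed.

(** Lower semi-computability of f^p gives the lower cuts. For the upper cuts a computable bound [C]
    of f^p is used: [C - f^p] is effective from below on [KR], hence so is its integral, which is
    [C] minus the one sought. *)
Lemma computable_integral_powR : computable_seq (fun i => \int[nu]_x f i x `^ p).
Proof.
split.
  apply: eff_lower_integral_nu_KR => //.
  - by move=> i x; exact: poweR_ge0.
  - by apply: eff_lower_powR => // i x _; exact: f_ge0.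
(* [P] is an integer above [p], and [(c i).+1] is at least 1, so [C i] is an integer bound of
   f^p. *)
pose P := (Num.bound p).
pose C i : R := ((c i).+1 ^ P)%:R%R.
have pP : (p <= P%:R)%R by apply/ltW/archi_boundP/ltW.
have fC i x : KR x -> f i x `^ p <= (C i)%:E.
  move=> Kx; apply: (@le_trans _ _ ((c i).+1%:R%:E `^ p)).
    apply: lee_poweR => //; first exact: ltW.
    by apply: le_trans (f_le i Kx) _; rewrite lee_fin ler_nat.
  rewrite /= lee_fin /C natrX -powR_mulrn//; apply: ler_powR => //.
  by rewrite ler1n.
have f_fin i x : KR x -> f i x `^ p \is a fin_num.
  by move=> Kx; rewrite ge0_fin_numE ?poweR_ge0//; apply: le_lt_trans (fC i x Kx) _; rewrite ltry.
have hC : rational_seq C by apply: rational_seq_nat; comp.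
have hu : eff_upper ballX KR (fun i x => f i x `^ p).
  by apply: eff_upper_powR => // i x _; exact: f_ge0.
have hl := eff_lower_opp_add O_base hC _ hu.
(* Off [KR] the bound [C] may fail; the maximum with 0 keeps the integrand nonnegative everywhere
   and changes nothing on [KR]. *)
have {}hl : eff_lower ballX KR (fun i x => Order.max 0 ((C i)%:E - f i x `^ p)).
  apply: eff_lower_ext (hl _) => i x Kx.
    by rewrite max_r// sube_ge0 ?fC// f_fin.
  by rewrite -ltey; have := f_fin i x Kx; rewrite ge0_fin_numE ?poweR_ge0.
have mg i : measurable_fun setT (fun x : borel X => Order.max 0 ((C i)%:E - f i x `^ p)).
  by apply: measurable_maxe => //; apply: emeasurable_funB.
have g0 i (x : borel X) : 0 <= Order.max 0 ((C i)%:E - f i x `^ p).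
  by rewrite le_max lexx.
have := eff_upper_opp_add trivial_base_effective hC _ (eff_lower_integral_nu_KR mg g0 hl).
move=> H; apply: eff_upper_ext (H _).
- move=> i _ _.
  have fi := integral_powR_fin i.
  have CE : (C i)%:E = \int[nu]_x (f i x `^ p) + \int[nu]_x Order.max 0 ((C i)%:E - f i x `^ p).
    rewrite -ge0_integralD//; last by move=> x _; exact: poweR_ge0.
    transitivity (\int[nu]_x (C i)%:E); first by rewrite integral_probability_cst.
    apply: ge0_ae_eq_integral => //.
    + exact: emeasurable_funD.
    + by move=> x _; rewrite lee_fin.
    + by move=> x _; apply: adde_ge0; rewrite ?poweR_ge0// le_max lexx.
    apply: ae_KR => x Kx _; rewrite max_r; last by rewrite sube_ge0 ?fC// f_fin.
    by rewrite addeC subeK// f_fin.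
  have : (C i)%:E \is a fin_num by [].
  by rewrite {1}CE fin_numD => /andP[_ Jfin]; rewrite [X in X - _]CE addeK.
- move=> i _ _; rewrite -ltNye; apply: lt_le_trans (integral_ge0 _ _) => //.
Qed.
Lemma computable_Lnorm : exists2 r, uniformly_computable_reals r &
  forall i, N (f i) = (r i)%:E.
Proof.
have Nfin i : N (f i) \is a fin_num.
  by rewrite ge0_LnormE ?(ltW p_gt1)//; apply: fin_num_poweR; exact: integral_powR_fin.
exists (fun i => fine (N (f i))); last by move=> i; rewrite fineK.
apply/computable_seqP; have [hl hu] := computable_integral_powR.
have I0 i (z : unit) : setT z -> 0 <= \int[nu]_x f i x `^ p.
  by move=> _; apply: integral_ge0 => x _; exact: poweR_ge0.
split.
  have := eff_lower_root p_computable p_gt0 trivial_base_effective I0 hl.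
  by apply: eff_lower_ext => i _ _; rewrite fineK// ge0_LnormE ?(ltW p_gt1).
have := eff_upper_root p_computable p_gt0 trivial_base_effective I0 hu.
by apply: eff_upper_ext => i _ _; rewrite fineK// ge0_LnormE ?(ltW p_gt1).
Qed.

End SchnorrTests.

(** * Rapidly converging sums of bounded functions *)

Section SeriesTests.
Variables (M : nat -> X -> \bar R) (c : nat -> nat).
Hypotheses (M_lower : eff_lower ballX setT M) (M_upper : eff_upper ballX KR M)
  (M_ge0 : forall i x, 0 <= M i x)
  (c_computable : computable c) (M_le : forall i x, KR x -> M i x <= (c i)%:R%:E)
  (M_sum : forall k, \sum_(0 <= s <oo) N (M s) * ((s.+1 ^ k)%N%:R)%:E < +oo).

Let mM i : measurable_fun setT (M i : borel X -> \bar R).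
Proof. exact: measurable_eff_lower M_lower. Qed.

(** One family of block sums serves both as the approximating tests and as their differences, with a
    single computation of the norms. *)
Let S (n : nat) (x : X) : \bar R := \sum_(j < nsnd n - nfst n) M (nfst n + j)%N x.

Let SE s t x : S (npair s t) x = \sum_(s <= j < t) M j x.
Proof.
rewrite /S !npairE -[s in RHS]add0n big_addn big_mkord.
by apply: eq_bigr => j _; rewrite addnC.
Qed.

Let S_ge0 n x : 0 <= S n x. Proof. by apply: sume_ge0. Qed.

Let M_fin i x : KR x -> M i x \is a fin_num.
Proof. by move=> Kx; rewrite ge0_fin_numE//; apply: le_lt_trans (M_le i Kx) _; rewrite ltry. Qed.

Let S_lower : eff_lower ballX setT S.
Proof.
apply: (eff_lower_sum O_base (x := fun n j => M (nfst n + j)%N)); [|apply: eff_lower_subst => //; comp|comp].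
by move=> i m z _; rewrite -ltNye; apply: lt_le_trans (M_ge0 _ _).
Qed.

Let S_upper : eff_upper ballX KR S.
Proof.
apply: (eff_upper_sum O_base (x := fun n j => M (nfst n + j)%N)); [|apply: eff_upper_subst => //; comp|comp].
by move=> i m z Kz; exact: M_fin.
Qed.

Let C n := (\sum_(j < nsnd n - nfst n) c (nfst n + j))%N.

Let C_computable : computable C.
Proof.
apply: (computable_sum (g := fun n j => c (nfst n + j)%N)); last by comp.
by apply: (computable_comp c_computable); comp.
Qed.

Let S_le n x : KR x -> S n x <= (C n)%:R%:E.
Proof.
move=> Kx; rewrite /C natr_sum -sumEFin; apply: lee_sum => i _; exact: M_le.
Qed.

Let S_schnorr h : computable h -> uniform_schnorr_tests a nu p (fun i => S (h i)).
Proof.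
move=> hh; split=> [|s x|]; first exact/uniformly_lscP/(eff_lower_subst S_lower hh).
  exact: S_ge0.
apply: (@computable_Lnorm (fun i => S (h i)) _ _ _ _ (fun i => C (h i))) => //.
- by move=> i; exact: (measurable_eff_lower (h i) S_lower).
- by apply: eff_open_sub (eff_lower_subst S_lower hh).
- exact: (eff_upper_subst S_upper hh).
- exact: (computable_comp C_computable hh).
- by move=> i x; exact: S_le.
Qed.

Let T (x : X) : \bar R := \sum_(0 <= s <oo) M s x.
Let H (s : nat) (x : X) : \bar R := \sum_(s <= j <oo) M j x.

Let H_sup s x : H s x = ereal_sup (range (fun t => S (npair s t) x)).
Proof.
apply/cvg_lim => //.
under eq_cvg do rewrite -SE.
apply: ereal_nondecreasing_cvgn => t t' tt'; rewrite !SE.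
exact: ereal_nondecreasing_series.
Qed.

Let H_lower : eff_lower ballX setT H.
Proof.
apply: eff_lower_ext (eff_lower_sup (x := fun s t => S (npair s t)) _).
  by move=> i z _; rewrite H_sup.
by apply: (eff_lower_subst S_lower); comp.
Qed.

Let T_split s x : T x = S (npair 0 s) x + H s x.
Proof. by rewrite /T (nneseries_split 0 s)// add0n SE. Qed.

Let T_difference s : difference_is a nu T (S (npair 0 s)) (H s).
Proof.
move=> x Kx Sfin; rewrite (T_split s) addeAC subee ?add0e//.
by rewrite ge0_fin_numE.
Qed.

Let N_H s : N (T \- S (npair 0 s)) <= \sum_(s <= j <oo) N (M j).
Proof.
have mH s' : measurable_fun setT (H s' : borel X -> \bar R).
  exact: measurable_eff_lower H_lower.
have mS n : measurable_fun setT (S n : borel X -> \bar R).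
  exact: measurable_eff_lower S_lower.
rewrite (@ae_eq_Lnorm _ (borel X) _ nu p (ltW p_gt1) _ (H s))//; last 2 first.
- by apply: emeasurable_funB => //; exact: (mH 0%N).
- apply: ae_KR => x Kx; apply: T_difference; first exact: Kx.
  by apply: le_lt_trans (S_le _ Kx) _; rewrite ltry.
have -> : H s = fun x => \sum_(0 <= j <oo) (if (s <= j)%N then M j x else 0).
  by apply/funext => x; rewrite /H nneseries_tail.
apply: (le_trans (@ge0_Lnorm_nneseries _ (borel X) _ nu p (ltW p_gt1)
  (fun j x => if (s <= j)%N then M j x else 0) _ _)).
- by move=> i; case: (s <= i)%N.
- by move=> i x; case: ifP.
rewrite [leRHS]nneseries_tail.
apply: lee_nneseries => [i _ _|i _]; first exact: Lnorm_ge0.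
case: (s <= i)%N => //; rewrite -[X in 'N[_]__[X]]/(cst 0) Lnorm0//.
Qed.

(** The approximations are the partial sums, so differences are blocks and remainders are tails, all
    effective from below. In the last clause the norm of a remainder is at most the sum of the later
    norms; interchanging the two sums costs a factor [j.+1], so weights of degree [k] are controlled
    by [M_sum] at [k.+1]. *)
Lemma series_test : maximal_doob_test a nu p T.
Proof.
split.
- apply/lscP; exact: (eff_lower_subst H_lower (computable_const 0)).
- by move=> x; apply: nneseries_ge0.
- apply: le_lt_trans (ge0_Lnorm_nneseries _ (ltW p_gt1) mM M_ge0) _.
  apply: le_lt_trans (M_sum 0); apply: lee_nneseries => [i _ _|i _]; first exact: Lnorm_ge0.
  by rewrite expn0 mule1.
exists (fun s => S (npair 0 s)); split.
- by apply: S_schnorr; comp.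
- move=> x Kx; split => [s|].
    by rewrite S_ge0 !SE; apply: ereal_nondecreasing_series.
  exact: H_sup 0%N x.
- move=> s; exists (H s); split => //.
    apply/lscP; exact: (eff_lower_subst H_lower (computable_const s)).
  by move=> x; apply: nneseries_ge0.
- exists (fun s t => S (npair s t)).
    by apply: S_schnorr; comp.
  move=> s t st x Kx Sfin; rewrite !SE (@big_cat_nat _ _ _ s 0%N t)//=; last exact: ltnW.
  rewrite addeAC subee ?add0e//; rewrite -SE ge0_fin_numE//.
- move=> k; apply: le_lt_trans (M_sum k.+1).
  apply: (@le_trans _ _ (\sum_(0 <= s <oo) \sum_(s <= j <oo) N (M j) * ((j.+1 ^ k)%N%:R)%:E)).
    apply: lee_nneseries => [i _ _|s _].
      by apply: mule_ge0; rewrite ?Lnorm_ge0 ?lee_fin.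
    apply: (@le_trans _ _ ((\sum_(s <= j <oo) N (M j)) * ((s.+1 ^ k)%N%:R)%:E)).
      by apply: lee_wpmul2r; rewrite ?lee_fin ?N_H.
    rewrite muleC -nneseriesZl//; last by move=> i _; exact: Lnorm_ge0.
    rewrite [leLHS]nneseries_tail [leRHS]nneseries_tail.
    apply: lee_nneseries => [i _ _|j _]; case: ifP => // sj.
      by apply: mule_ge0; rewrite ?Lnorm_ge0 ?lee_fin.
    rewrite muleC; apply: lee_wpmul2l; first exact: Lnorm_ge0.
    by rewrite lee_fin !natrX lerXn2r ?nnegrE// ler_nat.
  rewrite nneseries_nneseries_tail; last by move=> i; apply: mule_ge0; rewrite ?Lnorm_ge0 ?lee_fin.
  apply: lee_nneseries => [i _ _|j _].
    by rewrite !mule_ge0 ?Lnorm_ge0 ?lee_fin.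
  by rewrite muleCA -EFinM -natrM expnS.
Qed.

End SeriesTests.

Lemma KR_measure_eq (A B : set (borel X)) : measurable A -> measurable B ->
  (forall x, KR x -> (A x <-> B x)) -> nu A = nu B.
Proof.
move=> mA mB AB; rewrite -(setIT A) -(setIT B) -!integral_indic//.
apply: ge0_ae_eq_integral => //; try by apply/measurable_EFinP; exact: measurable_indic.
apply: ae_KR => x Kx _; rewrite !indicE.
suff -> : (x \in A) = (x \in B) by [].
by apply/idP/idP => /set_mem /(AB x Kx) /mem_set.
Qed.

(** * The basis on Kurtz random points *)

Variable B : nat -> set X.
Hypothesis B_basis : computable_basis a nu B.

(** The union of [B j] with the complement of [C j] is c.e. open of measure 1, so it contains every
    Kurtz random point. On [KR] the set [C j] thus coincides with [B j], and the complement of [B j]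
    becomes effectively open. *)
Lemma basis_decided : exists2 C : nat -> set X, eff_open ballX setT (fun j x => ~ C j x) &
  (forall j, B j `<=` C j) /\ (forall j x, KR x -> (~ C j x <-> ~ B j x)).
Proof.
have [/uniformly_ce_openP hB _ _ [C /uniformly_ce_openP hC BC]] := B_basis.
exists C; first exact: hC.
split=> [j|j x Kx]; first by have [] := BC j.
split=> [Cx /(BC j).1//|Bx].
have hBC := eff_open_or hB hC.
have mB := measurable_eff_open j hB; have mC := measurable_eff_open j hC.
case: (Kx _ (ce_open_eff_open j hBC)) => //.
have [BCj nuBC] := BC j.
have mCj : measurable (C j : set (borel X)) by rewrite -[C j]setCK; exact: measurableC.
have E : (fun x => B j x \/ (~` C j) x) = ~` (C j `\` B j).
  by rewrite setDE setCI setCK setUC.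
rewrite E; have mD : measurable (C j `\` B j : set (borel X)) by exact: measurableD.
have D0 : nu (C j `\` B j) = nu (C j) - nu (C j `&` B j).
  by apply: measureD => //; rewrite ltey_eq fin_num_measure.
have CB : C j `&` B j = B j by apply/setIidPr.
rewrite CB nuBC subee in D0; last exact: fin_num_measure.
have /= -> := probability_setC nu mD.
by rewrite [X in 1 - X](_ : _ = 0) ?sube0.
Qed.

Lemma eff_open_basisC : eff_open ballX KR (fun j x => ~ B j x).
Proof.
have [C hC [_ CB]] := basis_decided.
by apply: eff_open_ext (eff_open_sub _ hC) => // j x Kx; exact: CB.
Qed.

(** The exterior of a closed ball is the union of the basic balls whose centres lie farther away
    than the sum of the radii, a condition enumerable from the computable distances. *)
Lemma eff_open_far (l : nat -> nat) : computable l ->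
  eff_open ballX setT (fun n x => (posqval R (nsnd (l n)) < mdist (a (nfst (l n))) x)%R).
Proof.
move=> hl; have [hlo _] := uniformly_computable_mdist X_polish.
apply: eff_open_ext (_ : eff_open ballX setT (fun n x => exists j,
  (posqval R (nsnd (l n)) + posqval R (nsnd j))%R%:E <
    (mdist (a (nfst (npair (nfst (l n)) (nfst j)))) (a (nsnd (npair (nfst (l n)) (nfst j)))))%:E /\
  ballX j x)).
  move=> n x _; split=> [[j []]|h].
    rewrite lte_fin !npairE basic_ballE => h1 h2.
    have h3 := metric_triangle (a (nfst (l n))) x (a (nfst j)).
    have h4 := metric_sym x (a (nfst j)); by lra.
  pose e := (mdist (a (nfst (l n))) x - posqval R (nsnd (l n)))%R.
  have [|k hk] := @posqval_lt R (e / 4); first by rewrite divr_gt0// subr_gt0.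
  have [i hi] := dense_near x X_polish.1 (posqval_gt0 R k).
  exists (npair i k); rewrite lte_fin basic_ballE !npairE; split.
    have h3 := metric_triangle (a (nfst (l n))) (a i) x.
    have h4 := metric_sym x (a i); rewrite /e in hk *; by lra.
  by rewrite metric_sym.
have hr : rational_seq (fun n => posqval R (nsnd (l (nfst n))) + posqval R (nsnd (nsnd n)))%R.
  have hl' := computable_comp hl (computable_fst computable_id).
  by comp.
apply: eff_open_ex; apply: eff_open_and => //; last by apply: eff_open_base; comp.
apply: eff_open_re => //; apply: (eff_lowerP hlo hr).
by have hl' := computable_comp hl (computable_fst computable_id); comp.
Qed.

(* On Kurtz random points the sets [W k] shrink to the complement of [U].
   They cover this complement everywhere because the basic sets [B m] that are
   used come with closed supersets contained in [U]: the intersection of [C m]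
   with a closed ball formally included in [U]. *)
Lemma null_complement_cover (U : set X) : ce_open a U -> nu U = 1 ->
  exists W : nat -> set X, [/\ eff_open ballX setT W,
    eff_open ballX KR (fun k x => ~ W k x),
    forall k, ~` U `<=` W k & nu (W k) @[k --> \oo] --> 0].
Proof.
move=> [e0 he0 UE] nuU.
have [C hC [BC CB]] := basis_decided.
have [hB hbase _ _] := B_basis.
have hball : computable (fun n => (nfst n).+1) by comp.
have [g hg gball] := effectively_uniform hbase hball computable_id.
have {}gball l x : ballX l x <-> exists m k, g (npair l k) = m.+1 /\ B m x.
  have := gball l => /(congr1 (fun S : set X => S x)) /= E.
  have -> : ballX l x = open_of a (fun k => (nfst (npair l k)).+1) x.
    apply/propext; rewrite open_ofE; split; first by move=> h; exists 0%N, l; rewrite npairE.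
    by move=> [k [j []]]; rewrite npairE => -[->].
  rewrite E; split=> [[m [k gk] Bm]|[m [k [gk Bm]]]]; first by exists m, k.
  by exists m => //; exists k.
have [_ hup] := uniformly_computable_mdist X_polish.
pose incl l j := (mdist (a (nfst l)) (a (nfst j)) < posqval R (nsnd j) - posqval R (nsnd l))%R.
have hincl (l j : nat -> nat) : computable l -> computable j -> re (fun n => incl (l n) (j n)).
  move=> hl hj; have hr : rational_seq (fun n => posqval R (nsnd (j n)) - posqval R (nsnd (l n)))%R by comp.
  apply: eff_open_ext (eff_upperP hup hr (h := fun n => npair (nfst (l n)) (nfst (j n))) _); last by comp.
  by move=> n z _; rewrite lte_fin !npairE.
(* [z] pairs a ball [l], formally included in a ball enumerated for [U], with an index [m] such that
   [B m] is listed as a part of [l]. *)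
pose E z := exists k j, (e0 k == j.+1) /\ incl (nfst z) j /\
  exists k', g (npair (nfst z) k') == (nsnd z).+1.
have hE : re E.
  rewrite /re /E; apply: eff_open_ex; apply: eff_open_ex.
  apply: (eff_open_and trivial_base_effective).
    apply: (eff_open_dec _ trivial_base_effective).
    have h := computable_comp he0 (computable_snd (computable_fst computable_id)).
    by comp.
  apply: (eff_open_and trivial_base_effective).
    by apply: hincl; comp.
  apply: eff_open_ex; apply: (eff_open_dec _ trivial_base_effective).
  have h : computable (fun n => g (npair (nfst (nfst (nfst (nfst n)))) (nsnd n))).
    by apply: (computable_comp hg); comp.
  by comp.
have [u hu uE] := re_enumeration hE.
(* The complement of [C m] intersected with the closed ball [l]: an open set everywhere, which on
   [KR] is the complement of [B m] because [B m] lies in the ball. The set [W k] intersects the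
   first [k] of these; a stage with [u i = 0] imposes nothing. *)
pose NC z x := ~ C (nsnd z) x \/ (posqval R (nsnd (nfst z)) < mdist (a (nfst (nfst z))) x)%R.
have hNC : eff_open ballX setT NC.
  apply: eff_open_or => //; first by apply: (eff_open_subst hC); comp.
  by apply: eff_open_far; comp.
pose W k x := forall i, (i < k)%N -> u i == 0%N \/ NC (u i).-1 x.
have hW : eff_open ballX setT W.
  apply: eff_open_all => //; last by comp.
  have hu' := computable_comp hu (computable_snd computable_id).
  apply: eff_open_or => //; first by apply: eff_open_dec => //; comp.
  by apply: (eff_open_subst hNC); comp.
have EB z x : E z -> KR x -> NC z x <-> ~ B (nsnd z) x.
  move=> [k [j [_ [_ [k' /eqP gk]]]]] Kx; split; last by move=> nB; left; apply/CB.
  case=> [nC /BC//|far Bx].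
  have : ballX (nfst z) x by apply/gball; exists (nsnd z), k'.
  by rewrite basic_ballE; apply/negP; rewrite -leNgt ltW.
have NW k x : KR x -> ~ W k x <-> exists i, (i < k)%N /\ (u i != 0%N /\ B (nsnd (u i).-1) x).
  move=> Kx; split.
    move=> /existsNP[i /not_implyP[ik /not_orP[/negP ui nNC]]].
    exists i; split => //; split => //; apply: contrapT => nB; apply: nNC.
    by apply/EB => //; apply/uE; exists i; rewrite prednK// lt0n.
  move=> [i [ik [ui Bx]]] /(_ i ik); case=> [/eqP ui0|]; first by rewrite ui0 in ui.
  move/EB => h; apply: h => //.
  by apply/uE; exists i; rewrite prednK// lt0n.
exists W; split => //.
- apply: eff_open_ext (_ : eff_open ballX KR (fun k x =>
    exists i, (i < k)%N /\ (u i != 0%N /\ B (nsnd (u i).-1) x))).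
    by move=> k x Kx; exact: iff_sym (NW k x Kx).
  have hu' := computable_comp hu (computable_snd computable_id).
  apply: eff_open_ex; apply: eff_open_and => //; first by apply: eff_open_dec => //; comp.
  apply: eff_open_and => //; first by apply: eff_open_dec => //; comp.
  have /uniformly_ce_openP hB' := hB.
  by apply: (eff_open_subst (eff_open_sub _ hB')) => //; comp.
- move=> k x nUx i ik; case: eqP => [_|ui]; [by left|right].
  have : E (u i).-1 by apply/uE; exists i; rewrite prednK// lt0n; exact/eqP.
  move=> [m [j [/eqP em [inc _]]]]; apply: contrapT => /not_orP[_ /negP].
  rewrite -leNgt => near; apply: nUx; rewrite UE; apply/open_ofE; exists m, j; split => //.
  rewrite basic_ballE; rewrite /incl in inc.
  have h3 := metric_triangle (a (nfst j)) (a (nfst (nfst (u i).-1))) x.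
  have h4 := metric_sym (a (nfst j)) (a (nfst (nfst (u i).-1))).
  by lra.
- have mW k : measurable (W k : set (borel X)) by exact: measurable_eff_open hW.
  have -> : 0 = nu (\bigcap_k W k : set (borel X)).
    apply/esym; have mcap : measurable (\bigcap_k W k : set (borel X)) by exact: bigcapT_measurable.
    apply/negligibleP => //; apply: negligibleS (KR_ae a nu) => x /= Wx Kx.
    have : U x by apply: Kx => //; exists e0.
    rewrite UE => /open_ofE[k [j [ekj jx]]].
    have [l [lx inc]] : exists l, ballX l x /\ incl l j.
      rewrite basic_ballE in jx.
      have [|r hr] := @posqval_lt R ((posqval R (nsnd j) - mdist (a (nfst j)) x) / 4)%R.
        by rewrite divr_gt0// subr_gt0.
      have [i hi] := dense_near x X_polish.1 (posqval_gt0 R r).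
      exists (npair i r); rewrite basic_ballE /incl !npairE; split; first by rewrite metric_sym.
      have h3 := metric_triangle (a i) x (a (nfst j)).
      have h4 := metric_sym x (a i); have h5 := metric_sym x (a (nfst j)).
      by lra.
    have [m [k' [gk Bm]]] := (gball l x).1 lx.
    have : E (npair l m).
      by exists k, j; rewrite ekj !npairE; split => //; split => //; exists k'; rewrite gk.
    move=> /uE[i ui]; apply: (NW i.+1 x Kx).2 (Wx i.+1 I).
    by exists i; rewrite ui /= npairE.
  apply: nonincreasing_cvg_mu => //.
  + by rewrite ltey_eq fin_num_measure.
  + exact: bigcapT_measurable.
  + by move=> n m nm; apply/subsetPset => x Wx i im; apply: Wx; exact: leq_trans nm.
Qed.

(** For rational [c] the left side is a rational tolerance below c^p, which a search can compare
    exactly. *)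
Lemma powR_bound (c : R) : (0 < c <= 1)%R -> (c ^+ Num.bound p <= c `^ p)%R.
Proof.
move=> /andP[c0 c1]; rewrite -(powR_mulrn _ (ltW c0)); apply: ger_powR; first by rewrite c0.
by apply/ltW/archi_boundP/ltW/(lt_trans _ p_gt1).
Qed.

Lemma rational_seq_tolerance (s : nat -> nat) : computable s ->
  rational_seq (fun n => ((4^-1 : R) ^+ s n) ^+ Num.bound p)%R.
Proof.
move=> hs; apply: rational_seq_exp; last by comp.
apply: rational_seq_exp => //; apply: eq_rational_seq (rational_seq_invnat R (computable_const 3)).
by [].
Qed.

Lemma quarter_itv s : (0 < (4^-1 : R) ^+ s <= 1)%R.
Proof. by rewrite exprn_gt0//= exprn_ile1// invf_le1// ler1n. Qed.

Lemma MDR_KR x : MDR a nu p x -> KR x.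
Proof.
move=> MDRx U ceU nuU; apply: contrapT => Ux.
have [W [hW hNW UW nuW]] := null_complement_cover ceU nuU.
have mW k : measurable (W k : set (borel X)) by exact: measurable_eff_open hW.
have [V hV VE] := eff_open_extension hNW.
have mV k : measurable (V k : set (borel X)) by exact: measurable_eff_open hV.
have nuV k : nu (V k) = 1 - nu (W k).
  transitivity (nu (~` W k)); last exact: probability_setC.
  apply: (KR_measure_eq) => //; first exact: measurableC.
  by move=> y Ky; exact: VE.
(* [W k] being open, smallness of its measure is not directly enumerable. Its complement agrees on
   [KR] with the c.e. open set [V k], whose measure is effective from below. *)
have [||n hn nP] := @re_choice (fun s k =>
    (1 - ((4^-1 : R) ^+ s) ^+ Num.bound p)%R%:E < nu (V k)).
- have hr : rational_seq (fun n => 1 - ((4^-1 : R) ^+ nfst n) ^+ Num.bound p)%R.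
    apply: rational_seq_add; first exact: (rational_seq_natconst R 1).
    by apply: rational_seq_opp; apply: rational_seq_tolerance; comp.
  by apply: (eff_lowerP (eff_lower_nu nu_computable hV) hr); comp.
- move=> s; have q0 : (0 < ((4^-1 : R) ^+ s) ^+ Num.bound p)%R by rewrite !exprn_gt0.
  have q0' : 0 < (((4^-1 : R) ^+ s) ^+ Num.bound p)%R%:E by rewrite lte_fin.
  have [k _ /(_ k (leqnn k)) /= hk] := nuW _ (open_ereal_lt' q0').
  exists k; rewrite nuV; move: hk.
  have : nu (W k) \is a fin_num by exact: fin_num_measure.
  by case: (nu (W k)) => // w _; rewrite -EFinB !lte_fin; lra.
pose M s (y : X) : \bar R := (\1_(W (n s)) y)%:E.
have ME s y : M s y = if `[< W (n s) y >] then 1 else 0.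
  rewrite /M indicE; case: asboolP => h; first by rewrite mem_set.
  by rewrite memNset.
have M0 s y : 0 <= M s y by rewrite ME; case: ifP.
have T_test : maximal_doob_test a nu p (fun y => \sum_(0 <= s <oo) M s y).
  apply: (@series_test M (fun=> 1%N)) => //.
  - apply: eff_open_ext (_ : eff_open ballX setT (fun z y => (qval R (nfst z) < 0)%R \/
      (qval R (nfst z) < 1)%R /\ W (n (nsnd z)) y)).
      move=> z y _; rewrite ME; case: asboolP => h; rewrite lte_fin; split; try by auto.
      + by case=> [/lt_trans->|[]].
      + by case=> [|[]].
    apply: eff_open_or => //.
      by apply: eff_open_dec => //; apply: computable_ltr; [comp|exact: (rational_seq_natconst R 0)].
    apply: eff_open_and => //.
      by apply: eff_open_dec => //; apply: computable_ltr; [comp|exact: (rational_seq_natconst R 1)].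
    by apply: (eff_open_subst hW); apply: (computable_comp hn); comp.
  - apply: eff_open_ext (_ : eff_open ballX KR (fun z y => (1 < qval R (nfst z))%R \/
      (0 < qval R (nfst z))%R /\ ~ W (n (nsnd z)) y)).
      move=> z y _; rewrite ME; case: asboolP => h; rewrite lte_fin; split; try by auto.
      + by case=> [|[]].
      + by case=> [/(lt_trans _)->|[]].
    apply: eff_open_or => //.
      by apply: eff_open_dec => //; apply: computable_ltr; [exact: (rational_seq_natconst R 1)|comp].
    apply: eff_open_and => //.
      by apply: eff_open_dec => //; apply: computable_ltr; [exact: (rational_seq_natconst R 0)|comp].
    by apply: (eff_open_subst hNW); apply: (computable_comp hn); comp.
  - by comp.
  - by move=> s y _; rewrite ME; case: ifP; rewrite lee_fin.
  - move=> k; apply: le_lt_trans (quarter_polynomial_summable R k).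
    apply: lee_nneseries => [s _ _|s _]; first by apply: mule_ge0; rewrite ?Lnorm_ge0 ?lee_fin.
    apply: lee_wpmul2r; first by rewrite lee_fin.
    have q01 := quarter_itv s; have /andP[q0 q1] := q01.
    apply: Lnorm_le_of_integral; [exact: ltW|by []|exact: ltW|].
    apply: (@le_trans _ _ (((4^-1 : R) ^+ s) ^+ Num.bound p)%R%:E); last first.
      by rewrite lee_fin powR_bound.
    have -> : \int[nu]_y (M s y `^ p) = nu (W (n s)).
      rewrite -(setIT (W (n s))) -integral_indic//; apply: eq_integral => y _.
      have p0 : p != 0%R by rewrite gt_eqF// (lt_trans _ p_gt1).
      rewrite ME indicE; case: asboolP => h; first by rewrite poweR1r mem_set.
      by rewrite poweR0r// memNset.
    have := nP s; rewrite nuV.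
    have : nu (W (n s)) \is a fin_num by exact: fin_num_measure.
    by case: (nu (W (n s))) => // w _; rewrite -EFinB !lte_fin !lee_fin; lra.
have := MDRx _ T_test; apply/negP; rewrite -leNgt leye_eq; apply/eqP.
rewrite nneseries_sup//; apply/eqyP => r _.
have [n0 hn0] : exists n0 : nat, (r <= n0%:R)%R.
  exists (Num.bound `|r|%R); apply: le_trans (ler_norm r) _.
  exact/ltW/archi_boundP/normr_ge0.
apply: (@le_trans _ _ n0%:R%:E); first by rewrite lee_fin.
apply: (@le_trans _ _ (\sum_(0 <= s < n0) M s x)); last by apply: ereal_sup_ubound; exists n0.
rewrite (eq_bigr (fun=> 1)); first by rewrite sumr_const_nat subn0 -[leLHS]mule1 mule_natl.
by move=> s _; rewrite ME; case: asboolP => // h; case: h; exact: UW.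
Qed.

(** * Membership in sets of the generated algebra *)

Let hB : eff_open ballX KR B.
Proof.
by have [/uniformly_ce_openP h _ _ _] := B_basis; apply: eff_open_sub h.
Qed.

Lemma measurable_set_term t : measurable (set_term_val B t : set (borel X)).
Proof.
have [/uniformly_ce_openP h _ _ _] := B_basis.
elim: t => [j||u IHu|u IHu v IHv] /=.
- exact: measurable_eff_open h.
- exact: measurable0.
- exact: measurableC.
- exact: measurableU.
Qed.

(* [v] assigns to every code of a term the truth value at a given point of the
   set it denotes; at the codes of the atoms this is a condition on the point,
   at the others it determines [v] recursively. *)
Definition term_rule (v : nat -> bool) (c : nat) : bool :=
  if nfst c == 1%N then false
  else if nfst c == 2%N then ~~ v (nsnd c)
  else if nfst c == 3%N then v (nfst (nsnd c)) || v (nsnd (nsnd c))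
  else v c.

Definition truth_at (v : nat -> bool) (c : nat) (x : X) : Prop :=
  if nfst c == 0%N then v c /\ B (nsnd c) x \/ ~~ v c /\ ~ B (nsnd c) x
  else v c == term_rule v c.

(** The table is built by induction on the codes: a nonzero tag makes the argument code strictly
    smaller than the code itself ([ltn_npairr]), and the tag 0 belongs to the atoms, whose entries
    are read off the point. *)
Lemma truth_at_exists N x : exists v, forall c, (c < N)%N -> truth_at v c x.
Proof.
elim: N => [|N [v hv]]; first by exists (fun=> true).
pose b := if nfst N == 0%N then `[< B (nsnd N) x >] else term_rule v N.
pose v' c := if c == N then b else v c.
have v'E c : (c < N)%N -> v' c = v c by move=> cN; rewrite /v' ltn_eqF.
have lt c i : (c <= N)%N -> nfst c != 0%N -> (i <= nsnd c)%N -> (i < N)%N.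
  move=> cN c0 ic; apply: leq_trans cN; apply: leq_ltn_trans ic _.
  by rewrite -[ltnRHS](npairK c) ltn_npairr// lt0n.
have arg_fst c : (nfst c <= c)%N.
  by rewrite -[leqRHS](npairK c); apply: leq_trans (leq_npair _ _); exact: leq_addr.
have arg_snd c : (nsnd c <= c)%N.
  by rewrite -[leqRHS](npairK c); apply: leq_trans (leq_npair _ _); exact: leq_addl.
exists v' => c; rewrite ltnS => cN; rewrite /truth_at.
case: ifPn => c0.
  move: cN; rewrite leq_eqVlt => /orP[/eqP cN|cN].
    rewrite /v' cN eqxx /b; rewrite cN in c0; rewrite c0.
    by case: asboolP => h; [left|right].
  by have := hv c cN; rewrite /truth_at c0 v'E.
have e : v' c = term_rule v c.
  move: cN; rewrite leq_eqVlt => /orP[/eqP cN|cN].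
    by rewrite /v' cN eqxx /b; rewrite cN in c0; rewrite (negbTE c0).
  by have := hv c cN; rewrite /truth_at (negbTE c0) v'E// => /eqP.
rewrite {1}e /term_rule; case: ifP => // c1; case: ifP => c2.
  by rewrite v'E// (lt c).
case: ifP => c3; first by rewrite !v'E// (lt c).
(* The remaining tags code no term, and [term_rule] leaves the table free there. *)
by rewrite -[X in X == _]/(v c) -[v c]/(if false then true else v c); move: e; rewrite /term_rule c1 c2 c3 => ->.
Qed.

Lemma truth_at_val v x t :
  (forall c, (c < (set_term_index t).+1)%N -> truth_at v c x) ->
  v (set_term_index t) <-> set_term_val B t x.
Proof.
elim: t => [j||u IHu|u IHu w IHw] h /=.
- have := h _ (ltnSn _); rewrite /truth_at /= !npairE eqxx.
  by move=> [[]|[/negP]]; split.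
- by have := h _ (ltnSn _); rewrite /truth_at /term_rule /= ?npairE => /eqP ->.
- have hu c : (c < (set_term_index u).+1)%N -> truth_at v c x.
    by rewrite ltnS => cu; apply: h; rewrite ltnS /= (leq_trans cu)// ltnW// ltn_npairr.
  have := h _ (ltnSn _); rewrite /truth_at /term_rule /= ?npairE => /eqP ->.
  by rewrite -IHu//; split => /negP.
- have lu : (set_term_index u <= set_term_index (TUnion u w))%N.
    rewrite /=; apply: leq_trans (leq_npair _ _); apply: leq_trans (leq_addl _ _).
    by apply: leq_trans (leq_npair _ _); exact: leq_addr.
  have lw : (set_term_index w <= set_term_index (TUnion u w))%N.
    rewrite /=; apply: leq_trans (leq_npair _ _); apply: leq_trans (leq_addl _ _).
    by apply: leq_trans (leq_npair _ _); exact: leq_addl.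
  have := h _ (ltnSn _); rewrite {1}/truth_at /term_rule /= ?npairE => /eqP ->.
  rewrite -IHu; last by move=> c; rewrite ltnS => cu; apply: h; rewrite ltnS (leq_trans cu).
  rewrite -IHw; last by move=> c; rewrite ltnS => cu; apply: h; rewrite ltnS (leq_trans cu).
  by split=> /orP.
Qed.

(** Membership is witnessed by a finite truth table [s] up to the index of the term. Checking a
    table is a finite conjunction of decidable conditions and of statements about atoms, which are
    effectively open on [KR] with either truth value; so a set and its complement are obtained
    alike. *)
Lemma eff_open_set_term_bool (t : nat -> set_term) (b : bool) :
  computable (fun n => set_term_index (t n)) ->
  eff_open ballX KR (fun n x => if b then set_term_val B (t n) x else ~ set_term_val B (t n) x).
Proof.
move=> ht; pose v s c := nnth s c == 1%N.
have H : eff_open ballX KR (fun n x => exists s,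
    (forall c, (c < (set_term_index (t n)).+1)%N -> truth_at (v s) c x) /\
    v s (set_term_index (t n)) == b).
  apply: eff_open_ex; apply: eff_open_and => //.
    apply: eff_open_all => //; last first.
      by apply: (computable_comp (f := fun n => (set_term_index (t n)).+1)); comp.
    apply: (eff_open_if (b := fun n => nfst (nsnd n) == 0%N)); first by comp.
      apply: eff_open_or; apply: eff_open_and => //.
      - by apply: eff_open_dec => //; rewrite /v; comp.
      - by apply: (eff_open_subst hB); comp.
      - by apply: eff_open_dec => //; rewrite /v; comp.
      - by apply: (eff_open_subst (eff_open_basisC)); comp.
    apply: eff_open_dec => //; rewrite /term_rule.
    apply: computable_eqb; first by rewrite /v; comp.
    pose r z : nat := if nfst (nsnd z) == 1%N then 0%N
      else if nfst (nsnd z) == 2%N then ~~ v (nsnd (nfst z)) (nsnd (nsnd z)) : nat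
      else if nfst (nsnd z) == 3%N then
        v (nsnd (nfst z)) (nfst (nsnd (nsnd z))) || v (nsnd (nfst z)) (nsnd (nsnd (nsnd z))) : nat
      else v (nsnd (nfst z)) (nsnd z) : nat.
    apply: (@eq_computable r) => [z|]; first by rewrite /r; do !case: ifP.
    by rewrite /r /v; apply: computable_if; comp.
  apply: eff_open_dec => //; apply: computable_eqb; last by comp.
  apply: computable_eqn; last by comp.
  by apply: computable_nnth; [comp|apply: (computable_comp ht); comp].
apply: eff_open_ext H => n x _; split=> [[s [hs]]|hb].
  by have := truth_at_val hs; case: b; case: (v s _) => // -[h1 h2] _; [exact: h1|move=> /h2].
have [w hw] := truth_at_exists (set_term_index (t n)).+1 x.
have [s hs] := nnth_code (fun c => w c : nat) (set_term_index (t n)).+1.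
have vw c : (c < (set_term_index (t n)).+1)%N -> v s c = w c.
  by move=> ct; rewrite /v hs//; case: (w c).
exists s; split.
  move=> c ct; have := hw c ct; rewrite /truth_at /term_rule vw//.
  have lt i : (i <= c)%N -> v s i = w i by move=> ic; apply: vw; exact: leq_ltn_trans ct.
  have h1 : (nsnd c <= c)%N.
    by rewrite -[leqRHS](npairK c); apply: leq_trans (leq_npair _ _); exact: leq_addl.
  have h2 : (nfst (nsnd c) <= c)%N.
    apply: leq_trans h1; rewrite -[leqRHS](npairK (nsnd c)).
    by apply: leq_trans (leq_npair _ _); exact: leq_addr.
  have h3 : (nsnd (nsnd c) <= c)%N.
    apply: leq_trans h1; rewrite -[leqRHS](npairK (nsnd c)).
    by apply: leq_trans (leq_npair _ _); exact: leq_addl.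
  by rewrite !lt.
rewrite vw//; have := truth_at_val hw; case: b hb; case: (w _) => // hb [h1 h2].
  by have := h2 hb.
by exfalso; apply: hb; exact: h1.
Qed.

(** * Filtrations and disintegrations *)

Variables (F : nat -> set (set X)) (A : nat -> nat -> set X).
Hypotheses (F_mono : forall m n, (m <= n)%N -> F m `<=` F n)
  (F_gen : forall n, F n = <<s range (A n) >>)
  (A_alg : uniformly_in_algebra B A)
  (A_cover : effectively (fun _ e g =>
    open_of a e `&` KR =
    (\bigcup_(j in enumerated g) A (nfst j) (nsnd j)) `&` KR)).

Lemma measurable_A n m : measurable (A n m : set (borel X)).
Proof. by have [t _ ->] := A_alg; exact: (measurable_set_term). Qed.

Lemma eff_open_A (b : bool) :
  eff_open ballX KR (fun i x => if b then A (nfst i) (nsnd i) x else ~ A (nfst i) (nsnd i) x).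
Proof.
have [t ht tA] := A_alg.
apply: eff_open_ext (eff_open_set_term_bool b ht) => i x _.
by rewrite tA.
Qed.

Lemma F_A n m : F n (A n m).
Proof. by rewrite F_gen; apply: sub_sigma_algebra; exists m. Qed.

Lemma F_setT n : F n setT.
Proof.
have [F0 FC _] := smallest_sigma_algebra [set: X] (range (A n)).
by rewrite F_gen; have := FC _ F0; rewrite setD0.
Qed.

Lemma atom_A n m x y : atom (F n) x y -> (A n m x <-> A n m y).
Proof. by apply; exact: F_A. Qed.

Lemma atom_mono m n x : (m <= n)%N -> atom (F n) x `<=` atom (F m) x.
Proof. by move=> mn y xy S FS; apply: xy; exact: F_mono FS. Qed.

(** The sets that do not separate [x] from [y] form a sigma-algebra, so the generators suffice.
    Their countability makes the atom measurable. *)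
Lemma atomE n x : atom (F n) x = \bigcap_m [set y | A n m x <-> A n m y].
Proof.
apply/seteqP; split=> [y xy m _|y xy S]; first exact: atom_A.
rewrite F_gen; move: S; apply: smallest_sub => /=.
  split=> /=.
  - by [].
  - by move=> S hS; split=> -[_ h]; split=> // h'; apply: h; apply/hS.
  - by move=> S hS; split=> -[i _ Si]; exists i => //; apply/(hS i).
by move=> _ [m _ <-]; exact: xy.
Qed.

Lemma measurable_atom n x : measurable (atom (F n) x : set (borel X)).
Proof.
rewrite atomE; apply: bigcapT_measurable => m.
have [Ax|Ax] := pselect (A n m x).
  rewrite [X in measurable X](_ : _ = A n m); first exact: measurable_A.
  by apply/seteqP; split=> y /= => [[+ _]|Ay]; [apply|split].
rewrite [X in measurable X](_ : _ = ~` A n m); first by apply: measurableC; exact: measurable_A.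
by apply/seteqP; split=> y /= => [[_ h] /h|Ay]; [|split].
Qed.

Lemma ce_open_enumeration P : eff_open ballX setT P ->
  exists2 g, computable g & forall i x, KR x ->
    (P i x <-> exists k j, g (npair i k) = j.+1 /\ A (nfst j) (nsnd j) x).
Proof.
move=> /uniformly_ce_openP [e he eP].
have [g hg gA] := effectively_uniform A_cover he computable_id.
exists g => // i x Kx; rewrite eP.
have E := gA i.
split=> [ex|[k [j [gk Aj]]]].
  have : (open_of a (fun k => e (npair i k)) `&` KR) x by [].
  by rewrite E => -[[j [k gk] Aj] _]; exists k, j.
have : ((\bigcup_(j in enumerated (fun k => g (npair i k))) A (nfst j) (nsnd j)) `&` KR) x.
  by split => //; exists j => //; exists k.
by rewrite -E => -[].
Qed.

Variable rho : nat -> R.-ker (borel X) ~> (borel X).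
Hypothesis rho_dis : forall n, kurtz_disintegration a nu (F n) (rho n).

Lemma rho_setT n x : KR x -> rho n x setT = 1.
Proof. by have [_ _ h] := rho_dis n; move=> /h[]. Qed.

Lemma rho_ae n x (P : X -> Prop) : KR x ->
  (forall y, KR y -> atom (F n) x y -> P y) -> {ae rho n x, forall y, P y}.
Proof.
move=> Kx h; have [rfin _ /(_ x Kx)[r1 r2]] := rho_dis n.
have mAK : measurable (atom (F n) x `&` KR : set (borel X)).
  by apply: measurableI; [exact: measurable_atom|exact: measurable_KR].
exists (~` (atom (F n) x `&` KR)); split.
- exact: measurableC.
- have e : rho n x (setT `\` (atom (F n) x `&` KR)) =
      rho n x setT - rho n x (setT `&` (atom (F n) x `&` KR)).
    by apply: measureD => //; exact: rfin.
  by rewrite setTI r1 r2 subee// setTD in e.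
- by move=> y /= nP [xy Ky]; apply: nP; exact: h.
Qed.

Lemma integral_rho_cst n x (r : R) : KR x ->
  \int[rho n x]_(y in (setT : set (borel X))) r%:E = r%:E.
Proof. by move=> Kx; rewrite integral_cst// -[RHS]mule1; congr (_ * _); exact: rho_setT. Qed.

Lemma eq_integral_rho n x (f g : borel X -> \bar R) : KR x ->
  measurable_fun setT f -> measurable_fun setT g -> (forall y, 0 <= f y) -> (forall y, 0 <= g y) ->
  (forall y, KR y -> atom (F n) x y -> f y = g y) ->
  \int[rho n x]_y f y = \int[rho n x]_y g y.
Proof.
move=> Kx mf mg f0 g0 fg; apply: ge0_ae_eq_integral => //.
by apply: (rho_ae Kx) => y Ky xy _; exact: fg.
Qed.

Lemma lsc_liminf f x (q : R) : lsc a f -> (forall y, 0 <= f y) -> KR x ->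
  q%:E < f x -> exists N, forall n, (N <= n)%N -> q%:E <= \int[rho n x]_y f y.
Proof.
move=> /lscP hf f0 Kx /qval_between[q' /andP[qq' q'f]].
(* Integrals are compared below for nonnegative functions only, which requires a positive
   constant. *)
have [q'0|q'0] := leP (qval R q') 0%R.
  exists 0%N => n _; apply: (@le_trans _ _ 0); last exact: integral_ge0.
  by apply: le_trans (ltW qq') _; rewrite lee_fin.
have [g hg gA] := ce_open_enumeration hf.
have := gA (npair q' 0) x Kx; rewrite !npairE => -[/(_ q'f) [k [j [gk Aj]]] _].
(* [nfst j] is the level of a set [A] that contains [x] and on which, within [KR], [f] exceeds [q'].
   From this level on the whole atom of [x] lies in that set. *)
exists (nfst j) => n jn; rewrite -(integral_rho_cst n q Kx).
have mf : measurable_fun setT (f : borel X -> \bar R) by exact: (measurable_eff_lower 0%N hf).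
apply: (@le_trans _ _ (\int[rho n x]_(y in (setT : set (borel X))) (qval R q')%:E)).
  by rewrite !integral_rho_cst// ltW.
apply: ae_ge0_le_integral => //; first by move=> y _; rewrite lee_fin ltW.
apply: (rho_ae Kx) => y Ky xy _; apply/ltW.
have := gA (npair q' 0) y Ky; rewrite !npairE => -[_]; apply.
exists k, j; split => //.
by apply/(atom_A _ (atom_mono jn xy)).
Qed.

Lemma integral_rho_atom n x (f : borel X -> \bar R) : KR x -> measurable_fun setT f ->
  (forall y, 0 <= f y) -> (forall y, KR y -> atom (F n) x y -> f y = f x) ->
  \int[rho n x]_y f y = f x.
Proof.
move=> Kx mf f0 fx; transitivity (\int[rho n x]_y cst (f x) y).
  by apply: eq_integral_rho => // y; exact: f0.
by rewrite integral_cst// -[RHS]mule1; congr (_ * _); exact: rho_setT.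
Qed.

Lemma measurable_integral_rho n (f : borel X -> \bar R) : measurable_fun setT f ->
  (forall y, 0 <= f y) -> measurable_fun setT (fun x : borel X => \int[rho n x]_y f y).
Proof. by move=> mf f0; apply: measurable_fun_integral_kernel => // U mU; exact: measurable_kernel. Qed.

Lemma integral_integral_rho n (f : borel X -> \bar R) : nu.-integrable setT f ->
  \int[nu]_x \int[rho n x]_y f y = \int[nu]_x f x.
Proof.
move=> nuf; have [_ h _] := rho_dis n.
by have [_ _ /(_ setT (F_setT n))] := h f nuf.
Qed.

(** A version of the conditional expectation is measurable for [F n], so the preimage of the
    singleton of its value at [x] is a member of [F n] containing [x], hence [y]. *)
Lemma integral_rho_atom_eq n x y (f : borel X -> \bar R) : nu.-integrable setT f ->
  atom (F n) x y -> \int[rho n y]_z f z = \int[rho n x]_z f z.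
Proof.
move=> nuf xy; have [_ h _] := rho_dis n; have [hF _ _] := h f nuf.
have := xy _ (hF [set \int[rho n x]_z f z] (emeasurable_set1 _)).
by move=> /= [/(_ erefl)].
Qed.

Hypothesis rho_lsc : effectively (fun n e g => lsc_name a g (fun x => rho n x (open_of a e))).

Lemma eff_lower_integral_rho (f : nat -> X -> \bar R) :
  (forall i, measurable_fun setT (f i : borel X -> \bar R)) -> (forall i x, 0 <= f i x) ->
  eff_lower ballX KR f ->
  eff_lower ballX KR (fun i x => \int[rho (nfst i) x]_(y in (setT : set (borel X))) f (nsnd i) y).
Proof.
move=> mf f0 hf; have [g [hg g0 gE]] := lsc_extension O_base (fun i y _ => f0 i y) hf.
have h P : eff_open ballX setT P ->
    eff_lower ballX KR (fun i y => rho (nfst i) y (P (nsnd i))).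
  by move=> hP; apply: eff_open_sub (eff_lower_rho rho_lsc hP).
apply: eff_lower_ext (eff_lower_integral (mu := fun n x => rho n x) O_base h g0 hg) => i x Kx.
apply: eq_integral_rho => //; first exact: measurable_eff_lower hg.
by move=> y Ky _; exact: gE.
Qed.

(** Since the disintegration has mass 1 on [KR], the integral of [f] is [c] minus the integral of
    [c - f], and the latter is effective from below. *)
Lemma eff_upper_integral_rho (f : nat -> X -> \bar R) (c : nat -> nat) :
  (forall i, measurable_fun setT (f i : borel X -> \bar R)) -> (forall i x, 0 <= f i x) ->
  computable c -> (forall i x, f i x <= (c i)%:R%:E) ->
  eff_upper ballX KR f ->
  eff_upper ballX KR (fun i x => \int[rho (nfst i) x]_(y in (setT : set (borel X))) f (nsnd i) y).
Proof.
move=> mf f0 hc fc hf.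
have hcR : rational_seq (fun i => (c i)%:R : R)%R by exact: rational_seq_nat.
have f_fin i x : f i x \is a fin_num.
  by rewrite ge0_fin_numE//; apply: le_lt_trans (fc i x) _; rewrite ltry.
have hl : eff_lower ballX KR (fun i x => (c i)%:R%:E - f i x).
  apply: eff_lower_opp_add => // i z _.
  by have := f_fin i z; rewrite fin_numE => /andP[].
have mg i : measurable_fun setT (fun x : borel X => (c i)%:R%:E - f i x).
  exact: emeasurable_funB.
have g0 i x : 0 <= (c i)%:R%:E - f i x by rewrite sube_ge0// f_fin.
have := eff_lower_integral_rho mg g0 hl.
have hcR' : rational_seq (fun i => (c (nsnd i))%:R : R)%R.
  by apply: rational_seq_nat; apply: (computable_comp hc); comp.
move=> /(eff_upper_opp_add O_base hcR' _) H; apply: eff_upper_ext (H _) => i x Kx; last first.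
  by rewrite -ltNye; apply: lt_le_trans (integral_ge0 _ _).
have cE : (c (nsnd i))%:R%:E = \int[rho (nfst i) x]_(y in (setT : set (borel X))) f (nsnd i) y +
    \int[rho (nfst i) x]_(y in (setT : set (borel X))) ((c (nsnd i))%:R%:E - f (nsnd i) y).
  rewrite -ge0_integralD//.
  transitivity (\int[rho (nfst i) x]_(y in (setT : set (borel X))) ((c (nsnd i))%:R%:E : \bar R)).
    by rewrite (integral_rho_cst _ _ Kx).
  by apply: eq_integral => y _; rewrite addeC subeK.
set J := \int[rho (nfst i) x]_(y in setT) ((c (nsnd i))%:R%:E - f (nsnd i) y) in cE *.
have Jfin : J \is a fin_num.
  have : (c (nsnd i))%:R%:E \is a @fin_num R by [].
  by rewrite cE fin_numD => /andP[].
by rewrite cE addeK.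
Qed.

(** * The maximal inequality for a disintegration *)

Section DisintegrationMaximal.
Variables (c : R) (D : X -> R).
Hypotheses (mD : measurable_fun setT (D : borel X -> R))
  (D_bounds : forall x, (0 <= D x <= c)%R).
Let q : R := (p / (p - 1))%R.
Let cexp n x := \int[rho n x]_(y in (setT : set (borel X))) (D y)%:E.

Let mDE : measurable_fun setT (fun x : borel X => (D x)%:E).
Proof. exact/measurable_EFinP. Qed.

Let c_ge0 : (0 <= c)%R.
Proof. by have /andP[h1 h2] := D_bounds (a 0%N); exact: le_trans h2. Qed.

Let D_ge0 x : 0 <= (D x)%:E. Proof. by rewrite lee_fin; case/andP: (D_bounds x). Qed.

Let e_ge0 n x : 0 <= cexp n x. Proof. by apply: integral_ge0 => y _; exact: D_ge0. Qed.

Let e_le n x : KR x -> cexp n x <= c%:E.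
Proof.
move=> Kx; rewrite -(integral_rho_cst n c Kx); apply: ge0_le_integral => // y _.
by rewrite lee_fin; case/andP: (D_bounds y).
Qed.

Let e_measurable n : measurable_fun setT (cexp n : borel X -> \bar R).
Proof. by apply: measurable_integral_rho => // y; exact: D_ge0. Qed.

(** [doob_inequality] is about real functions bounded at every point, while [cexp n] is known to be
    at most [c] only on [KR]. The truncation changes nothing there. *)
Let s n (x : borel X) : R := Num.min c (fine (cexp n x)).

Let s_measurable n : measurable_fun setT (s n).
Proof.
apply: measurable_minr => //.
exact: (measurableT_comp (fine_measurable measurableT) (e_measurable n)).
Qed.

Let s_bounds n x : (0 <= s n x <= c)%R.
Proof. by rewrite /s le_min c_ge0 fine_ge0//= ge_min lexx. Qed.

Let sE n x : KR x -> (s n x)%:E = cexp n x.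
Proof.
move=> Kx; have efin : cexp n x \is a fin_num.
  by rewrite ge0_fin_numE//; apply: le_lt_trans (e_le n Kx) _; rewrite ltry.
by rewrite /s min_r ?fineK// -lee_fin fineK// e_le.
Qed.

Let D_integrable (g : borel X -> R) : measurable_fun setT g ->
  (exists C, forall x, (0 <= g x <= C)%R) -> nu.-integrable setT (EFin \o g).
Proof.
move=> mg [C gC]; apply/integrableP; split; first exact/measurable_EFinP.
apply: (@le_lt_trans _ _ (\int[nu]_(x in (setT : set (borel X))) C%:E)).
  apply: ge0_le_integral => //.
  - by apply: measurableT_comp => //; exact/measurable_EFinP.
  - by move=> x _; have /andP[g0 g1] := gC x; rewrite /= lee_fin ger0_norm.
by rewrite integral_probability_cst ltry.
Qed.

Let s_atom i j x y : (i <= j)%N -> atom (F j) x y -> running_max s i y = running_max s i x.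
Proof.
have sa k : (k <= j)%N -> atom (F j) x y -> s k y = s k x.
  move=> kj xy; rewrite /s /cexp (@integral_rho_atom_eq k x y)//.
    by apply: (D_integrable mD); exists c.
  exact: (atom_mono kj xy).
elim: i => [|i IH] ij xy /=; first exact: sa.
by rewrite IH ?sa// ltnW.
Qed.

(** Taking out what is known, done pointwise: the weight is constant on the atom of [x] in [F j],
    which carries the measure [rho j x], so it leaves the inner integral. *)
Let s_martingale i j : (i <= j)%N ->
  \int[nu]_x (s j x * running_max s i x `^ (p - 1))%R%:E =
  \int[nu]_x (D x * running_max s i x `^ (p - 1))%R%:E.
Proof.
move=> ij; set w := fun x => (running_max s i x `^ (p - 1))%R.
have mw : measurable_fun setT w.
  apply: (measurableT_comp (measurable_powR (p - 1))).
  by elim: (i) => [|k IH] //=; exact: measurable_maxr.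
have w0 x : (0 <= w x)%R by exact: powR_ge0.
have wc x : (w x <= c `^ (p - 1))%R.
  have m_bounds : (0 <= running_max s i x <= c)%R.
    elim: (i) => [|k /andP[IH1 IH2]] //=.
    by have /andP[h1 h2] := s_bounds k.+1 x; rewrite le_max IH1 ge_max IH2.
  have /andP[m0 m1] := m_bounds.
  by apply: ge0_ler_powR; rewrite ?nnegrE ?subr_ge0 ?(ltW p_gt1).
have mDw : measurable_fun setT (fun x : borel X => (D x * w x)%R) by exact: measurable_funM.
have Dw0 x : (0 <= D x * w x)%R by have /andP[? _] := D_bounds x; rewrite mulr_ge0.
have intDw : nu.-integrable setT (EFin \o (fun x => D x * w x)%R).
  apply: D_integrable => //; exists (c * c `^ (p - 1))%R => x; rewrite Dw0/=.
  by have /andP[? ?] := D_bounds x; apply: ler_pM.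
rewrite -[RHS](integral_integral_rho j intDw).
apply: ge0_ae_eq_integral => //.
- by apply/measurable_EFinP; exact: measurable_funM.
- by apply: measurable_integral_rho => //; exact/measurable_EFinP.
- by move=> x _; rewrite lee_fin mulr_ge0 ?powR_ge0//; case/andP: (s_bounds j x).
- by move=> x _; apply: integral_ge0 => y _; rewrite lee_fin.
apply: ae_KR => x Kx _.
transitivity (\int[rho j x]_(y in (setT : set (borel X))) ((w x)%:E * (D y)%:E)).
  rewrite ge0_integralZl//; last by rewrite lee_fin.
  by rewrite EFinM (sE j Kx) muleC.
apply: eq_integral_rho; first exact: Kx.
- exact: emeasurable_funM.
- exact/measurable_EFinP.
- by move=> y; apply: mule_ge0 => //; rewrite lee_fin.
- by move=> y; rewrite lee_fin.
by move=> y Ky xy; rewrite /= /w (s_atom ij xy) mulrC EFinM.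
Qed.

Lemma maximal_Lnorm_le N :
  'N[nu]_(p%:E)[(fun x : borel X => \big[Order.max/0]_(n < N.+1) cexp n x)] <=
  (2 * q)%R%:E * 'N[nu]_(p%:E)[(fun x : borel X => (D x)%:E)].
Proof.
have mM : measurable_fun setT ((fun x : borel X => \big[Order.max/0]_(n < N.+1) cexp n x)).
  exact: measurable_bigmaxe.
have rm0 x : (0 <= running_max s N x)%R.
  elim: (N) => [|k IH] /=; first by case/andP: (s_bounds 0 x).
  by rewrite le_max IH.
have mrm : measurable_fun setT (fun x : borel X => (running_max s N x)%:E).
  apply/measurable_EFinP.
  by elim: (N) => [|k IH] //=; exact: measurable_maxr.
apply: (@le_trans _ _ ('N[nu]_(p%:E)[(fun x : borel X => (running_max s N x)%:E)])).
  apply: ae_le_Lnorm => //.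
  apply: ae_KR => x Kx; rewrite !gee0_abs ?lee_fin//; last exact: bigmax_ge_id.
  apply/bigmax_leP; split => [|n _]; first by rewrite lee_fin.
  by rewrite -(sE n Kx) lee_fin le_running_max// -ltnS.
have h := doob_inequality p_gt1 mD s_measurable D_bounds s_bounds s_martingale N.
have q0 : (0 <= 2 * q)%R by rewrite mulr_ge0// (le_trans _ (conj_exponent_ge1 p_gt1)).
rewrite !ge0_LnormE ?(ltW p_gt1)//.
have -> : (2 * q)%R%:E = ((2 * q) `^ p)%R%:E `^ p^-1 by rewrite /= powRK.
rewrite -poweRM ?lee_fin ?powR_ge0//; last by apply: integral_ge0 => x _; exact: poweR_ge0.
apply: lee_poweR; rewrite ?invr_ge0 ?(ltW p_gt0)//.
by apply: integral_ge0 => x _; exact: poweR_ge0.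
Qed.

End DisintegrationMaximal.

(** * Convergence of the conditional expectations *)

Section ClopenApproximation.
Variables (fs : nat -> X -> \bar R) (g : nat -> nat).
Hypotheses (fs_ge0 : forall s x, 0 <= fs s x) (g_computable : computable g)
  (fs_mono : forall s x, KR x -> fs s x <= fs s.+1 x)
  (g_enum : forall i x, KR x -> ((qval R (nfst i))%:E < fs (nsnd i) x <->
     exists k j, g (npair i k) = j.+1 /\ A (nfst j) (nsnd j) x)).

(* The index [i] codes a rational value and a stage of the enumeration of the
   open set where [fs j] exceeds this value. *)
Definition piece_code (j i : nat) : nat := g (npair (npair (nfst i) j) (nsnd i)).

Definition piece_set (j i : nat) : set X :=
  A (nfst (piece_code j i).-1) (nsnd (piece_code j i).-1).

Definition piece_active (j i : nat) : bool :=
  (0 < piece_code j i)%N && (0 < qval R (nfst i))%R.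

Definition piece (j i : nat) (x : X) : \bar R :=
  if piece_active j i && `[< piece_set j i x >] then (qval R (nfst i))%:E else 0.

Definition piece_level (j i : nat) : nat := nfst (piece_code j i).-1.

Let computable_piece_code j i : computable j -> computable i ->
  computable (fun n => piece_code (j n) (i n)).
Proof. by move=> hj hi; apply: (computable_comp g_computable); comp. Qed.

Lemma piece_ge0 j i x : 0 <= piece j i x.
Proof. by rewrite /piece; case: ifP => // /andP[/andP[_ /ltW q0] _]; rewrite lee_fin. Qed.

(** The positive part of the numerator of the rational coded by [nfst i], an integer bound of the
    piece. *)
Definition piece_num (i : nat) : nat := nfst (nfst (nfst i)).

Lemma piece_le_num j i x : piece j i x <= (piece_num i)%:R%:E.
Proof.
rewrite /piece; case: ifP => _; rewrite lee_fin// /qval /piece_num.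
rewrite ler_pdivrMr ?ltr0Sn//; apply: (@le_trans _ _ (nfst (nfst (nfst i)))%:R%R).
  by rewrite gerBl.
by rewrite -natrM ler_nat leq_pmulr.
Qed.

Lemma piece_le j i x : KR x -> piece j i x <= fs j x.
Proof.
move=> Kx; rewrite /piece; case: ifP => // /andP[/andP[c0 q0] /asboolP Ax].
apply: ltW; have := g_enum (npair (nfst i) j) Kx; rewrite !npairE => -[_]; apply.
by exists (nsnd i), (piece_code j i).-1; rewrite prednK.
Qed.

Lemma piece_sup j x (t : \bar R) : KR x -> 0 <= t -> t < fs j x -> exists i, t < piece j i x.
Proof.
move=> Kx t0 /qval_between[q /andP[tq qf]].
have := g_enum (npair q j) Kx; rewrite !npairE => -[/(_ qf) [k [z [gk Az]]] _].
have q0 : (0 < qval R q)%R by rewrite -lte_fin (le_lt_trans t0).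
exists (npair q k); rewrite /piece /piece_active /piece_set /piece_code !npairE gk q0 /=.
by rewrite asboolT.
Qed.

Lemma piece_atom n j i x y : (piece_level j i <= n)%N -> atom (F n) x y ->
  piece j i y = piece j i x.
Proof.
move=> ln xy; rewrite /piece; congr (if _ && _ then _ else _); apply: asbool_equiv_eq.
apply: iff_sym; exact: (atom_A _ (atom_mono ln xy)).
Qed.

Lemma measurable_piece j i : measurable_fun setT (piece j i : borel X -> \bar R).
Proof.
rewrite /piece; case: piece_active => /=; last exact: measurable_cst.
apply: measurable_fun_ifT => //; apply: (measurable_fun_bool true).
rewrite setTI [X in measurable X](_ : _ = piece_set j i).
  exact: measurable_A.
by apply/seteqP; split=> x /=; [move/asboolP|move=> ?; apply/asboolP].
Qed.

Let eff_open_piece_set (b : bool) : eff_open ballX KR (fun n x =>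
  if b then piece_set (nfst n) (nsnd n) x else ~ piece_set (nfst n) (nsnd n) x).
Proof.
apply: (eff_open_subst (eff_open_A b)
  (h := fun n => (piece_code (nfst n) (nsnd n)).-1)).
by apply: computable_pred; apply: computable_piece_code; comp.
Qed.

Let computable_piece_active : computable (fun n => piece_active (nfst n) (nsnd n) : nat).
Proof.
have h : computable (fun n => piece_code (nfst n) (nsnd n)).
  by apply: computable_piece_code; comp.
have h0 := rational_seq_natconst R 0.
by rewrite /piece_active; comp.
Qed.

Lemma eff_lower_piece : eff_lower ballX KR (fun n => piece (nfst n) (nsnd n)).
Proof.
apply: eff_open_ext (_ : eff_open ballX KR (fun n x => (qval R (nfst n) < 0)%R \/
  (piece_active (nfst (nsnd n)) (nsnd (nsnd n)) /\
   (qval R (nfst n) < qval R (nfst (nsnd (nsnd n))))%R) /\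
   piece_set (nfst (nsnd n)) (nsnd (nsnd n)) x)).
  move=> n x _; split.
    move=> [q0|[[act qq] /asboolP Ax]]; last by rewrite /piece act Ax lte_fin.
    by apply: lt_le_trans (piece_ge0 _ _ _); rewrite lte_fin.
  rewrite /piece; case: ifP => [/andP[act /asboolP Ax]|_]; rewrite lte_fin => h; last by left.
  by right.
have h0 := rational_seq_natconst R 0.
have hs : computable (fun n => nsnd n) by comp.
apply: eff_open_or => //; first by apply: eff_open_dec => //; comp.
apply: eff_open_and => //; last by apply: (eff_open_subst (eff_open_piece_set true) hs).
apply: eff_open_and => //; apply: eff_open_dec => //; last by comp.
exact: (computable_comp computable_piece_active hs).
Qed.

Lemma eff_upper_piece : eff_upper ballX KR (fun n => piece (nfst n) (nsnd n)).
Proof.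
apply: eff_open_ext (_ : eff_open ballX KR (fun n x => (0 < qval R (nfst n))%R /\
  ((~~ piece_active (nfst (nsnd n)) (nsnd (nsnd n)) \/
   (qval R (nfst (nsnd (nsnd n))) < qval R (nfst n))%R) \/
   ~ piece_set (nfst (nsnd n)) (nsnd (nsnd n)) x))).
  move=> n x _; split.
    move=> [q0 h]; rewrite /piece; case: ifP => [/andP[act /asboolP Ax]|_]; rewrite lte_fin//.
    by case: h => [[|]|]//; rewrite act.
  move=> h; split; first by rewrite -lte_fin; exact: le_lt_trans (piece_ge0 _ _ _) h.
  move: h; rewrite /piece; case: ifP => [_|/negbT]; rewrite lte_fin.
    by left; right.
  by rewrite negb_and => /orP[?|/asboolPn ?] _; [left; left|right].
have h0 := rational_seq_natconst R 0.
have hs : computable (fun n => nsnd n) by comp.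
apply: eff_open_and => //; first by apply: eff_open_dec => //; comp.
apply: eff_open_or => //; last by apply: (eff_open_subst (eff_open_piece_set false) hs).
apply: eff_open_or => //; apply: eff_open_dec => //; last by comp.
by apply: computable_negb; exact: (computable_comp computable_piece_active hs).
Qed.

(** Pieces of all [fs j] with [j <= s] are used, not only those of [fs s]. This makes the minorants
    increase in [s] at every point, so that their increments are nonnegative. *)
Definition minorant (s k : nat) (x : X) : \bar R :=
  \big[Order.max/0]_(j < s.+1) \big[Order.max/0]_(i < k) piece j i x.

Lemma minorant_ge0 s k x : 0 <= minorant s k x.
Proof. by rewrite /minorant bigmax_ge_id. Qed.

Lemma minorant_le s k x (t : \bar R) : 0 <= t ->
  (forall j i, (j <= s)%N -> (i < k)%N -> piece j i x <= t) -> minorant s k x <= t.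
Proof.
move=> t0 h; apply/bigmax_leP; split=> // j _; apply/bigmax_leP; split=> // i _.
by apply: h => //; rewrite -ltnS.
Qed.

Lemma piece_le_minorant s k j i x : (j <= s)%N -> (i < k)%N -> piece j i x <= minorant s k x.
Proof.
move=> js ik; apply: (@le_trans _ _ (\big[Order.max/0]_(i < k) piece j i x)).
  exact: (le_bigmax _ (fun i : 'I_k => piece j i x) (Ordinal ik)).
exact: (le_bigmax _ (fun j : 'I_s.+1 => \big[Order.max/0]_(i < k) piece j i x) (Ordinal (js : (j < s.+1)%N))).
Qed.

Lemma minorant_mono s s' k k' x : (s <= s')%N -> (k <= k')%N -> minorant s k x <= minorant s' k' x.
Proof.
move=> ss kk; apply: minorant_le => [|j i js ik]; first exact: minorant_ge0.
by apply: piece_le_minorant; [exact: leq_trans ss|exact: leq_trans kk].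
Qed.

Lemma fs_nondecreasing s s' x : KR x -> (s <= s')%N -> fs s x <= fs s' x.
Proof.
move=> Kx; elim: s' => [|s' IH]; first by rewrite leqn0 => /eqP ->.
rewrite leq_eqVlt => /orP[/eqP ->//|]; rewrite ltnS => /IH /le_trans; apply.
exact: fs_mono.
Qed.

Lemma minorant_le_fs s k x : KR x -> minorant s k x <= fs s x.
Proof.
move=> Kx; apply: minorant_le => // j i js _.
by apply: le_trans (piece_le _ _ Kx) _; exact: fs_nondecreasing.
Qed.

Definition minorant_bound (k : nat) : nat := (\sum_(i < k) piece_num i)%N.

Lemma computable_minorant_bound k : computable k -> computable (fun n => minorant_bound (k n)).
Proof.
by apply: (computable_sum (g := fun _ i => piece_num i)); rewrite /piece_num; comp.
Qed.

Lemma minorant_le_bound s k x : minorant s k x <= (minorant_bound k)%:R%:E.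
Proof.
apply: minorant_le => [|j i _ ik]; first by rewrite lee_fin.
apply: le_trans (piece_le_num _ _ _) _; rewrite lee_fin ler_nat /minorant_bound.
by rewrite (bigD1 (Ordinal ik))//= leq_addr.
Qed.

Lemma minorant_fin s k x : minorant s k x \is a fin_num.
Proof.
by rewrite ge0_fin_numE ?minorant_ge0//; apply: le_lt_trans (minorant_le_bound _ _ _) _; rewrite ltry.
Qed.

Lemma minorant_atom n s k x y : (forall j i, (j <= s)%N -> (i < k)%N -> (piece_level j i <= n)%N) ->
  atom (F n) x y -> minorant s k y = minorant s k x.
Proof.
move=> ln xy; apply: eq_bigr => j _; apply: eq_bigr => i _; apply: piece_atom xy.
by apply: ln => //; rewrite -ltnS.
Qed.

Lemma measurable_minorant s k : measurable_fun setT (minorant s k : borel X -> \bar R).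
Proof.
apply: (measurable_bigmaxe (f := fun j (x : borel X) => \big[Order.max/0]_(i < k) piece j i x)) => j.
by apply: (measurable_bigmaxe (f := fun i (x : borel X) => piece j i x)) => i; exact: measurable_piece.
Qed.

Lemma eff_lower_minorant : eff_lower ballX KR (fun n => minorant (nfst n) (nsnd n)).
Proof.
apply: (eff_lower_max O_base (x := fun n j x => \big[Order.max/0]_(i < nsnd n) piece j i x)); last by comp.
apply: (eff_lower_max O_base (x := fun n i => piece (nsnd n) i)); last by comp.
apply: eff_lower_ext (eff_lower_subst eff_lower_piece (h := fun n => npair (nsnd (nfst n)) (nsnd n)) _).
  by move=> n x _; rewrite !npairE.
by comp.
Qed.

Lemma eff_upper_minorant : eff_upper ballX KR (fun n => minorant (nfst n) (nsnd n)).
Proof.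
apply: (eff_upper_max O_base (x := fun n j x => \big[Order.max/0]_(i < nsnd n) piece j i x)); last by comp.
apply: (eff_upper_max O_base (x := fun n i => piece (nsnd n) i)); last by comp.
apply: eff_upper_ext (eff_upper_subst eff_upper_piece (h := fun n => npair (nsnd (nfst n)) (nsnd n)) _).
  by move=> n x _; rewrite !npairE.
by comp.
Qed.

Lemma computable_integral_minorant :
  computable_seq (fun n => \int[nu]_x (minorant (nfst n) (nsnd n) x `^ p)).
Proof.
apply: (@computable_integral_powR (fun n => minorant (nfst n) (nsnd n)) _ _ _ _ (fun n => minorant_bound (nsnd n))).
- by move=> n; exact: measurable_minorant.
- by move=> n x; exact: minorant_ge0.
- exact: eff_lower_minorant.
- exact: eff_upper_minorant.
- by apply: computable_minorant_bound; comp.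
- by move=> n x _; exact: minorant_le_bound.
Qed.

Lemma minorant_sup s x : KR x -> fs s x = ereal_sup (range (fun k => minorant s k x)).
Proof.
move=> Kx; apply/eqP; rewrite eq_le; apply/andP; split; last first.
  by apply: ge_ereal_sup => _ [k _ <-]; exact: minorant_le_fs.
rewrite leNgt; apply/negP => h.
have s0 : 0 <= ereal_sup (range (fun k => minorant s k x)).
  by apply: le_trans (minorant_ge0 s 0 x) _; apply: ereal_sup_ubound; exists 0%N.
have [i hi] := piece_sup Kx s0 h.
have : ereal_sup (range (fun k => minorant s k x)) < ereal_sup (range (fun k => minorant s k x)).
  apply: lt_le_trans hi _; apply: le_trans (piece_le_minorant _ (leqnn s) (ltnSn i)) _.
  by apply: ereal_sup_ubound; exists i.+1.
by rewrite ltxx.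
Qed.

Hypothesis fs_lower : eff_lower ballX setT fs.
Variable r : nat -> R.
Hypotheses (r_computable : uniformly_computable_reals r)
  (rE : forall s, 'N[nu]_(p%:E)[fs s] = (r s)%:E).

Let mfs s : measurable_fun setT (fs s : borel X -> \bar R).
Proof. exact: measurable_eff_lower fs_lower. Qed.

Let r_ge0 s : 0 <= (r s)%:E. Proof. by rewrite -rE; exact: Lnorm_ge0. Qed.

Let rpE s : \int[nu]_x (fs s x `^ p) = (r s)%:E `^ p.
Proof.
rewrite -rE poweR_Lnorm; last by rewrite gt_eqF.
by apply: eq_integral => x _; rewrite gee0_abs.
Qed.

Let integral_minorant_sup s (t : \bar R) : t < \int[nu]_x (fs s x `^ p) ->
  exists k, t < \int[nu]_x (minorant s k x `^ p).
Proof.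
have nd x : {homo (fun k => minorant s k x `^ p) : k k' / (k <= k')%N >-> k <= k'}.
  move=> k k' kk; apply: lee_poweR; [exact: ltW|exact: minorant_ge0|exact: minorant_mono].
have ma k : measurable_fun setT (fun x : borel X => minorant s k x `^ p).
  by apply: (measurable_poweR_comp p); exact: measurable_minorant.
have -> : \int[nu]_x (fs s x `^ p) = ereal_sup (range (fun k => \int[nu]_x (minorant s k x `^ p))).
  transitivity (\int[nu]_x limn (fun k => minorant s k x `^ p)).
    have mlim : measurable_fun setT (fun x : borel X => limn (fun k => minorant s k x `^ p)).
      apply: (@emeasurable_fun_cvg _ (borel X) R setT (fun k (x : borel X) => minorant s k x `^ p)) => // x _.
      by apply: ereal_nondecreasing_is_cvgn; exact: nd.
    apply: ge0_ae_eq_integral => //.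
    - exact: (measurable_poweR_comp p (mfs s)).
    - by move=> x _; exact: poweR_ge0.
    - move=> x _; apply: lime_ge; last by apply: nearW => k; exact: poweR_ge0.
      by apply: ereal_nondecreasing_is_cvgn; exact: nd.
    apply: ae_KR => x Kx _.
    rewrite (cvg_lim _ (ereal_nondecreasing_cvgn (nd x)))// (minorant_sup s Kx) poweR_sup//.
    by move=> k; exact: minorant_ge0.
  rewrite monotone_convergence//; last by move=> k x _; exact: poweR_ge0.
  apply/cvg_lim => //; apply: ereal_nondecreasing_cvgn => k k' kk.
  by apply: ge0_le_integral => // x _; rewrite ?poweR_ge0//; exact: nd.
by move=> /ereal_sup_gt[_ [k _ <-] tk]; exists k.
Qed.

Let minorant_powR_fin s k : \int[nu]_x (minorant s k x `^ p) \is a fin_num.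
Proof.
have := @integral_powR_fin (fun _ => minorant s k) (fun _ => measurable_minorant s k)
  (fun _ => minorant_ge0 s k) (fun _ => minorant_bound k).
by move=> /(_ (fun _ x _ => minorant_le_bound s k x) 0%N).
Qed.

Let tol (s : nat) : R := (((4^-1 : R) ^+ s) ^+ Num.bound p)%R.

Let tol_gt0 s : (0 < tol s)%R. Proof. by rewrite !exprn_gt0. Qed.

(** By monotone convergence the integrals of the p-th powers of the minorants increase to that of
    [fs s], which is r_s^p. Both sides are computable, so a stage within the tolerance can be
    searched for. *)
Lemma minorant_stage : exists2 h, computable h &
  forall s, (r s)%:E `^ p < \int[nu]_x (minorant s (h s) x `^ p) + (tol s)%:E.
Proof.
have [_ ru] := (computable_seqP r).1 r_computable.
have rpu : eff_upper trivial_base setT (fun s _ => (r s)%:E `^ p).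
  by apply: eff_upper_powR ru => //; exact: trivial_base_effective.
have [al _] := computable_integral_minorant.
(* [m] codes a stage together with a rational above r_s^p and a rational below the integral at that
   stage, less than the tolerance apart. *)
have [||h hh hP] := @re_choice (fun s m => ((r s)%:E `^ p < (qval R (nfst (nsnd m)))%:E /\
   (qval R (nsnd (nsnd m)))%:E < \int[nu]_x (minorant s (nfst m) x `^ p)) /\
   (qval R (nfst (nsnd m)) - qval R (nsnd (nsnd m)) < tol s)%R).
- rewrite /re /=; apply: (eff_open_and trivial_base_effective).
    apply: (eff_open_and trivial_base_effective).
      by apply: (eff_upperP rpu); comp.
    apply: eff_open_ext (eff_lowerP al (r := fun n => qval R (nsnd (nsnd (nsnd n))))
      (h := fun n => npair (nfst n) (nfst (nsnd n))) _ _); [|by comp..].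
    by move=> n y _; rewrite !npairE.
  apply: (eff_open_dec _ trivial_base_effective); apply: computable_ltr; first by comp.
  by apply: rational_seq_tolerance; comp.
- move=> s; have Jfin : (r s)%:E `^ p \is a fin_num by exact: fin_num_poweR.
  have [|k hk] := @integral_minorant_sup s ((r s)%:E `^ p - (tol s / 2)%R%:E).
    by rewrite rpE lteBlDr// lteDl// lte_fin divr_gt0.
  have /qval_between[q2 /andP[q21 q22]] := hk.
  have /qval_between[q1 /andP[q11 q12]] : (r s)%:E `^ p < (r s)%:E `^ p + (tol s / 2)%R%:E.
    by rewrite lteDl// lte_fin divr_gt0.
  exists (npair k (npair q1 q2)); rewrite !npairE; split=> //.
  move: Jfin q21 q12; case: ((r s)%:E `^ p) => // J _; rewrite -EFinB -EFinD !lte_fin; lra.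
exists (fun s => nfst (h s)); first by comp.
move=> s; have [[h1 h2] h3] := hP s.
move: h2 (minorant_powR_fin s (nfst (h s))); case: (\int[nu]_x _) => // I; rewrite lte_fin => h2 _.
by apply: (lt_trans h1); rewrite -EFinD lte_fin; lra.
Qed.

(** By superadditivity of the p-th power, the integral of the p-th power of the residual is at most
    the gap found by [minorant_stage]. Later stages [k] are allowed because the gap only shrinks. *)
Lemma minorant_residual s k k0 : (k0 <= k)%N ->
  (r s)%:E `^ p < \int[nu]_x (minorant s k0 x `^ p) + (tol s)%:E ->
  'N[nu]_(p%:E)[(fun x : borel X => Order.max 0 (fs s x - minorant s k x))] <= ((4^-1 : R) ^+ s)%R%:E.
Proof.
move=> k0k h; set d := fun x : borel X => Order.max 0 (fs s x - minorant s k x).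
have d0 x : 0 <= d x by rewrite /d le_max lexx.
have md : measurable_fun setT d.
  apply: measurable_maxe => //; apply: emeasurable_funB => //; exact: measurable_minorant.
have q01 := quarter_itv s; have /andP[q0 q1] := q01.
apply: Lnorm_le_of_integral; [by []|by []|exact: ltW|].
apply: (@le_trans _ _ (tol s)%:E); last by rewrite lee_fin powR_bound.
have mdp : measurable_fun setT (fun x => d x `^ p) by exact: measurable_poweR_comp.
have map k' : measurable_fun setT (fun x : borel X => minorant s k' x `^ p).
  by apply: (measurable_poweR_comp p); exact: measurable_minorant.
have le1 : \int[nu]_x (d x `^ p) + \int[nu]_x (minorant s k x `^ p) <= \int[nu]_x (fs s x `^ p).
  rewrite -ge0_integralD//; try by move=> x _; exact: poweR_ge0.
  apply: ae_ge0_le_integral => //.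
  - by move=> x _; apply: adde_ge0; exact: poweR_ge0.
  - exact: emeasurable_funD.
  - by move=> x _; exact: poweR_ge0.
  - exact: (measurable_poweR_comp p (mfs s)).
  apply: ae_KR => x Kx _.
  have af := minorant_fin s k x; have ale := minorant_le_fs s k Kx.
  rewrite /d max_r ?sube_ge0 ?af//.
  by apply: poweR_superadd => //; exact: minorant_ge0.
have le2 : \int[nu]_x (minorant s k0 x `^ p) <= \int[nu]_x (minorant s k x `^ p).
  apply: ge0_le_integral => // x _; rewrite ?poweR_ge0//.
  by apply: lee_poweR; [exact: ltW|exact: minorant_ge0|exact: minorant_mono].
move: le1; rewrite rpE => le1.
have := le_lt_trans le1 (lt_le_trans h (leeD2r _ le2)).
rewrite addeC lteD2lE; first exact: ltW.
exact: minorant_powR_fin.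
Qed.

End ClopenApproximation.

(** * Maximal functions of the increments *)

Section ClopenMartingale.
Variables (Phi : nat -> X -> \bar R) (c L : nat -> nat).
Hypotheses (Phi_ge0 : forall s x, 0 <= Phi s x)
  (Phi_mono : forall s x, Phi s x <= Phi s.+1 x)
  (Phi_le : forall s x, Phi s x <= (c s)%:R%:E) (c_computable : computable c)
  (mPhi : forall s, measurable_fun setT (Phi s : borel X -> \bar R))
  (Phi_lower : eff_lower ballX KR Phi) (Phi_upper : eff_upper ballX KR Phi)
  (L_computable : computable L)
  (Phi_atom : forall s n x y, (L s <= n)%N -> atom (F n) x y -> Phi s y = Phi s x).
Variable E : nat -> \bar R.
Hypotheses (E_ge : forall s, N (fun x : borel X => Phi s.+1 x - Phi s x) <= E s)
  (E_sum : forall k, \sum_(0 <= s <oo) E s * ((s.+1 ^ k)%N%:R)%:E < +oo).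

Let Phi_fin s x : Phi s x \is a fin_num.
Proof. by rewrite ge0_fin_numE//; apply: le_lt_trans (Phi_le s x) _; rewrite ltry. Qed.

Let D s (x : X) : R := (fine (Phi s.+1 x) - fine (Phi s x))%R.

Let DE s x : (D s x)%:E = Phi s.+1 x - Phi s x.
Proof. by rewrite /D EFinB !fineK. Qed.

Let D_bounds s x : (0 <= D s x <= (c s.+1)%:R)%R.
Proof.
rewrite -!lee_fin DE sube_ge0 ?Phi_fin// Phi_mono/=.
by apply: le_trans (Phi_le s.+1 x); rewrite leeBlDr// leeDl.
Qed.

Let DE_ge0 s x : 0 <= (D s x)%:E.
Proof. by rewrite lee_fin; case/andP: (D_bounds s x). Qed.

Let DE_le s x : (D s x)%:E <= (c s.+1)%:R%:E.
Proof. by rewrite lee_fin; case/andP: (D_bounds s x). Qed.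

Let mD s : measurable_fun setT (D s : borel X -> R).
Proof.
by apply: measurable_funB; exact: (measurableT_comp (fine_measurable measurableT)).
Qed.

Let mDE s : measurable_fun setT (fun x : borel X => (D s x)%:E).
Proof. exact/measurable_EFinP. Qed.

Let D_lower : eff_lower ballX KR (fun s x => (D s x)%:E).
Proof.
apply: eff_lower_ext (eff_lower_add O_base (x := fun s => Phi s.+1) (y := fun s x => - Phi s x) _ _ _ _).
- by move=> s x _; rewrite DE.
- by move=> s x _; move: (Phi_fin s.+1 x); rewrite fin_numE => /andP[].
- by move=> s x _; move: (Phi_fin s x); rewrite -fin_numN fin_numE => /andP[].
- by apply: (eff_lower_subst Phi_lower); comp.
- exact: eff_lower_opp.
Qed.

Let D_upper : eff_upper ballX KR (fun s x => (D s x)%:E).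
Proof.
apply: eff_upper_ext (eff_upper_add O_base (x := fun s => Phi s.+1) (y := fun s x => - Phi s x) _ _ _ _).
- by move=> s x _; rewrite DE.
- by move=> s x _; move: (Phi_fin s.+1 x); rewrite fin_numE => /andP[].
- by move=> s x _; move: (Phi_fin s x); rewrite -fin_numN fin_numE => /andP[].
- by apply: (eff_upper_subst Phi_upper); comp.
- exact: eff_upper_opp.
Qed.

Let W n s (x : X) := \int[rho n x]_(y in (setT : set (borel X))) (D s y)%:E.

Let W_ge0 n s x : 0 <= W n s x. Proof. exact: integral_ge0. Qed.

Let W_le n s x : KR x -> W n s x <= (c s.+1)%:R%:E.
Proof.
move=> Kx; rewrite -(integral_rho_cst n _ Kx).
by apply: ge0_le_integral => // y _.
Qed.

Let mW n s : measurable_fun setT (W n s : borel X -> \bar R).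
Proof. exact: measurable_integral_rho. Qed.

(** The sum dominates the levels of [Phi s] and of [Phi s.+1]; from it on [W n s] equals the
    increment [D s] on [KR]. The successor makes the range of the maximum include this level, so
    that [M s] bounds [W n s] for every [n]. *)
Let n_ s := (L s + L s.+1).+1.

Let M s (x : X) := \big[Order.max/0]_(n < n_ s) W n s x.

Let swap i := npair (nsnd i) (nfst i).

Let n_computable : computable n_.
Proof.
apply: computable_succ; apply: computable_add => //.
by apply: (computable_comp L_computable); comp.
Qed.

Let M_lower : eff_lower ballX KR M.
Proof.
apply: (eff_lower_max O_base (x := fun s n => W n s)) => //.
apply: eff_lower_ext (eff_lower_subst (h := swap)
  (eff_lower_integral_rho mDE DE_ge0 D_lower) _).
  by move=> i x _; rewrite /swap !npairE.
by rewrite /swap; comp.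
Qed.

Let M_upper : eff_upper ballX KR M.
Proof.
apply: (eff_upper_max O_base (x := fun s n => W n s)) => //.
have hc : computable (fun s => c s.+1) by apply: (computable_comp c_computable); comp.
apply: eff_upper_ext (eff_upper_subst (h := swap)
  (eff_upper_integral_rho mDE DE_ge0 hc DE_le D_upper) _).
  by move=> i x _; rewrite /swap !npairE.
by rewrite /swap; comp.
Qed.

Let mM s : measurable_fun setT (M s : borel X -> \bar R).
Proof. by apply: (measurable_bigmaxe (f := fun n (x : borel X) => W n s x)). Qed.

Let M_ge0 s x : 0 <= M s x. Proof. exact: bigmax_ge_id. Qed.

Let W_le_M n s x : KR x -> W n s x <= M s x.
Proof.
move=> Kx; have [nn|nn] := ltnP n (n_ s).
  exact: (le_bigmax _ (fun n : 'I_(n_ s) => W n s x) (Ordinal nn)).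
have WE k : (L s + L s.+1 <= k)%N -> W k s x = (D s x)%:E.
  move=> lk; apply: (@integral_rho_atom k x (fun y => (D s y)%:E)) => //.
  move=> y _ xy; rewrite /D.
  by rewrite (Phi_atom (n := k) (s := s) _ xy)?(Phi_atom (n := k) (s := s.+1) _ xy)//;
    apply: leq_trans lk; rewrite ?leq_addr ?leq_addl.
rewrite WE; last exact: ltnW.
have l : (L s + L s.+1 < n_ s)%N by rewrite /n_.
rewrite -(WE _ (leqnn _)).
exact: (le_bigmax _ (fun n : 'I_(n_ s) => W n s x) (Ordinal l)).
Qed.

Let q := (2 * (p / (p - 1)))%R.

Let q_ge0 : (0 <= q)%R.
Proof. by rewrite mulr_ge0// (le_trans _ (conj_exponent_ge1 p_gt1)). Qed.

Let N_M s : N (M s) <= q%:E * E s.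
Proof.
apply: le_trans (maximal_Lnorm_le (mD s) (D_bounds s) _) _.
apply: lee_wpmul2l; first by rewrite lee_fin.
by apply: le_trans (E_ge s); under eq_fun do rewrite DE.
Qed.

Lemma MDR_maximal_sum x : MDR a nu p x ->
  \sum_(0 <= s <oo) M s x < +oo.
Proof.
move=> MDRx; have Kx := MDR_KR MDRx.
(* [M] is effective on [KR] only; its extension has the same norms and the same value at the Kurtz
   random point [x]. *)
have [M' [lM' M'0 M'E]] := lsc_extension O_base (fun i x _ => M_ge0 i x) M_lower.
have mM' s : measurable_fun setT (M' s : borel X -> \bar R) by exact: measurable_eff_lower lM'.
have NM' s : N (M' s) = N (M s).
  by apply: (@ae_eq_Lnorm _ (borel X) _ nu p (ltW p_gt1)) => //; apply: ae_KR => y; exact: M'E.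
have := @series_test M' (fun s => c s.+1) lM'.
case.
- by apply: eff_upper_ext M_upper => i y Ky; rewrite M'E.
- by [].
- by apply: (computable_comp c_computable); comp.
- move=> i y Ky; rewrite M'E//; apply/bigmax_leP; split=> [|n _]; first by rewrite lee_fin.
  exact: W_le.
- move=> k; apply: (@le_lt_trans _ _ (q%:E * \sum_(0 <= s <oo) E s * ((s.+1 ^ k)%N%:R)%:E)).
    rewrite -nneseriesZl//; last first.
      by move=> i _; rewrite mule_ge0 ?lee_fin// (le_trans _ (E_ge i)) ?Lnorm_ge0.
    apply: lee_nneseries => [i _ _|i _]; first by rewrite mule_ge0 ?lee_fin// Lnorm_ge0.
    by rewrite muleA NM'; apply: lee_wpmul2r; rewrite ?lee_fin.
  have S0 : 0 <= \sum_(0 <= s <oo) E s * ((s.+1 ^ k)%N%:R)%:E.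
    by apply: nneseries_ge0 => i _ _; rewrite mule_ge0 ?lee_fin// (le_trans _ (E_ge i)) ?Lnorm_ge0.
  move: S0 (E_sum k); case: (\sum_(0 <= s <oo) _) => // e _ _.
  by rewrite -EFinM ltry.
move=> h1 h2 h3 h4.
have : maximal_doob_test a nu p (fun x => \sum_(0 <= s <oo) M' s x) by split.
move=> /MDRx; under eq_eseriesr do rewrite M'E//.
by [].
Qed.

Variable f : X -> \bar R.
Hypotheses (f_lsc : lsc a f) (f_ge0 : forall x, 0 <= f x)
  (f_sup : forall x, KR x -> f x = ereal_sup (range (fun s => Phi s x))).

Let Phi_nd x : {homo (fun s => Phi s x) : s t / (s <= t)%N >-> s <= t}.
Proof. by apply/nondecreasing_seqP => s; exact: Phi_mono. Qed.

Let mf : measurable_fun setT (f : borel X -> \bar R).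
Proof. by move/lscP: f_lsc => h; exact: (measurable_eff_lower 0%N h). Qed.

Let integral_f_le n x (t : \bar R) : KR x ->
  (\forall s \near \oo, \int[rho n x]_y Phi s y <= t) -> \int[rho n x]_y f y <= t.
Proof.
move=> Kx ht.
have lim0 y : 0 <= limn (fun s => Phi s y).
  apply: lime_ge; first by apply: ereal_nondecreasing_is_cvgn; exact: Phi_nd.
  by apply: nearW => s.
have mlim : measurable_fun setT (fun y : borel X => limn (fun s => Phi s y)).
  apply: (@emeasurable_fun_cvg _ (borel X) R setT (fun s (y : borel X) => Phi s y)) => // y _.
  by apply: ereal_nondecreasing_is_cvgn; exact: Phi_nd.
rewrite (@eq_integral_rho n x f (fun y => limn (fun s => Phi s y)))//.
  rewrite monotone_convergence; [|by []|by []|by move=> ? ? _|by move=> y _; exact: Phi_nd].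
  apply: lime_le => [|//]; apply: ereal_nondecreasing_is_cvgn => s s' ss.
  by apply: ge0_le_integral => // y _; exact: Phi_nd.
by move=> y Ky _; rewrite f_sup//; apply/esym/cvg_lim => //; exact: ereal_nondecreasing_cvgn.
Qed.

Let integral_Phi n x s : KR x -> \int[rho n x]_y Phi s.+1 y = \int[rho n x]_y Phi s y + W n s x.
Proof.
by move=> Kx; rewrite -ge0_integralD//; apply: eq_integral => y _; rewrite DE addeC subeK.
Qed.

(** For [n >= L S], [Phi S] is constant on the atom of [x], so the integral of [Phi t] telescopes to
    [Phi S x] plus the terms [W n s x] for [S <= s < t], each at most [M s x]. Monotone convergence
    in [t] passes to [f]. *)
Let integral_f_upper n x S : KR x -> (L S <= n)%N ->
  \int[rho n x]_y f y <= f x + \sum_(S <= s <oo) M s x.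
Proof.
move=> Kx Ln; apply: integral_f_le => //; exists S => // t /= St.
apply: (@le_trans _ _ (Phi S x + \sum_(S <= s < t) M s x)); last first.
  apply: leeD; first by rewrite f_sup//; apply: ereal_sup_ubound; exists S.
  exact: nneseries_lim_ge.
elim: t St => [|t IH]; rewrite leq_eqVlt.
  rewrite ltn0 orbF => /eqP S0; move: Ln; rewrite S0 => Ln.
  rewrite big_nil adde0 (integral_rho_atom)// => y _.
  exact: Phi_atom.
move=> /orP[/eqP <-|].
  rewrite big_geq// adde0 (integral_rho_atom)// => y _.
  exact: Phi_atom.
rewrite ltnS => St; rewrite big_nat_recr//= addeA integral_Phi//.
by apply: leeD; [exact: IH|exact: W_le_M].
Qed.

Lemma MDR_cvg_integral_rho x : MDR a nu p x -> f x \is a fin_num ->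
  \int[rho n x]_y f y @[n --> \oo] --> f x.
Proof.
move=> MDRx fx; have Kx := MDR_KR MDRx.
have tail : \sum_(S <= s <oo) M s x @[S --> \oo] --> 0.
  by apply: nneseries_tail_cvg => //; exact: MDR_maximal_sum.
rewrite -(fineK fx); have near_fx (e : R) : (0 < e)%R -> \forall n \near \oo,
    (fine (f x) - e)%R%:E <= \int[rho n x]_y f y <= (fine (f x) + e)%R%:E.
  rewrite -lte_fin => e0.
  have [|n1 h1] := @lsc_liminf f x
    (fine (f x) - e)%R f_lsc f_ge0 Kx.
    by rewrite -[ltRHS](fineK fx) lte_fin gtrBl -lte_fin.
  have [S _ /(_ S (leqnn S)) /= hS] := tail _ (open_ereal_lt' (e0 : 0 < e%:E)).
  exists (maxn n1 (L S)) => // n /=; rewrite geq_max => /andP[n1n Ln]; rewrite h1//=.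
  apply: le_trans (integral_f_upper Kx Ln) _.
  by rewrite EFinD fineK//; apply: leeD => //; exact: ltW.
apply/fine_cvgP; split.
  have [n0 _ h] := near_fx 1%R ltr01; exists n0 => // n /h /andP[_ hn].
  by rewrite ge0_fin_numE ?integral_ge0//; apply: le_lt_trans hn _; rewrite ltry.
apply/cvgrPdist_le => e e0; have [n0 _ h] := near_fx e e0; exists n0 => // n /h /=.
case: (\int[rho n x]_y f y) => [r| |]//=; rewrite ?lee_fin ?leNye ?leye_eq ?leeNy_eq//=.
  by rewrite ler_norml; lra.
by rewrite andbF.
Qed.

End ClopenMartingale.

Lemma MDR_cvg f x : MDR a nu p x -> maximal_doob_test a nu p f ->
  \int[rho n x]_y f y @[n --> \oo] --> f x.
Proof.
move=> MDRx f_test; have [f_lsc f_ge0 _ [fs [[/uniformly_lscP fs_lower fs_ge0 [r r_computable rE]] fs_sup _ _ fs_sum]]] := f_test.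
have fs_mono s y : KR y -> fs s y <= fs s.+1 y.
  by move=> Ky; have [/(_ s)/andP[]] := fs_sup y Ky.
have fs_le s y : KR y -> fs s y <= f y.
  by move=> Ky; have [_ ->] := fs_sup y Ky; apply: ereal_sup_ubound; exists s.
have [g g_computable g_enum] := ce_open_enumeration fs_lower.
have [k k_computable kP] := minorant_stage fs_ge0 g_computable fs_mono g_enum fs_lower r_computable rE.
(* [K] dominates [k], which keeps the residual small; it is monotone, which makes [Phi] increase;
   and it is unbounded, so that every piece eventually enters. *)
pose K s := (\sum_(i < s.+1) k i + s)%N.
have K_computable : computable K.
  apply: computable_add; last exact: computable_id.
  apply: (computable_sum (g := fun _ => k)); last by comp.
  by apply: (computable_comp k_computable); comp.
have kK s : (k s <= K s)%N by rewrite /K big_ord_recr/= -addnA addnCA leq_addr.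
have leK s : (s <= K s)%N by rewrite leq_addl.
have K_mono s : (K s <= K s.+1)%N.
  by rewrite /K [X in (_ <= X + _)%N]big_ord_recr/= leq_add// leq_addr.
pose Phi s := minorant g s (K s).
(* Summing the levels of all pieces used in [Phi s] gives a computable bound of their maximum. *)
pose L s := (\sum_(j < s.+1) \sum_(i < K s) piece_level g j i)%N.
have L_computable : computable L.
  apply: (computable_sum (g := fun s j => \sum_(i < K s) piece_level g j i)%N); last by comp.
  apply: (computable_sum (g := fun n i => piece_level g (nsnd n) i)); last first.
    by apply: (computable_comp K_computable); comp.
  have hg : computable (fun n => piece_code g (nsnd (nfst n)) (nsnd n)).
    by apply: (computable_comp g_computable); comp.
  by rewrite /piece_level; comp.
have hK : computable (fun n => npair n (K n)) by comp.
(* On [KR], [Phi s.+1 <= f], so the increment of [Phi] is at most [f - fs s] plus the residual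
   [fs s - Phi s]. *)
pose E s := N (f \- fs s) + ((4^-1 : R) ^+ s)%R%:E.
have mf : measurable_fun setT (f : borel X -> \bar R).
  by move/lscP: f_lsc => h; exact: (measurable_eff_lower 0%N h).
have mfs s : measurable_fun setT (fs s : borel X -> \bar R) by exact: measurable_eff_lower fs_lower.
have mPhi s : measurable_fun setT (Phi s : borel X -> \bar R).
  exact: measurable_minorant.
have Phi_le_fs s y : KR y -> Phi s y <= fs s y by exact: minorant_le_fs.
have Phi_fin s y : Phi s y \is a fin_num by exact: minorant_fin.
have Phi_mono s y : Phi s y <= Phi s.+1 y by exact: minorant_mono.
apply: (@MDR_cvg_integral_rho Phi (fun s => minorant_bound (K s)) L
  _ _ _ _ _ _ _ _ _ E _ _ f) => //.
- by move=> s y; exact: minorant_ge0.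
- by move=> s y; exact: minorant_le_bound.
- exact: computable_minorant_bound.
- apply: eff_lower_ext (eff_lower_subst (eff_lower_minorant g_computable) hK).
  by move=> s y _; rewrite !npairE.
- apply: eff_upper_ext (eff_upper_subst (eff_upper_minorant g_computable) hK).
  by move=> s y _; rewrite !npairE.
- move=> s n y z Ln; apply: (minorant_atom) => j i js iK; apply: leq_trans Ln.
  rewrite /L (bigD1 (Ordinal (js : (j < s.+1)%N)))//= (bigD1 (Ordinal iK))//=.
  by rewrite -addnA leq_addr.
- move=> s.
  have m1 : measurable_fun setT (fun y : borel X => `|f y - fs s y|).
    by apply: measurableT_comp => //; exact: emeasurable_funB.
  have m2 : measurable_fun setT (fun y : borel X => Order.max 0 (fs s y - Phi s y)).
    by apply: measurable_maxe => //; exact: emeasurable_funB.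
  apply: (@le_trans _ _ (N (fun y : borel X => `|f y - fs s y| + Order.max 0 (fs s y - Phi s y)))).
    apply: (ae_le_Lnorm (ltW p_gt1)); [exact: emeasurable_funB|exact: emeasurable_funD|].
    apply: ae_KR => y Ky.
    have d0 : 0 <= Phi s.+1 y - Phi s y by rewrite sube_ge0 ?Phi_fin.
    have h0 : 0 <= `|f y - fs s y| + Order.max 0 (fs s y - Phi s y).
      by apply: adde_ge0 => //; rewrite le_max lexx.
    rewrite (gee0_abs d0) (gee0_abs h0) max_r ?sube_ge0 ?Phi_fin ?Phi_le_fs//.
    have Phi_f : Phi s.+1 y <= f y by apply: le_trans (fs_le s.+1 y Ky); exact: Phi_le_fs.
    (* Where [fs s] is infinite, [f - fs s] carries no information, but [Phi s] is finite, so the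
       residual is infinite and the bound trivial. *)
    have [fs_fin|fs_inf] := boolP (fs s y \is a fin_num).
      apply: (@le_trans _ _ ((f y - fs s y) + (fs s y - Phi s y))).
        by rewrite addeA subeK// leeB.
      by apply: leeD => //; exact: lee_abs.
    have -> : fs s y = +oo by move: fs_inf (fs_ge0 s y); case: (fs s y).
    have -> : +oo - Phi s y = +oo by move: (Phi_fin s y); case: (Phi s y).
    by rewrite addey ?leey// -ltNye; apply: lt_le_trans (abse_ge0 _).
  have max0 y : 0 <= Order.max 0 (fs s y - Phi s y) by rewrite le_max lexx.
  apply: (le_trans (@ge0_minkowski _ (borel X) _ nu _ (ltW p_gt1) _ _ m1 m2 (fun y => abse_ge0 _) max0)).
  apply: leeD; first by rewrite -[leRHS]Lnorm_abse.
  exact: (minorant_residual fs_ge0 fs_mono g_enum fs_lower rE (kK s) (kP s)).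
- move=> i.
  under eq_eseriesr => s _ do rewrite ge0_muleDl ?Lnorm_ge0 ?lee_fin ?exprn_ge0//.
  rewrite nneseriesD => [|s _ _|s _ _]; last 2 first.
    by rewrite mule_ge0 ?Lnorm_ge0.
    by rewrite mule_ge0 ?lee_fin ?exprn_ge0.
  by rewrite lte_add_pinfty ?fs_sum ?quarter_polynomial_summable.
- move=> y Ky; apply/eqP; rewrite eq_le; apply/andP; split; last first.
    apply: ge_ereal_sup => _ [s _ <-]; exact: le_trans (Phi_le_fs s y Ky) (fs_le s y Ky).
  set t := ereal_sup _; have Phi_t s : Phi s y <= t by apply: ereal_sup_ubound; exists s.
  have t0 : 0 <= t by apply: le_trans (Phi_t 0%N); exact: minorant_ge0.
  have [_ ->] := fs_sup y Ky; apply: ge_ereal_sup => _ [s _ <-].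
  rewrite leNgt; apply/negP => /(piece_sup g_enum Ky t0)[i].
  (* Piece [i] of [fs s] takes part in [Phi t] as soon as [s <= t] and [i < K t]; since [t <= K t],
     the index [maxn s i.+1] satisfies both. *)
  apply/negP; rewrite -leNgt; apply: le_trans (Phi_t (maxn s i.+1)).
  apply: piece_le_minorant; first exact: leq_maxl.
  by apply: leq_trans (leK _); exact: leq_maxr.
- by rewrite ge0_fin_numE// MDRx.
Qed.

End MaximalDoobTests.

Theorem theorem1p11 (R : realType) (X : completeMetricType R) (a : nat -> X)
    (nu : probability (borel X) R) (F : nat -> set (set X))
    (rho : nat -> R.-ker (borel X) ~> (borel X)) (p : R)
    (X_polish : computable_polish a)
    (nu_computable : computable_measure a nu)
    (F_filtration : almost_full_effective_filtration a nu F)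
    (rho_disintegrations : uniform_kurtz_disintegrations a nu F rho)
    (p_computable : computable_real p) (p_gt1 : (1 < p)%R) (x : X) :
  [<-> MDR a nu p x;
       KR a nu x /\
       forall f, maximal_doob_test a nu p f ->
         f x \is a fin_num /\ \int[rho n x]_y f y @[n --> \oo] --> f x;
       KR a nu x /\
       forall f, maximal_doob_test a nu p f ->
         exists l : R, \int[rho n x]_y f y @[n --> \oo] --> l%:E].
Proof.
have [F_mono [A [F_gen [B B_basis A_alg] A_cover]]] := F_filtration.
have [rho_dis rho_lsc] := rho_disintegrations.
tfae.
- move=> MDRx; split; first exact: (MDR_KR X_polish nu_computable p_computable p_gt1 B_basis MDRx).
  move=> f f_test; have [_ f_ge0 _ _] := f_test; split.
    by rewrite ge0_fin_numE// MDRx.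
  exact: (MDR_cvg X_polish nu_computable p_computable p_gt1 B_basis F_mono F_gen A_alg A_cover rho_dis rho_lsc).
- move=> [Kx h]; split=> // f /h[fx fl]; exists (fine (f x)); by rewrite fineK.
- move=> [Kx h] f f_test; have [l fl] := h f f_test; have [f_lsc f_ge0 _ _] := f_test.
  rewrite ltNge; apply/negP; rewrite leye_eq => /eqP fx.
  (* If [f x] were infinite, the lower bound would apply above any real, in particular at [l + 1],
     contradicting the limit [l]. *)
  have [|n0 hn] := lsc_liminf B_basis F_mono F_gen A_alg A_cover rho_dis (q := (l + 1)%R)
    f_lsc f_ge0 Kx; first by rewrite fx ltry.
  have : (l + 1)%R%:E <= l%:E by apply: cvge_ge fl; exists n0.
  by rewrite lee_fin; apply/negP; rewrite -ltNge ltrDl.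
Qed.
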